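(* Let $Z$ be a random $n\times n$ Hermitian matrix (for each $n\ge0$, as defined in the context) with arbitrary distributions of the diagonal entries and of the entries above the diagonal, of expected value $0$, with moments $\lambda_{pq},\kappa_q$. For $a_1,a_2,c_1,c_2\in\mathbb{R}$ let $$H_2(t,a_1,a_2,c_1,c_2)=\sum_{n=0}^\infty \frac{t^n}{n!}\,\mathbb{E}\big[\det(Z+a_1J+c_1\mathrm{Id})\det(Z+a_2J+c_2\mathrm{Id})\big].$$ Then $$H_2(t,a_1,a_2,c_1,c_2)=P(t)\,Q(t),$$ where $$\begin{aligned}P(t)={}&1+(a_1+a_2)(\lambda_{21}+\lambda_{12})\frac{t^2}{2}+\frac{(a_1c_2+a_2c_1)t}{1-\lambda_{11}^2t^2}-\frac{\lambda_{11}(a_1c_1+a_2c_2)t^2}{1-\lambda_{11}^2t^2}\\&+a_1a_2\Bigg(\frac{\lambda_{11}t^2}{1-\lambda_{11}t}+\frac{t}{1-\lambda_{11}^2t^2}-t+\frac{e^{(\lambda_{02}-\lambda_{20})t}-1}{\lambda_{02}-\lambda_{20}e^{(\lambda_{02}-\lambda_{20})t}}\\&\quad+\Big((\lambda_{21}+\lambda_{12})\frac{t^2}{2}+\frac{c_2t}{1-\lambda_{11}^2t^2}-\frac{c_1\lambda_{11}t^2}{1-\lambda_{11}^2t^2}\Big)\Big((\lambda_{21}+\lambda_{12})\frac{t^2}{2}+\frac{c_1t}{1-\lambda_{11}^2t^2}-\frac{c_2\lambda_{11}t^2}{1-\lambda_{11}^2t^2}\Big)\Bigg)\end{aligned}$$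 and $$Q(t)=\frac{(\lambda_{02}-\lambda_{20})\exp\left((c_1c_2+\kappa_2-\lambda_{11}-\lambda_{20})t+\frac{t^2}{2}(\lambda_{22}-2\lambda_{11}^2-\lambda_{02}\lambda_{20})+\frac{c_1c_2\lambda_{11}^2t^3}{1-\lambda_{11}^2t^2}-\frac{t^2}{2}\frac{(c_1^2+c_2^2)\lambda_{11}}{1-\lambda_{11}^2t^2}\right)}{(1-\lambda_{11}t)\sqrt{1-\lambda_{11}^2t^2}\,\left(\lambda_{02}-\lambda_{20}e^{(\lambda_{02}-\lambda_{20})t}\right)}.$$ When $\lambda_{02}=\lambda_{20}$, the expressions $\frac{e^{(\lambda_{02}-\lambda_{20})t}-1}{\lambda_{02}-\lambda_{20}e^{(\lambda_{02}-\lambda_{20})t}}$ and $\frac{\lambda_{02}-\lambda_{20}}{\lambda_{02}-\lambda_{20}e^{(\lambda_{02}-\lambda_{20})t}}$ are to be read as their limits $\frac{t}{1-\lambda_{20}t}$ and $\frac{1}{1-\lambda_{20}t}$ respectively.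
   Context: The random $n\times n$ Hermitian matrix $Z$ has complex entries such that: $\{Z_{jj'}:1\le j<j'\le n\}$ are i.i.d. complex random variables, $Z_{j'j}=\overline{Z_{jj'}}$ for $j<j'$, the diagonal entries $\{Z_{jj}:1\le j\le n\}$ are real and i.i.d., and the family $\{Z_{jj}:1\le j\le n\}$ is independent of the family $\{Z_{jj'}:1\le j<j'\le n\}$ (real and imaginary parts of a given entry need not be independent). The two distributions do not depend on $n$. For $j<j'$, $\lambda_{pq}=\mathbb{E}\left[Z_{jj'}^p\,\overline{Z_{jj'}}^{\,q}\right]$, and $\kappa_q=\mathbb{E}[Z_{jj}^q]$. It is assumed that $\lambda_{10}=\kappa_1=0$, that the off-diagonal entries have finite fourth absolute moment, and that the diagonal entries have finite second moment. $J$ is the $n\times n$ all-ones matrix and $\mathrm{Id}$ is the identity matrix. The determinant of the $0\times0$ matrix is $1$. The identity is one of formal power series in $t$, with $\sqrt{1-x}$ the power series with constant term $1$. *)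

(* Defs.v *)
From HB Require Import structures.
From mathcomp Require Import all_boot all_order all_algebra.
From mathcomp Require Import complex.
From mathcomp Require Import all_classical all_reals all_analysis.

Set Implicit Arguments.
Unset Strict Implicit.
Unset Printing Implicit Defensive.

Import Order.TTheory GRing.Theory Num.Theory.
Import numFieldNormedType.Exports.

Local Open Scope classical_set_scope.
Local Open Scope ring_scope.
Local Open Scope complex_scope.

Record fps (K : Type) := Fps { fcoef : nat -> K }.

Reserved Notation "c %:S" (format "c %:S").

HB.instance Definition _ (K : Type) := gen_eqMixin (fps K).
HB.instance Definition _ (K : Type) := gen_choiceMixin (fps K).

Lemma fpsP (K : Type) (F G : fps K) : (forall n, fcoef F n = fcoef G n) -> F = G.
Proof. by case: F G => [f] [g] /= fg; congr Fps; apply/funext. Qed.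

Section FpsRing.
Variable K : fieldType.
Implicit Types (F G H : fps K) (c : K) (n : nat).

Definition fps_zero : fps K := Fps (fun=> 0).
Definition fps_opp F := Fps (fun n => - fcoef F n).
Definition fps_add F G := Fps (fun n => fcoef F n + fcoef G n).
Definition fps_const c := Fps (fun n => if n == 0%N then c else 0).
Definition fps_mul F G :=
  Fps (fun n => \sum_(i < n.+1) fcoef F i * fcoef G (n - i)).

Fact fps_addA : associative fps_add.
Proof. by move=> F G H; apply: fpsP => n /=; rewrite addrA. Qed.
Fact fps_addC : commutative fps_add.
Proof. by move=> F G; apply: fpsP => n /=; rewrite addrC. Qed.
Fact fps_add0 : left_id fps_zero fps_add.
Proof. by move=> F; apply: fpsP => n /=; rewrite add0r. Qed.
Fact fps_addN : left_inverse fps_zero fps_opp fps_add.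
Proof. by move=> F; apply: fpsP => n /=; rewrite addNr. Qed.

HB.instance Definition _ :=
  GRing.isZmodule.Build (fps K) fps_addA fps_addC fps_add0 fps_addN.

Definition fps_trunc n F : {poly K} := \poly_(i < n) fcoef F i.

Fact fps_mul_trunc F G n m : (n < m)%N ->
  fcoef (fps_mul F G) n = (fps_trunc m F * fps_trunc m G)`_n.
Proof.
move=> nm; rewrite coefM; apply: eq_bigr => i _; rewrite !coef_poly.
by rewrite (leq_ltn_trans _ nm) ?leq_ord// (leq_ltn_trans _ nm)// leq_subr.
Qed.

Fact fps_mulA : associative fps_mul.
Proof.
move=> F G H; apply: fpsP => n.
transitivity ((fps_trunc n.+1 F * (fps_trunc n.+1 G * fps_trunc n.+1 H))`_n).
  rewrite coefM; apply: eq_bigr => i _.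
  rewrite (@fps_mul_trunc _ _ _ n.+1) ?ltnS ?leq_subr//.
  by rewrite coef_poly ltn_ord.
rewrite mulrA coefM; apply: eq_bigr => i _.
rewrite (@fps_mul_trunc _ _ _ n.+1)//.
by rewrite coef_poly ltnS leq_subr.
Qed.
Fact fps_mulC : commutative fps_mul.
Proof.
by move=> F G; apply: fpsP => n; rewrite !(@fps_mul_trunc _ _ _ n.+1)// mulrC.
Qed.
Fact fps_mul1 : left_id (fps_const 1) fps_mul.
Proof.
move=> F; apply: fpsP => n /=; rewrite big_ord_recl /= mul1r subn0.
by rewrite big1 ?addr0// => i _; rewrite mul0r.
Qed.
Fact fps_mulDl : left_distributive fps_mul fps_add.
Proof.
move=> F G H; apply: fpsP => n /=; rewrite -big_split /=.
by apply: eq_bigr => i _; rewrite mulrDl.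
Qed.
Fact fps_oner_neq0 : fps_const 1 != 0.
Proof. by apply/eqP => /(congr1 (fun F => fcoef F 0))/eqP; rewrite oner_eq0. Qed.

HB.instance Definition _ := GRing.Zmodule_isComNzRing.Build (fps K)
  fps_mulA fps_mulC fps_mul1 fps_mulDl fps_oner_neq0.

Fixpoint fps_inv_seq F n : seq K :=
  if n is m.+1 then
    let s := fps_inv_seq F m in
    rcons s (- (fcoef F 0)^-1 * \sum_(i < m.+1) fcoef F i.+1 * s`_(m - i))
  else [:: (fcoef F 0)^-1].

Definition fps_unit : pred (fps K) := fun F => fcoef F 0 != 0.

Definition fps_inv F :=
  if fps_unit F then Fps (fun n => (fps_inv_seq F n)`_n) else F.

Lemma size_fps_inv_seq F n : size (fps_inv_seq F n) = n.+1.
Proof. by elim: n => //= n IHn; rewrite size_rcons IHn. Qed.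

Lemma nth_fps_inv_seq F n i : (i <= n)%N ->
  (fps_inv_seq F n)`_i = (fps_inv_seq F i)`_i.
Proof.
elim: n => [|n IHn]; first by rewrite leqn0 => /eqP->.
rewrite leq_eqVlt => /predU1P[->//|lin] /=.
by rewrite nth_rcons size_fps_inv_seq lin IHn.
Qed.

Fact fps_mulV : {in fps_unit, left_inverse 1 fps_inv *%R}.
Proof.
move=> F; rewrite unfold_in => F0; rewrite mulrC /fps_inv /fps_unit F0; apply: fpsP => n.
rewrite [LHS]/= big_ord_recl subn0; case: n => [|n].
  by rewrite big_ord0 addr0 /= mulfV.
rewrite [_`_n.+1]/= nth_rcons size_fps_inv_seq ltnn eqxx mulrA mulrN mulfV//.
rewrite mulN1r; apply/eqP; rewrite addrC subr_eq0; apply/eqP.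
apply: eq_bigr => i _ /=; rewrite subSS; congr (_ * _).
by rewrite (@nth_fps_inv_seq _ n)// leq_subr.
Qed.

Fact fps_unitP F G : G * F = 1 -> fps_unit F.
Proof.
move=> /(congr1 (fun H => fcoef H 0)) /=; rewrite big_ord1 subn0 => GF.
by apply: contra_eq_neq GF => ->; rewrite mulr0 eq_sym oner_neq0.
Qed.

Fact fps_inv_out : {in [predC fps_unit], fps_inv =1 id}.
Proof. by move=> F; rewrite inE unfold_in /fps_inv /fps_unit => /negbTE->. Qed.

HB.instance Definition _ := GRing.ComNzRing_hasMulInverse.Build (fps K)
  fps_mulV fps_unitP fps_inv_out.

Definition fps_var : fps K := Fps (fun n => (n == 1%N)%:R).

(* Substitution of [F] into the exponential series; meaningful only when [F]
   has zero constant term, since [F ^+ k] then has no term of degree < k. *)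
Definition fps_exp F : fps K :=
  Fps (fun n => \sum_(k < n.+1) k`!%:R^-1 * fcoef (F ^+ k) n).

(* Square root with constant term 1; meaningful only when [F] itself has
   constant term 1, see [fps_sqrtK] and [fps_sqrt_uniq]. *)
Fixpoint fps_sqrt_seq F n : seq K :=
  if n is m.+1 then
    let s := fps_sqrt_seq F m in
    rcons s ((fcoef F n - \sum_(i < m) s`_i.+1 * s`_(m - i)) / 2)
  else [:: 1].

Definition fps_sqrt F : fps K := Fps (fun n => (fps_sqrt_seq F n)`_n).

Lemma size_fps_sqrt_seq F n : size (fps_sqrt_seq F n) = n.+1.
Proof. by elim: n => //= n IHn; rewrite size_rcons IHn. Qed.

Lemma nth_fps_sqrt_seq F n i : (i <= n)%N ->
  (fps_sqrt_seq F n)`_i = fcoef (fps_sqrt F) i.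
Proof.
elim: n => [|n IHn]; first by rewrite leqn0 => /eqP->.
rewrite leq_eqVlt => /predU1P[->//|lin] /=.
by rewrite nth_rcons size_fps_sqrt_seq lin IHn.
Qed.

Lemma fps_sqrt0 F : fcoef (fps_sqrt F) 0 = 1.
Proof. by []. Qed.

Lemma fps_sqrtS F n : let S := fps_sqrt F in
  fcoef S n.+1 =
  (fcoef F n.+1 - \sum_(i < n) fcoef S i.+1 * fcoef S (n - i)) / 2.
Proof.
move=> S; rewrite [LHS]/= nth_rcons size_fps_sqrt_seq ltnn eqxx.
congr ((_ - _) / _); apply: eq_bigr => i _.
by rewrite !nth_fps_sqrt_seq// leq_subr.
Qed.

Lemma fps_sqrtK F : 2 != 0 :> K -> fcoef F 0 = 1 -> fps_sqrt F ^+ 2 = F.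
Proof.
move=> K2 F0; apply: fpsP => -[|n].
  by rewrite expr2 [LHS]/= big_ord1 F0 mulr1.
have := fps_sqrtS F n; have := fps_sqrt0 F; rewrite expr2.
move: (fps_sqrt F) => S S0 /= Sn.
rewrite big_ord_recl big_ord_recr /= subn0 /bump /= add1n subnn S0 mul1r mulr1.
under eq_bigr => i _ do rewrite add1n subSS.
by rewrite addrCA -mulr2n -mulr_natr Sn divfK// subrKC.
Qed.

Lemma fps_sqrt_uniq F G : 2 != 0 :> K ->
  fcoef G 0 = 1 -> G ^+ 2 = F -> G = fps_sqrt F.
Proof.
move=> K2 G0 GF.
have F0 : fcoef F 0 = 1 by rewrite -GF expr2 [LHS]/= big_ord1 G0 mulr1.
have := fps_sqrtK K2 F0; rewrite -{2}GF => /esym/eqP.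
rewrite -subr_eq0 subr_sqr => /eqP GS.
have uGS : G + fps_sqrt F \is a GRing.unit.
  by rewrite /in_mem /= /fps_unit /= G0.
apply/eqP; rewrite -subr_eq0; apply/eqP/(mulIr uGS).
by rewrite GS mul0r.
Qed.

End FpsRing.

Arguments fps_var {K}.
Notation "c %:S" := (fps_const c) : ring_scope.

Section ComplexMeasurable.
Variable R : realType.

HB.instance Definition _ := isPointed.Build R[i] 0.

Definition complex_pair (z : R[i]) : measurableTypeR R * measurableTypeR R :=
  (complex.Re z, complex.Im z).

Let complex_measurable : set (set R[i]) :=
  g_sigma_algebra_preimage complex_pair.

Fact complex_measurable0 : complex_measurable set0.
Proof. exact: (@measurable0 _ (g_sigma_algebra_preimageType complex_pair)). Qed.

Fact complex_measurableC A : complex_measurable A -> complex_measurable (~` A).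
Proof.
exact: (@measurableC _ (g_sigma_algebra_preimageType complex_pair)).
Qed.

Fact complex_measurable_bigcup (F : (set R[i])^nat) :
  (forall i, complex_measurable (F i)) -> complex_measurable (\bigcup_i F i).
Proof.
exact: (@bigcupT_measurable _ (g_sigma_algebra_preimageType complex_pair)).
Qed.

(* The Borel sigma-algebra of C, obtained by identifying C with R * R. *)
HB.instance Definition _ := @isMeasurable.Build (preimage_display complex_pair)
  R[i] complex_measurable complex_measurable0 complex_measurableC
  complex_measurable_bigcup.

End ComplexMeasurable.

(* [fine] makes this total; it is the usual expectation as soon as the real and
   imaginary parts of [X] are integrable. *)
Definition complex_expectation d (T : measurableType d) (R : realType)
    (P : probability T R) (X : T -> R[i]) : R[i] :=
  fine 'E_P[fun w => complex.Re (X w)] +i* fine 'E_P[fun w => complex.Im (X w)].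

Section Independence.
Context d (T : measurableType d) (R : realType) (P : probability T R).

Definition mutually_independent d' (E : measurableType d') (I : finType)
    (X : I -> T -> E) : Prop :=
  forall (J : {set I}) (A : I -> set E), (forall i, measurable (A i)) ->
  P (\bigcap_(i in [set` J]) X i @^-1` A i) =
  (\prod_(i in J) P (X i @^-1` A i))%E.

Definition sigma_family d' (E : measurableType d') (I : Type)
    (X : I -> T -> E) : set (set T) :=
  <<s [set B | exists i, exists2 A, measurable A & B = X i @^-1` A] >>.

Definition independent_families d1 (E1 : measurableType d1) (I1 : Type)
    (X1 : I1 -> T -> E1) d2 (E2 : measurableType d2) (I2 : Type)
    (X2 : I2 -> T -> E2) : Prop :=
  forall A B, sigma_family X1 A -> sigma_family X2 B ->
  P (A `&` B) = (P A * P B)%E.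

Record iid d' (E : measurableType d') (law : probability E R) (I : finType)
    (X : I -> T -> E) : Prop := Iid {
  iid_measurable : forall i, measurable_fun setT (X i);
  iid_law : forall i A, measurable A -> P (X i @^-1` A) = law A;
  iid_independent : mutually_independent X
}.

End Independence.

Definition upper_index (n : nat) : finType :=
  {p : 'I_n * 'I_n | (p.1 < p.2)%N}.

Section RandomHermitian.
Context d (T : measurableType d) (R : realType) (P : probability T R).

Definition upper_entries n (Z : T -> 'M[R[i]]_n) (p : upper_index n) (w : T) :
  R[i] := Z w (val p).1 (val p).2.

Definition diagonal_entries n (Z : T -> 'M[R[i]]_n) (j : 'I_n) (w : T) :
  measurableTypeR R := complex.Re (Z w j j).

Record random_hermitian (mu : probability R[i] R)
    (nu : probability (measurableTypeR R) R) n (Z : T -> 'M[R[i]]_n) : Prop :=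
  RandomHermitian {
    random_hermitian_conj :
      forall w (j k : 'I_n), (j < k)%N -> Z w k j = (Z w j k)^*;
    random_hermitian_diag : forall w j, complex.Im (Z w j j) = 0;
    random_hermitian_upper_iid : iid P mu (upper_entries Z);
    random_hermitian_diag_iid : iid P nu (diagonal_entries Z);
    random_hermitian_indep :
      independent_families P (diagonal_entries Z) (upper_entries Z)
  }.

End RandomHermitian.

Definition lambda_moment (R : realType) (mu : probability R[i] R) (p q : nat) :
  R[i] := complex_expectation mu (fun z => z ^+ p * (z^*) ^+ q).

Definition kappa_moment (R : realType)
    (nu : probability (measurableTypeR R) R) (q : nat) : R :=
  fine 'E_nu[fun x => x ^+ q].

Definition H2_series (R : realType) (d : nat -> measure_display)
    (T : forall n, measurableType (d n)) (P : forall n, probability (T n) R)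
    (Z : forall n, T n -> 'M[R[i]]_n) (a1 a2 c1 c2 : R) : fps R[i] :=
  Fps (fun n => n`!%:R^-1 * complex_expectation (P n) (fun w =>
    \det (Z n w + a1%:C *: const_mx 1 + c1%:C%:M) *
    \det (Z n w + a2%:C *: const_mx 1 + c2%:C%:M))).

Section Factors.
Variables (K : fieldType) (l : nat -> nat -> K) (k2 : K).
Variables (a1 a2 c1 c2 : K).

Local Notation t := (fps_var : fps K).
Local Notation l11 := (l 1 1).
Local Notation l20 := (l 2 0).
Local Notation l02 := (l 0 2).
Local Notation l21 := (l 2 1).
Local Notation l12 := (l 1 2).
Local Notation l22 := (l 2 2).
Local Notation D := (1 - (l11 ^+ 2)%:S * t ^+ 2).
Local Notation E := (fps_exp ((l02 - l20)%:S * t)).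

(* When l02 = l20 the numerator and the denominator of the general form of the
   two quotients below both vanish, and their limits as l02 - l20 tends to 0 are
   taken instead; otherwise the denominator has nonzero constant term. *)
Definition ratio_expm1 : fps K :=
  if l02 == l20 then t / (1 - l20%:S * t)
  else (E - 1) / (l02%:S - l20%:S * E).

Definition ratio_const : fps K :=
  if l02 == l20 then (1 - l20%:S * t)^-1
  else (l02 - l20)%:S / (l02%:S - l20%:S * E).

Definition P_series : fps K :=
  1 + (a1 + a2)%:S * (l21 + l12)%:S * (t ^+ 2 / 2)
  + (a1 * c2 + a2 * c1)%:S * t / D
  - l11%:S * (a1 * c1 + a2 * c2)%:S * t ^+ 2 / D
  + (a1 * a2)%:S *
    (l11%:S * t ^+ 2 / (1 - l11%:S * t) + t / D - t + ratio_expm1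
     + ((l21 + l12)%:S * (t ^+ 2 / 2) + c2%:S * t / D
        - (c1 * l11)%:S * t ^+ 2 / D)
       * ((l21 + l12)%:S * (t ^+ 2 / 2) + c1%:S * t / D
          - (c2 * l11)%:S * t ^+ 2 / D)).

Definition Q_series : fps K :=
  ratio_const
  * fps_exp ((c1 * c2 + k2 - l11 - l20)%:S * t
             + t ^+ 2 / 2 * (l22 - 2 * l11 ^+ 2 - l02 * l20)%:S
             + (c1 * c2 * l11 ^+ 2)%:S * t ^+ 3 / D
             - t ^+ 2 / 2 * (((c1 ^+ 2 + c2 ^+ 2) * l11)%:S / D))
  / ((1 - l11%:S * t) * fps_sqrt D).

End Factors.

(* Main.v *)
Require Import Defs.
From HB Require Import structures.
From mathcomp Require Import all_boot all_order all_algebra.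
From mathcomp Require Import perm complex ring.
From mathcomp Require Import all_classical all_reals all_analysis.
From mathcomp Require Import measurable_realfun.

Set Implicit Arguments.
Unset Strict Implicit.
Unset Printing Implicit Defensive.

Import Order.TTheory GRing.Theory Num.Theory.
Import numFieldNormedType.Exports.

Local Open Scope classical_set_scope.
Local Open Scope ring_scope.
Local Open Scope complex_scope.

(* Only the moments lambda_pq with p, q <= 2 and kappa_q with q <= 2 enter the
   statement, and they are matched by a product law with finitely many atoms and
   weights in the field of coefficients; there the expectation is a finite sum
   and conditioning on everything but the row and column of one vertex is a
   reindexing.  Put A1 = Z + c1, A2 = Z + c2, and let s(A) be the sum of the
   entries of adj A, so that det (A + a J) = det A + a s(A).  Expanding along
   the row and column of one vertex yields recursions in n for E[det A1 det A2],
   E[s(A1) det A2] and E[s(A1) s(A2)] in terms of the same kind of expectations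
   on one vertex less and of
     u_i = E[(adj A1 1)_i (1 adj A2)_i] and y_i = E[(adj A1 1)_i (adj A2 1)_i].
   The order of the indices only matters for y_i, where y_(i+1) - y_i is
   (lambda_02 - lambda_20) times y_i on one vertex less; this is the source of
   the factors exp((lambda_02 - lambda_20) t).  For exponential generating
   functions the recursions are linear equations over the power series, except
   for the one of E[det A1 det A2], which is a first order differential equation
   F' = F G; the series Q solves it with the same constant term. *)

(** * Inserting a vertex in a matrix *)

(** Expanding both determinants over permutations makes every entry occur with degree at most 2, so
    a pair of conjugate entries is seen only through the moments [p, q <= 2]. All later recursions
    are algebraic identities, so the weights of the model need be neither real nor positive, and its
    two coordinates need not be conjugate. Each denominator of the answer comes from solving one
    linear equation. Giving an extra vertex to only one of two factors yields two kinds of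
    expectation, each expressed through the other on one vertex less; eliminating one leaves the
    factor [1 - l11^2 t^2]. The sums U of u_i satisfy U = t (F + l11 U), whence [1 - l11 t]. The
    sums V of y_i satisfy V = Psi (F + l20 V) with Psi = (e^(ct) - 1)/c and c = l02 - l20; working
    with Psi instead of exponentials removes the distinction between c = 0 and c <> 0. The recursion
    for E[det A1 det A2] involves the sums over j of (adj A1)_ij (adj A2)_ij and of (adj A1)_ij (adj
    A2)_ji rather than y_i and u_i; they turn out to have the same expectations. *)

Section VertexInsertion.
Variable U : Type.

Definition ins n (i : 'I_n.+1) (d : U) (r q : 'I_n -> U) (B : 'M[U]_n) :
    'M[U]_n.+1 :=
  \matrix_(a, b) match unlift i a, unlift i b with
                 | Some k, Some l => B k l
                 | Some k, None => q k
                 | None, Some l => r l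
                 | None, None => d
                 end.

Definition pminor n (i : 'I_n.+1) (A : 'M[U]_n.+1) : 'M[U]_n :=
  mxsub (lift i) (lift i) A.

Lemma insE n (i : 'I_n.+1) d r q B :
  (ins i d r q B i i = d) * (forall k, ins i d r q B i (lift i k) = r k) *
  (forall k, ins i d r q B (lift i k) i = q k) *
  (forall k l, ins i d r q B (lift i k) (lift i l) = B k l).
Proof. by do !split => *; rewrite mxE ?unlift_none ?liftK. Qed.

Lemma pminor_ins n (i : 'I_n.+1) d r q B : pminor i (ins i d r q B) = B.
Proof. by apply/matrixP => k l; rewrite !mxE !liftK. Qed.

Lemma ins_pminor n (i : 'I_n.+1) (A : 'M[U]_n.+1) :
  ins i (A i i) (fun k => A i (lift i k)) (fun k => A (lift i k) i) (pminor i A)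
  = A.
Proof.
apply/matrixP => a b; rewrite !mxE.
by case: unliftP => [k|] ->; case: unliftP => [l|] ->; rewrite ?mxE.
Qed.

Lemma eq_ins n (i : 'I_n.+1) d r r' q q' B : r =1 r' -> q =1 q' ->
  ins i d r q B = ins i d r' q' B.
Proof.
move=> rr qq; apply/matrixP => a b; rewrite !mxE.
by case: unliftP => // [k|] _; case: unliftP.
Qed.

End VertexInsertion.

(** * Determinants and adjugates of bordered matrices *)

Section BorderedMatrices.
Variable K : comNzRingType.

Lemma ins_addC n (i : 'I_n.+1) d r q (B : 'M[K]_n) c :
  ins i d r q B + c%:M = ins i (d + c) r q (B + c%:M).
Proof.
apply/matrixP => a b; rewrite !mxE.
case: unliftP => [k|] ->; case: unliftP => [l|] -> //; rewrite ?mxE ?eqxx//.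
- by rewrite (inj_eq (@lift_inj _ i)).
- by rewrite eq_sym (negbTE (neq_lift _ _)) addr0.
- by rewrite (negbTE (neq_lift _ _)) addr0.
Qed.

Lemma pminor_addC n (i : 'I_n.+1) (A : 'M[K]_n.+1) c : pminor i (A + c%:M) = pminor i A + c%:M.
Proof. by apply/matrixP => a b; rewrite !mxE (inj_eq (@lift_inj _ i)). Qed.

Lemma cofactor_diag n (i : 'I_n.+1) (A : 'M[K]_n.+1) : cofactor A i i = \det (pminor i A).
Proof.
rewrite /cofactor -signr_odd oddD addbb mul1r; congr (\det _).
by apply/matrixP => a b; rewrite !mxE.
Qed.

Definition simperm n (s : 'S_n) (A : 'M[K]_n) : 'M[K]_n :=
  \matrix_(i, j) A (s i) (s j).

Lemma det_simperm n (s : 'S_n) A : \det (simperm s A) = \det A.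
Proof.
have -> : simperm s A = row_perm s (col_perm s A).
  by apply/matrixP => i j; rewrite !mxE.
rewrite row_permE col_permE !det_mulmx !det_perm odd_permV mulrCA.
by rewrite -signr_addb addbb mulr1.
Qed.

(** A full-size determinant, unlike a minor, is relabelled directly by a permutation; this is what
    [adj_simperm] needs. *)
Lemma cofactor_det n (A : 'M[K]_n) i j :
  cofactor A i j = \det (\matrix_(a, b) if a == i then (b == j)%:R else A a b).
Proof.
case: n A i j => [? []//|n] A i j.
set A' := \matrix_(_, _) _.
rewrite (expand_det_row A' i) (bigD1 j)//= big1 => [|k kj]; last first.
  by rewrite mxE eqxx (negbTE kj) mul0r.
rewrite mxE !eqxx mul1r addr0 /cofactor; congr (_ * \det _).
by apply/matrixP => a b; rewrite /A' !mxE eq_sym (negbTE (neq_lift _ _)).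
Qed.

Lemma adj_simperm n (s : 'S_n) A i j :
  (\adj (simperm s A)) i j = (\adj A) (s i) (s j).
Proof.
rewrite !mxE !cofactor_det -[RHS](det_simperm s); congr (\det _).
apply/matrixP => a b; rewrite !mxE (inj_eq perm_inj); case: eqP => // _.
by rewrite (inj_eq perm_inj).
Qed.

(** A simultaneous permutation of rows and columns brings vertex [i] to the front, so that signs of
    cofactors have to be followed at [ord0] only. *)
Lemma ins_simperm n (i : 'I_n.+1) d r q (B : 'M[K]_n) :
  ins i d r q B = simperm (lift_perm i ord0 1) (ins ord0 d r q B).
Proof.
apply/matrixP => a b; rewrite [RHS]mxE; case: (unliftP i a) => [k|] ->;
  case: (unliftP i b) => [l|] ->;
  by rewrite ?lift_perm_id ?lift_perm_lift ?perm1 ?insE// lift_perm_lift perm1 insE.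
Qed.

Lemma lift_lift0 n (j : 'I_n.+1) (a : 'I_n) :
  lift (lift ord0 j) (lift ord0 a) = lift ord0 (lift j a).
Proof. by apply: val_inj; rewrite /= /bump !leq0n !add1n ltnS addnS. Qed.

Lemma lift_lift00 n (j : 'I_n.+1) : lift (lift ord0 j) ord0 = ord0.
Proof. exact: val_inj. Qed.

Lemma adj_ins_row n (i : 'I_n.+1) d r q (B : 'M[K]_n) j :
  (\adj (ins i d r q B)) i (lift i j) = - \sum_k r k * (\adj B) k j.
Proof.
rewrite ins_simperm adj_simperm lift_perm_id lift_perm_lift perm1 mxE.
case: n i B j r q => [|n] i B j r q; first by case: j.
(* Row [j] of [B] has index [j + 1] in the bordered matrix, which is the origin of the minus sign;
   the row left at the front is [r]. *)
rewrite /cofactor (expand_det_row _ ord0) /= addn0 exprSr mulrN1 mulNr.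
congr (- _); rewrite mulr_sumr; apply: eq_bigr => k _.
rewrite 2![in LHS]mxE lift_lift00 insE mulrCA; congr (_ * _).
rewrite mxE /cofactor mulrA add0n -exprD; congr (_ * \det _).
by apply/matrixP => a b; rewrite !mxE lift_lift0 !liftK.
Qed.

Lemma tr_ins n (i : 'I_n.+1) d r q (B : 'M[K]_n) : (ins i d r q B)^T = ins i d q r B^T.
Proof.
apply/matrixP => a b; rewrite !mxE.
by case: unliftP => [k|] _; case: unliftP => [l|] _; rewrite ?mxE.
Qed.

Lemma adj_ins_col n (i : 'I_n.+1) d r q (B : 'M[K]_n) j :
  (\adj (ins i d r q B)) (lift i j) i = - \sum_k (\adj B) j k * q k.
Proof.
have -> : (\adj (ins i d r q B)) (lift i j) i =
    (\adj (ins i d r q B))^T i (lift i j) by rewrite [RHS]mxE.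
rewrite trmx_adj tr_ins adj_ins_row; congr (- _).
by apply: eq_bigr => k _; rewrite -trmx_adj mxE mulrC.
Qed.

Lemma adj_ins_diag n (i : 'I_n.+1) d r q (B : 'M[K]_n) : (\adj (ins i d r q B)) i i = \det B.
Proof. by rewrite mxE cofactor_diag pminor_ins. Qed.

(** Cauchy's formula for a bordered determinant; stated with the adjugate, it also covers singular
    [B]. *)
Lemma det_ins n (i : 'I_n.+1) d r q (B : 'M[K]_n) :
  \det (ins i d r q B) =
  d * \det B - \sum_k \sum_l r k * (\adj B) k l * q l.
Proof.
rewrite (expand_det_col _ i) (bigD1_ord i)//= insE cofactor_diag pminor_ins.
congr (_ + _); rewrite exchange_big -sumrN; apply: eq_bigr => l _ /=.
have -> : cofactor (ins i d r q B) (lift i l) i =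
    (\adj (ins i d r q B)) i (lift i l) by rewrite mxE.
by rewrite adj_ins_row insE mulrN mulrC mulr_suml.
Qed.

Definition bform n (x y : 'I_n -> K) (A : 'M[K]_n) : K :=
  \sum_k \sum_l x k * (\adj A) k l * y l.

(** Seeing a bilinear form in the adjugate as a determinant reduces its behaviour under insertion of
    a vertex to [det_ins]. *)
Lemma det_bordered n (x y : 'I_n -> K) A :
  \det (ins ord0 0 x y A) = - bform x y A.
Proof. by rewrite det_ins mul0r add0r. Qed.

(** Exchanges the border with the vertex [i], so that [det_ins] can expand along [i]; the two cross
    at the entries [y i] and [x i]. *)
Lemma bordered_ins n (i : 'I_n.+1) x y d r q (B : 'M[K]_n) :
  ins ord0 0 x y (ins i d r q B) =
  ins (lift ord0 i) d (fun k => if unlift ord0 k is Some l then r l else y i)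
    (fun k => if unlift ord0 k is Some l then q l else x i)
    (ins ord0 0 (x \o lift i) (y \o lift i) B).
Proof.
rewrite -[LHS](ins_pminor (lift ord0 i)); congr ins.
- by rewrite !insE.
- apply/funext => k; case: unliftP => [l|] ->.
    by rewrite lift_lift0 !insE.
  by rewrite lift_lift00 !insE.
- apply/funext => k; case: unliftP => [l|] ->.
    by rewrite lift_lift0 !insE.
  by rewrite lift_lift00 !insE.
- apply/matrixP => a b; rewrite [LHS]mxE.
  by case: (unliftP ord0 a) => [k|] ->; case: (unliftP ord0 b) => [l|] ->;
    rewrite ?lift_lift0 ?lift_lift00 !insE.
Qed.

Lemma pminor_bordered n (p : 'I_n.+1) x y (B : 'M[K]_n.+1) :
  pminor (lift ord0 p) (ins ord0 0 x y B) =
  ins ord0 0 (x \o lift p) (y \o lift p) (pminor p B).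
Proof.
apply/matrixP => a b; rewrite [LHS]mxE.
by case: (unliftP ord0 a) => [k|] ->; case: (unliftP ord0 b) => [l|] ->;
    rewrite ?lift_lift0 ?lift_lift00 !insE// !mxE.
Qed.

(** Up to sign, the coefficient of [r p * q m] in the form of a matrix with one vertex inserted; the
    sign is the one that [expands] requires on the diagonal. *)
Definition bform2 n (x y : 'I_n -> K) (B : 'M[K]_n) (p m : 'I_n) : K :=
  - (\adj (ins ord0 0 x y B)) (lift ord0 p) (lift ord0 m).

Lemma bform2_diag n x y (B : 'M[K]_n.+1) p :
  bform2 x y B p p = bform (x \o lift p) (y \o lift p) (pminor p B).
Proof.
by rewrite /bform2 mxE cofactor_diag pminor_bordered det_bordered opprK.
Qed.

Lemma bform_ins n (i : 'I_n.+1) x y d r q (B : 'M[K]_n) :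
  bform x y (ins i d r q B) =
  x i * y i * \det B + d * bform (x \o lift i) (y \o lift i) B
  - \sum_k r k * (x i * \sum_l (\adj B) k l * y (lift i l))
  - \sum_l (y i * \sum_k x (lift i k) * (\adj B) k l) * q l
  - \sum_k \sum_l r k * bform2 (x \o lift i) (y \o lift i) B k l * q l.
Proof.
apply: oppr_inj; rewrite -det_bordered bordered_ins det_ins det_bordered.
rewrite (bigD1_ord ord0)//= unlift_none (bigD1_ord ord0)//= unlift_none.
rewrite adj_ins_diag.
have -> : \sum_(k < n) y i * (\adj (ins ord0 0 (x \o lift i) (y \o lift i) B)) ord0
    (lift ord0 k) * (if unlift ord0 (lift ord0 k) is Some l then q l else x i) =
  - \sum_l (y i * \sum_k x (lift i k) * (\adj B) k l) * q l.
  by rewrite -sumrN; apply: eq_bigr => k _; rewrite liftK adj_ins_row mulrN mulNr.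
under eq_bigr => k _.
  rewrite (bigD1_ord ord0)//= liftK unlift_none adj_ins_col.
  under eq_bigr => l _ do rewrite liftK.
  over.
rewrite big_split /= 2!opprD opprK.
have -> : \sum_(i0 < n) \sum_(l < n)
    r i0 * (\adj (ins ord0 0 (x \o lift i) (y \o lift i) B)) (lift ord0 i0) (lift ord0 l) * q l
  = - \sum_k \sum_l r k * bform2 (x \o lift i) (y \o lift i) B k l * q l.
  rewrite -sumrN; apply: eq_bigr => k _; rewrite -sumrN; apply: eq_bigr => l _.
  by rewrite /bform2 mulrN mulNr opprK.
have -> : \sum_(i0 < n) r i0 * (- \sum_k (\adj B) i0 k * (y \o lift i) k) * x i
  = - \sum_k r k * (x i * \sum_l (\adj B) k l * y (lift i l)).
  by rewrite -sumrN; apply: eq_bigr => k _ /=; ring.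
by ring.
Qed.

Lemma det_add_ones n (A : 'M[K]_n) a :
  \det (A + a *: const_mx 1) = \det A + a * bform (fun=> 1) (fun=> 1) A.
Proof.
(* Clearing the border column by row operations adds [a] to every entry of [A], while expanding
   along the border gives the form in the adjugate. *)
have E : ins ord0 1 (fun=> - a) (fun=> 1) A =
  (block_mx 1%:M 0 (const_mx 1) 1%:M : 'M[K]_(1 + n)) *m
  (block_mx 1%:M (const_mx (- a)) 0 (A + a *: const_mx 1) : 'M[K]_(1 + n)).
  rewrite mulmx_block !mul1mx !mulmx1 !mul0mx ?addr0.
  have -> : (const_mx 1 : 'M[K]_(n, 1)) *m (const_mx (- a) : 'M[K]_(1, n))
    = - (a *: const_mx 1) :> 'M[K]_n.
    by apply/matrixP => k l; rewrite !mxE big_ord1 !mxE mul1r mulr1.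
  rewrite addrC addrK.
  have l0 : ord0 = lshift n (ord0 : 'I_1) by exact: val_inj.
  apply/matrixP => k l; case: (unliftP ord0 k) => [k'|] ->;
    case: (unliftP ord0 l) => [l'|] ->; rewrite !insE; symmetry.
  - by rewrite -!rshift1; exact: block_mxEdr.
  - rewrite -rshift1 l0; apply: etrans; first exact: block_mxEdl.
    by rewrite mxE.
  - rewrite -rshift1 l0; apply: etrans; first exact: block_mxEur.
    by rewrite mxE.
  - by rewrite l0; apply: etrans; [exact: block_mxEul | rewrite mxE].
have := congr1 (@determinant _ (1 + n)) E; rewrite det_mulmx det_lblock det_ublock !det1.
rewrite !mul1r => <-; rewrite det_ins mul1r; congr (_ + _).
rewrite /bform -sumrN mulr_sumr; apply: eq_bigr => k _.
by rewrite -sumrN mulr_sumr; apply: eq_bigr => l _; rewrite mul1r !mulNr opprK mulrA.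
Qed.

(* [phi] is affine in the inserted row and column, up to a bilinear part whose
   diagonal coefficients are the values of [phi] with one more vertex deleted. *)
Record expands (eps : K) (phi : forall n, 'M[K]_n -> K)
    (Th : forall n, 'M[K]_n -> 'I_n -> 'I_n -> K)
    (al be : forall n, 'M[K]_n -> 'I_n -> K) : Prop := Expands {
  expands_ins : forall n (i : 'I_n.+1) d r q B,
    phi n.+1 (ins i d r q B) =
    eps * \det B + d * phi n B - \sum_k r k * al n B k
    - \sum_l be n B l * q l - \sum_k \sum_l r k * Th n B k l * q l;
  expands_diag : forall n (B : 'M[K]_n.+1) p, Th n.+1 B p p = phi n (pminor p B)
}.

Definition det_fun n (A : 'M[K]_n) := \det A.
Definition ones_fun n (A : 'M[K]_n) := bform (fun=> 1) (fun=> 1) A.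
Definition trace_fun n (A : 'M[K]_n) := \tr (\adj A).

Definition adj_row_sum n (A : 'M[K]_n) k := \sum_l (\adj A) k l.
Definition adj_col_sum n (A : 'M[K]_n) l := \sum_k (\adj A) k l.

Lemma det_expands : expands 0 det_fun (fun n B => \adj B)
  (fun _ _ _ => 0) (fun _ _ _ => 0).
Proof.
split=> [n i d r q B|n B p]; last by rewrite mxE cofactor_diag.
rewrite /det_fun det_ins mul0r add0r.
rewrite [X in _ - X - _ - _]big1 => [|k _]; last by rewrite mulr0.
rewrite [X in _ - X - _]big1 => [|k _]; last by rewrite mul0r.
by rewrite !subr0.
Qed.

Lemma ones_expands : expands 1 ones_fun
  (fun n => @bform2 n (fun=> 1) (fun=> 1)) adj_row_sum adj_col_sum.
Proof.
split=> [n i d r q B|n B p]; last by rewrite bform2_diag.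
rewrite /ones_fun bform_ins !mulr1; congr (_ + _ - _ - _ - _).
  by apply: eq_bigr => k _; rewrite mul1r; under eq_bigr do rewrite mulr1.
by apply: eq_bigr => k _; rewrite mul1r; under eq_bigr do rewrite mul1r.
Qed.

Definition unit_fun n (k l : 'I_n) : K := (l == k)%:R.

Lemma bform_unit n (A : 'M[K]_n) i j :
  bform (unit_fun i) (unit_fun j) A = (\adj A) i j.
Proof.
rewrite /bform (bigD1 i)//= [X in _ + X]big1 => [|k /negbTE ki]; last first.
  by rewrite big1// => l _; rewrite /unit_fun ki !mul0r.
rewrite (bigD1 j)//= [X in _ + X + _]big1 => [|k /negbTE kj]; last first.
  by rewrite /unit_fun kj mulr0.
by rewrite /unit_fun !eqxx mul1r mulr1 !addr0.
Qed.

Lemma unit_fun_lift n (p : 'I_n.+1) k :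
  unit_fun (lift p k) \o lift p = unit_fun k.
Proof. by apply/funext => l; rewrite /unit_fun /= (inj_eq (@lift_inj _ p)). Qed.

Lemma unit_fun_lift0 n (p : 'I_n.+1) : unit_fun p \o lift p = fun=> 0.
Proof. by apply/funext => l; rewrite /unit_fun /= eq_sym (negbTE (neq_lift _ _)). Qed.

Lemma bform0 n y (A : 'M[K]_n) : bform (fun=> 0) y A = 0.
Proof. by rewrite /bform big1// => k _; rewrite big1// => l _; rewrite !mul0r. Qed.

(** The trace is a sum of forms on pairs of equal unit vectors. Those carried by old vertices vanish
    at the inserted one, so there are no linear terms; the unit vector of the inserted vertex
    contributes [\det B], whence [eps = 1]. *)
Lemma trace_expands : expands 1 trace_fun
  (fun n B p m => \sum_k bform2 (unit_fun k) (unit_fun k) B p m)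
  (fun _ _ _ => 0) (fun _ _ _ => 0).
Proof.
split=> [n i d r q B|n B p]; last first.
  rewrite (bigD1_ord p)//= bform2_diag unit_fun_lift0 bform0 add0r.
  apply: eq_bigr => k _.
  by rewrite bform2_diag unit_fun_lift bform_unit.
rewrite /trace_fun /mxtrace (bigD1_ord i)//= adj_ins_diag mul1r.
rewrite [X in _ - X - _ - _]big1 => [|k _]; last by rewrite mulr0.
rewrite [X in _ - X - _]big1 => [|k _]; last by rewrite mul0r.
rewrite !subr0 -addrA; congr (_ + _).
have E k : (\adj (ins i d r q B)) (lift i k) (lift i k) = d * (\adj B) k k -
    \sum_p \sum_m r p * bform2 (unit_fun k) (unit_fun k) B p m * q m.
  rewrite -bform_unit bform_ins unit_fun_lift bform_unit {1 2}/unit_fun.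
  rewrite (negbTE (neq_lift _ _)) !mul0r add0r.
  rewrite [X in _ - X - _ - _]big1 => [|p _]; last by rewrite /unit_fun (negbTE (neq_lift _ _)) mul0r mulr0.
  rewrite [X in _ - X - _]big1 => [|p _]; last by rewrite /unit_fun (negbTE (neq_lift _ _)) !mul0r.
  by rewrite !subr0.
under eq_bigr do rewrite E.
rewrite big_split /= -mulr_sumr sumrN; congr (_ - _).
rewrite exchange_big; apply: eq_bigr => p _ /=.
rewrite exchange_big; apply: eq_bigr => m _ /=.
by rewrite mulr_sumr mulr_suml.
Qed.

End BorderedMatrices.

(** * A matrix model with finitely many atoms *)

(* [wo] and [wd] are arbitrary weights in [K], not probabilities, and [x], [y]
   play the roles of an entry above the diagonal and of its conjugate. *)
Section FiniteModel.
Variables (K : fieldType) (A : finType) (wo wd x y z : A -> K).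

Definition mom p q : K := \sum_a wo a * (x a ^+ p * y a ^+ q).
Definition kap p : K := \sum_a wd a * z a ^+ p.

Definition entries n (M : 'M[A]_n) : 'M[K]_n :=
  \matrix_(i, j) if (i < j)%N then x (M i j)
                 else if (j < i)%N then y (M j i) else z (M i j).

(* The positions below the diagonal carry independent atoms that [entries]
   ignores; this makes the removal of a vertex a plain reindexing. *)
Definition weight n (i j : 'I_n) (a : A) : K := if i == j then wd a else wo a.

Definition EE n (f : 'M[K]_n -> K) : K :=
  \sum_(M : 'M[A]_n) (\prod_i \prod_j weight i j (M i j)) * f (entries M).

(** The entries at [(i, lift i k)] and [(lift i k, i)] both read the atom of whichever position is
    above the diagonal; the other atom is ignored. *)
Definition row_atoms n (i : 'I_n.+1) (r q : {ffun 'I_n -> A}) (k : 'I_n) : K :=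
  if (i < lift i k)%N then x (r k) else y (q k).
Definition col_atoms n (i : 'I_n.+1) (r q : {ffun 'I_n -> A}) (k : 'I_n) : K :=
  if (i < lift i k)%N then y (r k) else x (q k).

(* The expectation over the row and column of vertex [i] only; by [EE_peel],
   [EE] is [VE] followed by the expectation over the remaining vertices. *)
Definition VE n (i : 'I_n.+1) (g : K -> ('I_n -> K) -> ('I_n -> K) -> K) : K :=
  \sum_a \sum_(r : {ffun 'I_n -> A}) \sum_(q : {ffun 'I_n -> A})
    (wd a * (\prod_k wo (r k)) * (\prod_k wo (q k))) *
    g (z a) (row_atoms i r q) (col_atoms i r q).

Lemma entries_ins n (i : 'I_n.+1) a (r q : {ffun 'I_n -> A}) M :
  entries (ins i a r q M) =
  ins i (z a) (row_atoms i r q) (col_atoms i r q) (entries M).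
Proof.
apply/matrixP => b c; rewrite [LHS]mxE.
case: (unliftP i b) => [k|] ->; case: (unliftP i c) => [l|] ->; rewrite !insE.
- rewrite mxE.
  have E (u v : 'I_n) : (lift i u < lift i v)%N = (u < v)%N.
    by rewrite !ltnNge /= leq_bump2.
  by rewrite !E.
- rewrite /col_atoms; case: (ltngtP (lift i k) i) => // /val_inj /eqP.
  by rewrite eq_sym (negbTE (neq_lift _ _)).
- rewrite /row_atoms; case: (ltngtP (lift i l) i) => // /val_inj /eqP.
  by rewrite eq_sym (negbTE (neq_lift _ _)).
- by rewrite ltnn.
Qed.

Lemma weight_ins n (i : 'I_n.+1) a (r q : {ffun 'I_n -> A}) M :
  \prod_b \prod_c weight b c (ins i a r q M b c) =
  (wd a * (\prod_k wo (r k)) * (\prod_k wo (q k))) *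
  \prod_b \prod_c weight b c (M b c).
Proof.
rewrite (bigD1_ord i)//= (bigD1_ord i)//= insE /weight eqxx -!mulrA.
congr (_ * _).
under eq_bigr => k _ do rewrite insE (negbTE (neq_lift _ _)).
congr (_ * _); rewrite -big_split; apply: eq_bigr => k _ /=.
rewrite (bigD1_ord i)//= insE eq_sym (negbTE (neq_lift _ _)); congr (_ * _).
by apply: eq_bigr => l _; rewrite insE (inj_eq (@lift_inj _ i)).
Qed.

Lemma EE_peel n (i : 'I_n.+1) (f : 'M[K]_n.+1 -> K) :
  EE f = EE (fun B => VE i (fun d r q => f (ins i d r q B))).
Proof.
pose T : finType := (A * ({ffun 'I_n -> A} * {ffun 'I_n -> A}))%type.
pose h (u : 'M[A]_n * T) : 'M[A]_n.+1 := ins i u.2.1 u.2.2.1 u.2.2.2 u.1.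
pose h' (M : 'M[A]_n.+1) : 'M[A]_n * T :=
  (pminor i M, (M i i, ([ffun k => M i (lift i k)], [ffun k => M (lift i k) i]))).
have hK : cancel h h'.
  move=> [M [a [r q]]]; rewrite /h /h' /= pminor_ins insE; congr (_, (_, (_, _))).
    by apply/ffunP => k; rewrite ffunE insE.
  by apply/ffunP => k; rewrite ffunE insE.
have h'K : cancel h' h.
  move=> M; rewrite /h /h' /=.
  rewrite -[RHS](ins_pminor i); apply: eq_ins => k; by rewrite ffunE.
rewrite /EE (reindex h) /=; last by exists h' => u _; [exact: hK | exact: h'K].
rewrite -(pair_bigA _ (fun M (t : T) => (\prod_b \prod_c weight b c (h (M, t) b c)) *
   f (entries (h (M, t))))) /=.
apply: eq_bigr => M _; rewrite /VE mulr_sumr.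
rewrite -(pair_bigA _ (fun a (t : {ffun 'I_n -> A} * {ffun 'I_n -> A}) =>
  (\prod_b \prod_c weight b c (h (M, (a, t)) b c)) * f (entries (h (M, (a, t)))))) /=.
apply: eq_bigr => a _; rewrite mulr_sumr.
rewrite -(pair_bigA _ (fun r q =>
  (\prod_b \prod_c weight b c (h (M, (a, (r, q))) b c)) *
    f (entries (h (M, (a, (r, q))))))) /=.
apply: eq_bigr => r _; rewrite mulr_sumr; apply: eq_bigr => q _.
by rewrite /h /= weight_ins entries_ins -mulrA mulrCA.
Qed.

(** Mixed moment of the entries at [(i, j)] and [(j, i)]. The exponents swap with the order of the
    vertices, because [x] and [y] do. *)
Definition pair_mom n (i : 'I_n) (j : 'I_n) p q : K :=
  if (i < j)%N then mom p q else mom q p.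

Hypotheses (mom00 : mom 0 0 = 1) (kap0 : kap 0 = 1).

Lemma sum_wo : \sum_a wo a = 1.
Proof. by rewrite -mom00; apply: eq_bigr => a _; rewrite !expr0 !mulr1. Qed.

Lemma VE_mon n (i : 'I_n.+1) e (al be : 'I_n -> nat) :
  VE i (fun d r q => d ^+ e * \prod_k (r k ^+ al k * q k ^+ be k)) =
  kap e * \prod_k pair_mom i (lift i k) (al k) (be k).
Proof.
rewrite /VE /kap mulr_suml; apply: eq_bigr => a _.
transitivity (\sum_(r : {ffun 'I_n -> A}) \sum_(q : {ffun 'I_n -> A})
   (wd a * z a ^+ e) * ((\prod_k (wo (r k) * (if (i < lift i k)%N then
      x (r k) ^+ al k * y (r k) ^+ be k else 1))) *
    \prod_k (wo (q k) * (if (i < lift i k)%N then 1 else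
      x (q k) ^+ be k * y (q k) ^+ al k)))).
  apply: eq_bigr => r _; apply: eq_bigr => q _.
  have -> : \prod_k (row_atoms i r q k ^+ al k * col_atoms i r q k ^+ be k) =
    (\prod_k (if (i < lift i k)%N then x (r k) ^+ al k * y (r k) ^+ be k else 1)) *
    \prod_k (if (i < lift i k)%N then 1 else x (q k) ^+ be k * y (q k) ^+ al k);
    last by rewrite ![in RHS]big_split /=; ring.
  rewrite -big_split; apply: eq_bigr => k _ /=.
  rewrite /row_atoms /col_atoms; case: ifP => _; first by rewrite mulr1.
  by rewrite mul1r mulrC.
transitivity ((wd a * z a ^+ e) * ((\sum_(r : {ffun 'I_n -> A})
  \prod_k (wo (r k) * (if (i < lift i k)%N then
      x (r k) ^+ al k * y (r k) ^+ be k else 1))) *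
   \sum_(q : {ffun 'I_n -> A})
    \prod_k (wo (q k) * (if (i < lift i k)%N then 1 else
      x (q k) ^+ be k * y (q k) ^+ al k)))).
  rewrite mulr_suml mulr_sumr; apply: eq_bigr => r _.
  by rewrite !mulr_sumr.
congr (_ * _).
rewrite -(bigA_distr_bigA (fun k a => wo a * (if (i < lift i k)%N then
      x a ^+ al k * y a ^+ be k else 1))).
rewrite -(bigA_distr_bigA (fun k a => wo a * (if (i < lift i k)%N then 1 else
      x a ^+ be k * y a ^+ al k))).
(* For each [k], one of the two sums runs over an ignored atom and equals 1. *)
rewrite -big_split; apply: eq_bigr => k _ /=; rewrite /pair_mom.
case: ifP => _; under [X in _ * X]eq_bigr do rewrite ?mulr1.
  by rewrite sum_wo mulr1.
by under eq_bigr do rewrite mulr1; rewrite sum_wo mul1r.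
Qed.

Lemma EE_prod n (g : 'I_n -> 'I_n -> K -> K) :
  EE (fun Z => \prod_i \prod_j g i j (Z i j)) =
  \prod_(i < n) \prod_(j < n) (if (i < j)%N then \sum_a wo a * (g i j (x a) * g j i (y a))
                   else if i == j then \sum_a wd a * g i i (z a) else 1).
Proof.
(* Collects at the position above the diagonal the two factors that read its atom, leaving 1 below
   the diagonal; the positions then separate. *)
pose hh (i j : 'I_n) (a : A) : K := if (i < j)%N then g i j (x a) * g j i (y a)
   else if i == j then g i i (z a) else 1.
transitivity (\sum_(M : {ffun 'I_n * 'I_n -> A})
   \prod_(u : 'I_n * 'I_n) (weight u.1 u.2 (M u) * hh u.1 u.2 (M u))).
  rewrite /EE (reindex (fun M : {ffun 'I_n * 'I_n -> A} => \matrix_(i < n, j < n) M (i, j))) /=; last first.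
    exists (fun M => [ffun u => M u.1 u.2]) => M _.
      by apply/ffunP => -[i j]; rewrite ffunE mxE.
    by apply/matrixP => i j; rewrite mxE ffunE.
  apply: eq_bigr => M _.
  rewrite big_split /=; congr (_ * _).
    rewrite pair_bigA; apply: eq_bigr => -[i j] _ /=; by rewrite mxE.
  have -> : \prod_u hh u.1 u.2 (M u) = \prod_i \prod_j hh i j (M (i, j)).
    by rewrite pair_bigA; apply: eq_bigr => -[].
  transitivity (\prod_(i < n) \prod_(j < n) ((if (i < j)%N then g i j (x (M (i, j))) else 1) *
     ((if (j < i)%N then g i j (y (M (j, i))) else 1) *
       (if i == j then g i i (z (M (i, i))) else 1)))).
    apply: eq_bigr => i _; apply: eq_bigr => j _; rewrite !mxE.
    case: ltngtP => [ij|ij|/val_inj ->]; rewrite ?eqxx ?mul1r ?mulr1//.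
      by case: eqP => [E|]; rewrite ?mulr1//; rewrite E ltnn in ij.
    by case: eqP => [E|]; rewrite ?mulr1//; rewrite E ltnn in ij.
  transitivity (\prod_(i < n) \prod_(j < n) ((if (i < j)%N then g i j (x (M (i, j))) else 1) *
     ((if (i < j)%N then g j i (y (M (i, j))) else 1) *
       (if i == j then g i i (z (M (i, i))) else 1)))).
    under [LHS]eq_bigr do rewrite !big_split /=.
    under [RHS]eq_bigr do rewrite !big_split /=.
    rewrite !big_split /=; congr (_ * (_ * _)).
    by rewrite exchange_big.
  apply: eq_bigr => i _; apply: eq_bigr => j _; rewrite /hh.
  case: ltngtP => [ij|ij|/val_inj ->]; rewrite ?eqxx ?mul1r ?mulr1//.
    by case: eqP => [E|]; rewrite ?mulr1//; rewrite E ltnn in ij.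
  by case: eqP => [E|]; rewrite ?mulr1//; rewrite E ltnn in ij.
transitivity (\prod_(u : 'I_n * 'I_n) \sum_a weight u.1 u.2 a * hh u.1 u.2 a).
  by rewrite [RHS]bigA_distr_bigA.
rewrite [RHS]pair_bigA; apply: eq_bigr => -[i j] _ /=; rewrite /weight /hh.
case: ltngtP => [ij|ij|/val_inj ->]; rewrite ?eqxx//.
  by case: eqP => [E|//]; rewrite E ltnn in ij.
case: eqP => [E|_]; first by rewrite E ltnn in ij.
by under eq_bigr do rewrite mulr1; rewrite sum_wo.
Qed.

Hypotheses (mom10 : mom 1 0 = 0) (mom01 : mom 0 1 = 0) (kap1 : kap 1 = 0).

Lemma EE_mulr0 n (f : 'M[K]_n -> K) : EE (fun M => f M * 0) = 0.
Proof. by rewrite /EE big1// => M _; rewrite !mulr0. Qed.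

Lemma EE_ext n (f g : 'M[K]_n -> K) : f =1 g -> EE f = EE g.
Proof. by move=> fg; apply: eq_bigr => M _; rewrite fg. Qed.

Lemma EE_D n (f g : 'M[K]_n -> K) : EE (fun M => f M + g M) = EE f + EE g.
Proof. by rewrite -big_split; apply: eq_bigr => M _; rewrite mulrDr. Qed.

Lemma EE_Z n c (f : 'M[K]_n -> K) : EE (fun M => c * f M) = c * EE f.
Proof. by rewrite mulr_sumr; apply: eq_bigr => M _; rewrite mulrCA. Qed.

Lemma EE_sum n (I : finType) (f : I -> 'M[K]_n -> K) :
  EE (fun M => \sum_k f k M) = \sum_k EE (f k).
Proof. by rewrite [RHS]exchange_big; apply: eq_bigr => M _; rewrite mulr_sumr. Qed.

Lemma VE_ext n (i : 'I_n.+1) f g :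
  (forall d r q, f d r q = g d r q) -> VE i f = VE i g.
Proof.
by move=> fg; do 3!apply: eq_bigr => ? _; rewrite fg.
Qed.

Lemma VE_D n (i : 'I_n.+1) f g :
  VE i (fun d r q => f d r q + g d r q) = VE i f + VE i g.
Proof.
rewrite -big_split; apply: eq_bigr => a _; rewrite -big_split.
apply: eq_bigr => r _; rewrite -big_split; apply: eq_bigr => q _.
by rewrite mulrDr.
Qed.

Lemma VE_Z n (i : 'I_n.+1) c f :
  VE i (fun d r q => c * f d r q) = c * VE i f.
Proof.
rewrite mulr_sumr; apply: eq_bigr => a _; rewrite mulr_sumr.
apply: eq_bigr => r _; rewrite mulr_sumr; apply: eq_bigr => q _.
by rewrite mulrCA.
Qed.

Lemma VE_sum n (i : 'I_n.+1) (I : finType) (f : I -> _) :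
  VE i (fun d r q => \sum_k f k d r q) = \sum_k VE i (f k).
Proof.
rewrite [RHS]exchange_big; apply: eq_bigr => a _; rewrite [RHS]exchange_big.
apply: eq_bigr => r _; rewrite [RHS]exchange_big; apply: eq_bigr => q _.
by rewrite mulr_sumr.
Qed.

Lemma prod_count (I : finType) (r : I -> K) (s : seq I) :
  \prod_(p <- s) r p = \prod_k r k ^+ count_mem k s.
Proof.
elim: s => [|p s IHs]; first by rewrite big_nil big1.
rewrite big_cons IHs (bigD1 p)//= [RHS](bigD1 p)//= eqxx exprD mulrA expr1.
congr (_ * _); apply: eq_bigr => k /negbTE kp.
by rewrite eq_sym kp.
Qed.

(** Words of indices instead of exponents: a product of a few entries is then evaluated by counting
    coincidences among its indices. *)
Lemma VE_seq n (i : 'I_n.+1) e (rs qs : seq 'I_n) :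
  VE i (fun d r q => d ^+ e * (\prod_(p <- rs) r p * \prod_(m <- qs) q m)) =
  kap e * \prod_k pair_mom i (lift i k) (count_mem k rs) (count_mem k qs).
Proof.
rewrite -VE_mon//; apply: VE_ext => d r q.
by rewrite (prod_count r) (prod_count q) -big_split.
Qed.

Lemma pair_mom00 n (i j : 'I_n) : pair_mom i j 0 0 = 1.
Proof. by rewrite /pair_mom mom00 if_same. Qed.

Lemma pair_mom11 n (i j : 'I_n) : pair_mom i j 1 1 = mom 1 1.
Proof. by rewrite /pair_mom if_same. Qed.

Lemma pair_mom22 n (i j : 'I_n) : pair_mom i j 2 2 = mom 2 2.
Proof. by rewrite /pair_mom if_same. Qed.

(** An index met only once contributes a factor [mom 1 0] or [mom 0 1], which is zero by
    centring. *)
Lemma VE_lone n (i : 'I_n.+1) e (rs qs : seq 'I_n) k :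
  (count_mem k rs + count_mem k qs = 1)%N ->
  VE i (fun d r q => d ^+ e * (\prod_(p <- rs) r p * \prod_(m <- qs) q m)) = 0.
Proof.
move=> k1; rewrite VE_seq (bigD1 k)//=.
have -> : pair_mom i (lift i k) (count_mem k rs) (count_mem k qs) = 0.
  move: k1; rewrite /pair_mom; case: (count_mem k rs) => [|[|c]];
    case: (count_mem k qs) => [|[|c']]; rewrite ?add0n ?addn0 ?addSn ?addnS// => _;
    by rewrite mom10 mom01 if_same.
by rewrite mul0r mulr0.
Qed.

Lemma VE_one n (i : 'I_n.+1) : VE i (fun _ _ _ => 1) = 1.
Proof.
transitivity (VE i (fun d r q => d ^+ 0 *
   (\prod_(p <- [::]) r p * \prod_(m <- [::]) q m))).
  by apply: VE_ext => d r q; rewrite !big_nil !mul1r.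
by rewrite VE_seq kap0 mul1r big1// => k _; rewrite pair_mom00.
Qed.

Lemma VE_c n (i : 'I_n.+1) c : VE i (fun _ _ _ => c) = c.
Proof.
rewrite -[RHS]mulr1 -(VE_one i) -VE_Z; apply: VE_ext => *; by rewrite mulr1.
Qed.

Lemma VE_diag n (i : 'I_n.+1) (rs qs : seq 'I_n) :
  VE i (fun d r q => d * (\prod_(p <- rs) r p * \prod_(m <- qs) q m)) = 0.
Proof. by rewrite (VE_seq i 1) kap1 mul0r. Qed.

Lemma VE_same n (i : 'I_n.+1) e k a b :
  VE i (fun d r q => d ^+ e * (\prod_(p <- nseq a k) r p * \prod_(m <- nseq b k) q m)) =
  kap e * pair_mom i (lift i k) a b.
Proof.
rewrite VE_seq; congr (_ * _); rewrite (bigD1 k)//= !count_nseq /= eqxx !mul1n.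
rewrite big1 ?mulr1// => l /negbTE lk.
by rewrite !count_nseq /= eq_sym lk !mul0n pair_mom00.
Qed.

Lemma VE_r n (i : 'I_n.+1) p : VE i (fun d r q => r p) = 0.
Proof.
rewrite -(@VE_lone n i 0 [:: p] [::] p) /= ?eqxx//; apply: VE_ext => d r q.
by rewrite mul1r big_seq1 big_nil mulr1.
Qed.

Lemma VE_q n (i : 'I_n.+1) p : VE i (fun d r q => q p) = 0.
Proof.
rewrite -(@VE_lone n i 0 [::] [:: p] p) /= ?eqxx//; apply: VE_ext => d r q.
by rewrite mul1r big_seq1 big_nil mul1r.
Qed.

Lemma VE_d n (i : 'I_n.+1) : VE i (fun d r q => d) = 0.
Proof.
rewrite -(@VE_diag n i [::] [::]); apply: VE_ext => d r q.
by rewrite !big_nil !mulr1.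
Qed.

Lemma VE_dr n (i : 'I_n.+1) p : VE i (fun d r q => d * r p) = 0.
Proof.
rewrite -(@VE_diag n i [:: p] [::]); apply: VE_ext => d r q.
by rewrite big_seq1 big_nil !mulr1.
Qed.

Lemma VE_drq n (i : 'I_n.+1) p m : VE i (fun d r q => d * (r p * q m)) = 0.
Proof.
rewrite -(@VE_diag n i [:: p] [:: m]); apply: VE_ext => d r q.
by rewrite !big_seq1.
Qed.

Lemma VE_dd n (i : 'I_n.+1) : VE i (fun d r q => d * d) = kap 2.
Proof.
transitivity (VE i (fun d r q => d ^+ 2 *
   (\prod_(p <- [::]) r p * \prod_(m <- [::]) q m))).
  by apply: VE_ext => d r q; rewrite !big_nil !mulr1.
by rewrite VE_seq big1 ?mulr1// => k _; rewrite pair_mom00.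
Qed.

Lemma VE_rq n (i : 'I_n.+1) p m :
  VE i (fun d r q => r p * q m) = (p == m)%:R * mom 1 1.
Proof.
transitivity (VE i (fun d r q => d ^+ 0 *
   (\prod_(p <- [:: p]) r p * \prod_(m <- [:: m]) q m))).
  by apply: VE_ext => d r q; rewrite !big_seq1 mul1r.
case: eqVneq => [<-|pm]; last first.
  by rewrite (@VE_lone _ _ _ _ _ p) ?mul0r//= eqxx eq_sym (negbTE pm).
by rewrite (VE_same i 0 p 1 1) kap0 pair_mom11.
Qed.

Lemma VE_rr n (i : 'I_n.+1) p m :
  VE i (fun d r q => r p * r m) = (p == m)%:R * pair_mom i (lift i p) 2 0.
Proof.
transitivity (VE i (fun d r q => d ^+ 0 *
   (\prod_(p <- [:: p; m]) r p * \prod_(m <- [::]) q m))).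
  by apply: VE_ext => d r q; rewrite big_cons big_seq1 mul1r big_nil mulr1.
case: eqVneq => [<-|pm]; last first.
  by rewrite (@VE_lone _ _ _ _ _ p) ?mul0r//= eqxx eq_sym (negbTE pm).
by rewrite (VE_same i 0 p 2 0) kap0.
Qed.

Lemma VE_rrq n (i : 'I_n.+1) k p m :
  VE i (fun d r q => r k * (r p * q m)) =
  ((k == p) && (k == m))%:R * pair_mom i (lift i k) 2 1.
Proof.
transitivity (VE i (fun d r q => d ^+ 0 *
   (\prod_(p <- [:: k; p]) r p * \prod_(m <- [:: m]) q m))).
  by apply: VE_ext => d r q; rewrite big_cons !big_seq1 mul1r mulrA.
case: (eqVneq k p) => [<-|kp]; case: (eqVneq k m) => [<-|km] /=.
- by rewrite (VE_same i 0 k 2 1) kap0.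
- by rewrite (@VE_lone _ _ _ _ _ m) ?mul0r//= eqxx (negbTE km).
- by rewrite (@VE_lone _ _ _ _ _ p) ?mul0r//= eqxx (negbTE kp).
- by rewrite (@VE_lone _ _ _ _ _ k) ?mul0r//= eqxx !(eq_sym _ k) (negbTE kp) (negbTE km).
Qed.

Local Notation l11 := (mom 1 1).
Local Notation l20 := (mom 2 0).
Local Notation l02 := (mom 0 2).
Local Notation l22 := (mom 2 2).

(* Restricted to the first vertex: elsewhere the value of E[r_a^2 q_b^2] depends
   on the sides of the vertex on which [a] and [b] lie. *)
Lemma VE_rqrq n (a b c d : 'I_n) :
  VE ord0 (fun _ r q => (r a * q b) * (r c * q d)) =
  l11 ^+ 2 * (((a == b) && (c == d))%:R + ((a == d) && (b == c))%:R)
  + l20 * l02 * ((a == c) && (b == d))%:R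
  + (l22 - 2 * l11 ^+ 2 - l20 * l02) * [&& a == b, a == c & a == d]%:R.
Proof.
transitivity (VE ord0 (fun e r q => e ^+ 0 *
   (\prod_(p <- [:: a; c]) r p * \prod_(m <- [:: b; d]) q m))).
  by apply: VE_ext => e r q; rewrite !big_cons !big_nil !mulr1 mul1r mulrACA.
have two (u v : 'I_n) (uv : u != v) (rs qs : seq 'I_n) :
    (forall k, k != u -> k != v -> (count_mem k rs = 0)%N /\ (count_mem k qs = 0)%N) ->
    VE ord0 (fun e r q => e ^+ 0 *
      (\prod_(p <- rs) r p * \prod_(m <- qs) q m)) =
    mom (count_mem u rs) (count_mem u qs) * mom (count_mem v rs) (count_mem v qs).
  move=> uv0; rewrite VE_seq kap0 mul1r (bigD1 u)//= (bigD1 v) 1?eq_sym//=.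
  rewrite mulrA big1 ?mulr1// => k /andP[ku kv].
  by have [-> ->] := uv0 k ku kv; rewrite pair_mom00.
(* Unless the indices pair up, one of them is alone. When all four coincide, the three pairings
   together give [2 * l11 ^+ 2 + l20 * l02]; the last coefficient corrects this to [l22]. *)
have [ab|ab] := eqVneq a b.
  subst b; have [ac|ac] := eqVneq a c.
    subst c; have [<-|ad] := eqVneq a d.
      rewrite (VE_same ord0 0 a 2 2) kap0 mul1r /=; rewrite pair_mom22 ?mulr1n; ring.
    rewrite (@VE_lone _ _ _ _ _ d) /= ?eqxx ?(negbTE ad)//; rewrite ?mulr0n ?mulr1n; ring.
  have [cd|cd] := eqVneq c d.
    subst d; rewrite (negbTE ac) /= (two a c)//= ?eqxx ?(eq_sym c a) ?(negbTE ac) /=.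
      rewrite ?mulr0n ?mulr1n; ring.
    by move=> k; rewrite !(eq_sym _ k) => /negbTE -> /negbTE ->.
  rewrite (@VE_lone _ _ _ _ _ c) /= ?eqxx ?(eq_sym d c) ?(negbTE ac) ?(negbTE cd)//.
  by rewrite ?andbF /= ?mulr0n ?mulr1n; ring.
have [ac|ac] := eqVneq a c.
  subst c; have [bd|bd] := eqVneq b d.
    subst d; rewrite /= (two a b)//= ?eqxx ?(eq_sym b a) ?(negbTE ab) /=.
      rewrite ?mulr0n ?mulr1n; ring.
    by move=> k; rewrite !(eq_sym _ k) => /negbTE -> /negbTE ->.
  rewrite (@VE_lone _ _ _ _ _ b) /= ?eqxx ?(eq_sym d b) ?(eq_sym b a) ?(negbTE ab) ?(negbTE bd)//.
  by rewrite ?andbF /= ?mulr0n ?mulr1n; ring.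
have [ad|ad] := eqVneq a d.
  subst d; have [bc|bc] := eqVneq b c.
    subst c; rewrite /= (two a b)//= ?eqxx ?(eq_sym b a) ?(negbTE ab) /=.
      rewrite ?mulr0n ?mulr1n; ring.
    by move=> k; rewrite !(eq_sym _ k) => /negbTE -> /negbTE ->.
  rewrite (@VE_lone _ _ _ _ _ c) /= ?eqxx ?(negbTE ac) ?(negbTE bc)//.
  by rewrite ?andbF /= ?mulr0n ?mulr1n; ring.
rewrite (@VE_lone _ _ _ _ _ a) /= ?eqxx ?(eq_sym _ a) ?(negbTE ab) ?(negbTE ac) ?(negbTE ad)//.
by rewrite ?andbF /= ?mulr0n ?mulr1n; ring.
Qed.

Lemma VE_N n (i : 'I_n.+1) f : VE i (fun d r q => - f d r q) = - VE i f.
Proof. by rewrite -mulN1r -VE_Z; apply: VE_ext => *; rewrite mulN1r. Qed.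

Lemma VE_Zr n (i : 'I_n.+1) c f :
  VE i (fun d r q => f d r q * c) = VE i f * c.
Proof. by rewrite mulrC -VE_Z; apply: VE_ext => *; rewrite mulrC. Qed.

Lemma sum_diag (I : finType) (f : I -> K) k : \sum_l (k == l)%:R * f l = f k.
Proof.
rewrite (bigD1 k)//= eqxx mul1r big1 ?addr0// => l /negbTE lk.
by rewrite eq_sym lk mul0r.
Qed.

(** * Averages over one vertex of affine and quadratic expressions *)

Section AffineForms.
Variables (n : nat) (e f : K) (al be : 'I_n -> K) (T : 'I_n -> 'I_n -> K).

(** The shape of [expands_ins] with its coefficients frozen; [e] also absorbs the part due to the
    shift of the diagonal. *)
Definition vertex_affine d (r q : 'I_n -> K) :=
  e + d * f - \sum_k r k * al k - \sum_l be l * q l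
  - \sum_k \sum_l r k * T k l * q l.

Lemma VE_affine (i : 'I_n.+1) : VE i vertex_affine = e - l11 * \sum_k T k k.
Proof.
rewrite /vertex_affine !(VE_D, VE_N, VE_sum) VE_c VE_Zr VE_d mul0r addr0.
rewrite [X in _ - X - _ - _]big1 => [|k _]; last by rewrite VE_Zr VE_r mul0r.
rewrite [X in _ - X - _]big1 => [|k _]; last by rewrite VE_Z VE_q mulr0.
rewrite !subr0; congr (_ - _); rewrite mulr_sumr; apply: eq_bigr => k _.
rewrite VE_sum -(sum_diag (fun l => l11 * T k l)); apply: eq_bigr => l _.
transitivity (VE i (fun d r q => T k l * (r k * q l))).
  by apply: VE_ext => *; ring.
by rewrite VE_Z VE_rq; ring.
Qed.

(** By centring, only [r p], [q p] and the product [r p * q p] correlate with [r p]. Hence [T]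
    enters through a diagonal coefficient and a third moment. *)
Lemma VE_r_affine (i : 'I_n.+1) p :
  VE i (fun d r q => r p * vertex_affine d r q) =
  - (pair_mom i (lift i p) 2 0 * al p + l11 * be p
     + pair_mom i (lift i p) 2 1 * T p p).
Proof.
transitivity (VE i (fun d r q => r p * e + (d * r p) * f
  - \sum_k (r p * r k) * al k - \sum_l be l * (r p * q l)
  - \sum_k \sum_l T k l * (r p * (r k * q l)))).
  apply: VE_ext => d r q; rewrite /vertex_affine !mulrBr mulrDr.
  congr (_ + _ - _ - _ - _); first by ring.
  - by rewrite mulr_sumr; apply: eq_bigr => k _; ring.
  - by rewrite mulr_sumr; apply: eq_bigr => k _; ring.
  rewrite mulr_sumr; apply: eq_bigr => k _.
  by rewrite mulr_sumr; apply: eq_bigr => l _; ring.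
rewrite !(VE_D, VE_N, VE_sum) !VE_Zr VE_r VE_dr !mul0r addr0 sub0r.
rewrite -!opprD; congr (- _); congr (_ + _ + _).
- rewrite -[RHS](sum_diag (fun k => pair_mom i (lift i p) 2 0 * al k)).
  by apply: eq_bigr => k _; rewrite VE_Zr VE_rr mulrA.
- rewrite -[RHS](sum_diag (fun k => l11 * be k)).
  by apply: eq_bigr => k _; rewrite VE_Z VE_rq; ring.
rewrite -[RHS](sum_diag (fun k => pair_mom i (lift i p) 2 1 * T k k)).
apply: eq_bigr => k _; rewrite VE_sum.
under eq_bigr => l _ do rewrite VE_Z VE_rrq.
case: (eqVneq p k) => [<-|pk] /=; last first.
  by rewrite big1 ?mul0r// => l _; rewrite mulr0.
rewrite -(sum_diag (fun l => pair_mom i (lift i p) 2 1 * T p l)) mul1r.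
by apply: eq_bigr => l _; ring.
Qed.

End AffineForms.

Lemma VE_rr_forms n (i : 'I_n.+1) e e' (al al' : 'I_n -> K) :
  VE i (fun d r q => (e - \sum_k r k * al k) * (e' - \sum_k r k * al' k)) =
  e * e' + \sum_k pair_mom i (lift i k) 2 0 * (al k * al' k).
Proof.
transitivity (VE i (fun d r q => e * vertex_affine e' 0 al' (fun=> 0) (fun _ _ => 0) d r q
  - \sum_k al k * (r k * vertex_affine e' 0 al' (fun=> 0) (fun _ _ => 0) d r q))).
  apply: VE_ext => d r q.
  have -> : vertex_affine e' 0 al' (fun=> 0) (fun _ _ => 0) d r q =
      e' - \sum_k r k * al' k.
    rewrite /vertex_affine mulr0 addr0 [X in _ - X - _]big1 ?subr0 => [|l _]; last by rewrite mul0r.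
    rewrite [X in _ - X]big1 ?subr0// => k _; rewrite big1// => l _; by rewrite mulr0 mul0r.
  rewrite mulrBl; congr (_ - _); rewrite mulr_suml; apply: eq_bigr => k _; ring.
rewrite VE_D VE_N VE_sum VE_Z VE_affine big1// mulr0 subr0; congr (_ + _).
rewrite -sumrN; apply: eq_bigr => k _; rewrite VE_Z VE_r_affine; ring.
Qed.

Lemma VE_rq_forms n (i : 'I_n.+1) e e' (al be : 'I_n -> K) :
  VE i (fun d r q => (e - \sum_k r k * al k) * (e' - \sum_k be k * q k)) =
  e * e' + l11 * \sum_k al k * be k.
Proof.
transitivity (VE i (fun d r q => e * vertex_affine e' 0 (fun=> 0) be (fun _ _ => 0) d r q
  - \sum_k al k * (r k * vertex_affine e' 0 (fun=> 0) be (fun _ _ => 0) d r q))).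
  apply: VE_ext => d r q.
  have -> : vertex_affine e' 0 (fun=> 0) be (fun _ _ => 0) d r q =
      e' - \sum_k be k * q k.
    rewrite /vertex_affine mulr0 addr0 [X in _ - X - _ - _]big1 ?subr0 => [|l _]; last by rewrite mulr0.
    rewrite [X in _ - X]big1 ?subr0// => k _; rewrite big1// => l _; by rewrite mulr0 mul0r.
  rewrite mulrBl; congr (_ - _); rewrite mulr_suml; apply: eq_bigr => k _; ring.
rewrite VE_D VE_N VE_sum VE_Z VE_affine big1// mulr0 subr0; congr (_ + _).
rewrite -sumrN mulr_sumr; apply: eq_bigr => k _; rewrite VE_Z VE_r_affine; ring.
Qed.

Lemma VE_quad n c c' f f' (T T' : 'I_n -> 'I_n -> K) :
  VE ord0 (fun d r q => ((d + c) * f - \sum_k \sum_l r k * T k l * q l) *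
                        ((d + c') * f' - \sum_k \sum_l r k * T' k l * q l)) =
  (kap 2 + c * c') * (f * f')
  - l11 * (c * f * \sum_k T' k k + c' * f' * \sum_k T k k)
  + l11 ^+ 2 * ((\sum_k T k k) * (\sum_k T' k k) + \sum_k \sum_l T k l * T' l k)
  + l20 * l02 * (\sum_k \sum_l T k l * T' k l)
  + (l22 - 2 * l11 ^+ 2 - l20 * l02) * \sum_k T k k * T' k k.
Proof.
transitivity (VE ord0 (fun d r q => (d * d) * (f * f') + (d * ((c + c') * (f * f'))
    + c * c' * (f * f'))
  - \sum_k \sum_l (f * T' k l) * (d * (r k * q l))
  - \sum_k \sum_l (c * f * T' k l) * (r k * q l)
  - \sum_k \sum_l (f' * T k l) * (d * (r k * q l))
  - \sum_k \sum_l (c' * f' * T k l) * (r k * q l)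
  + \sum_a \sum_b \sum_u \sum_v
     (T a b * T' u v) * ((r a * q b) * (r u * q v)))).
  apply: VE_ext => d r q.
  have S1 (g : K) (U : 'I_n -> 'I_n -> K) : \sum_k \sum_l (g * U k l) * (d * (r k * q l)) =
     g * d * \sum_k \sum_l r k * U k l * q l.
    rewrite mulr_sumr; apply: eq_bigr => k _; rewrite mulr_sumr.
    by apply: eq_bigr => l _; ring.
  have S2 (g : K) (U : 'I_n -> 'I_n -> K) : \sum_k \sum_l (g * U k l) * (r k * q l) =
     g * \sum_k \sum_l r k * U k l * q l.
    rewrite mulr_sumr; apply: eq_bigr => k _; rewrite mulr_sumr.
    by apply: eq_bigr => l _; ring.
  rewrite !S1 !S2.
  have -> : \sum_a \sum_b \sum_u \sum_v
     (T a b * T' u v) * ((r a * q b) * (r u * q v)) =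
     (\sum_k \sum_l r k * T k l * q l) * (\sum_k \sum_l r k * T' k l * q l).
    rewrite mulr_suml; apply: eq_bigr => a _; rewrite mulr_suml.
    apply: eq_bigr => b _; rewrite mulr_sumr; apply: eq_bigr => u _.
    by rewrite mulr_sumr; apply: eq_bigr => v _; ring.
  by ring.
rewrite !(VE_D, VE_N) !VE_Zr VE_dd VE_d VE_c mul0r add0r.
have Z0 (g : K) (U : 'I_n -> 'I_n -> K) :
   VE ord0 (fun d r q => \sum_k \sum_l (g * U k l) * (d * (r k * q l))) = 0.
  rewrite VE_sum big1// => k _; rewrite VE_sum big1// => l _.
  by rewrite VE_Z VE_drq mulr0.
have Z1 (g : K) (U : 'I_n -> 'I_n -> K) :
   VE ord0 (fun d r q => \sum_k \sum_l (g * U k l) * (r k * q l)) =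
   l11 * (g * \sum_k U k k).
  rewrite VE_sum !mulr_sumr; apply: eq_bigr => k _; rewrite VE_sum.
  rewrite -[RHS](sum_diag (fun l => l11 * (g * U k l))).
  by apply: eq_bigr => l _; rewrite VE_Z VE_rq; ring.
rewrite !Z0 !Z1 !subr0.
have -> : VE ord0 (fun _ r q => \sum_a \sum_b \sum_u \sum_v
     (T a b * T' u v) * ((r a * q b) * (r u * q v))) =
  l11 ^+ 2 * ((\sum_k T k k) * (\sum_k T' k k) + \sum_k \sum_l T k l * T' l k)
  + l20 * l02 * (\sum_k \sum_l T k l * T' k l)
  + (l22 - 2 * l11 ^+ 2 - l20 * l02) * \sum_k T k k * T' k k; last by ring.
(* Each contraction is written as a fourfold sum against an indicator, so that the identity can be
   checked index by index with [VE_rqrq]. *)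
pose G (a b u v : 'I_n) := T a b * T' u v.
have E1 : \sum_a \sum_b \sum_u \sum_v G a b u v * ((a == b) && (u == v))%:R =
    (\sum_k T k k) * (\sum_k T' k k).
  rewrite mulr_suml; apply: eq_bigr => a _.
  rewrite -[RHS](sum_diag (fun b => T a b * _)); apply: eq_bigr => b _.
  rewrite mulrA mulr_sumr; apply: eq_bigr => u _.
  rewrite -[RHS](sum_diag (fun v => _ * T a b * T' u v)); apply: eq_bigr => v _.
  by rewrite /G -mulnb natrM; ring.
have E2 : \sum_a \sum_b \sum_u \sum_v G a b u v * ((a == v) && (b == u))%:R =
    \sum_k \sum_l T k l * T' l k.
  apply: eq_bigr => a _; apply: eq_bigr => b _.
  rewrite -[RHS](sum_diag (fun u => T a b * T' u a)); apply: eq_bigr => u _.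
  rewrite -[RHS](sum_diag (fun v => _ * (T a b * T' u v)) a); apply: eq_bigr => v _.
  by rewrite /G -mulnb natrM; ring.
have E3 : \sum_a \sum_b \sum_u \sum_v G a b u v * ((a == u) && (b == v))%:R =
    \sum_k \sum_l T k l * T' k l.
  apply: eq_bigr => a _; apply: eq_bigr => b _.
  rewrite -[RHS](sum_diag (fun u => T a b * T' u b)); apply: eq_bigr => u _.
  rewrite -[RHS](sum_diag (fun v => _ * (T a b * T' u v)) b); apply: eq_bigr => v _.
  by rewrite /G -mulnb natrM; ring.
have E4 : \sum_a \sum_b \sum_u \sum_v G a b u v * [&& a == b, a == u & a == v]%:R =
    \sum_k T k k * T' k k.
  apply: eq_bigr => a _; rewrite -[RHS](sum_diag (fun b => T a b * T' a a)).
  apply: eq_bigr => b _.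
  rewrite -[RHS](sum_diag (fun u => (a == b)%:R * (T a b * T' u a)) a); apply: eq_bigr => u _.
  rewrite -[RHS](sum_diag (fun v => (a == u)%:R * ((a == b)%:R * (T a b * T' u v))) a); apply: eq_bigr => v _.
  by rewrite /G -!mulnb !natrM; ring.
move: (@VE_rqrq n); move: l11 l20 l02 l22 => m11 m20 m02 m22 Hrqrq.
rewrite -E1 -E2 -E3 -E4 mulrDr !mulr_sumr -!big_split VE_sum.
apply: eq_bigr => a _; rewrite /= !mulr_sumr -!big_split VE_sum.
apply: eq_bigr => b _; rewrite /= !mulr_sumr -!big_split VE_sum.
apply: eq_bigr => u _; rewrite /= !mulr_sumr -!big_split VE_sum.
apply: eq_bigr => v _; rewrite /= VE_Z Hrqrq /G. by ring.
Qed.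

Lemma natr_sum_ord n (c : K) : n%:R * c = \sum_(i < n) c.
Proof. by rewrite sumr_const card_ord mulr_natl. Qed.

Lemma EE_pminor n (i : 'I_n.+1) (f : 'M[K]_n -> K) :
  EE (fun M => f (pminor i M)) = EE f.
Proof.
rewrite (EE_peel i); apply: EE_ext => M.
rewrite -[RHS](VE_c i); apply: VE_ext => d r q.
by rewrite pminor_ins.
Qed.

(* The first factor is linear in the row of [p], which is centred, and the
   second one does not involve [p]. *)
Lemma EE_adj_offdiag n (p : 'I_n.+1) j c (f : 'M[K]_n -> K) :
  EE (fun M => (\adj (M + c%:M)) p (lift p j) * f (pminor p M)) = 0.
Proof.
rewrite (EE_peel p) -[RHS](mul0r (EE (fun _ : 'M[K]_n => 1))) -EE_Z.
apply: EE_ext => M.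
transitivity (VE p (fun d r q => \sum_k (- (\adj (M + c%:M)) k j * f M) * r k)).
  apply: VE_ext => d r q; rewrite ins_addC adj_ins_row pminor_ins mulNr.
  rewrite mulr_suml -sumrN; apply: eq_bigr => k _; ring.
rewrite VE_sum big1 ?mul0r// => k _.
by rewrite VE_Z VE_r mulr0.
Qed.

Lemma EE_0 (f : 'M[K]_0 -> K) : EE f = f 0.
Proof.
(* [A] comes without a default element, so the entries of the empty matrix are obtained from the
   absurd index. *)
rewrite /EE (big_pred1 (\matrix_(i < 0, j < 0) match i with Ordinal _ h => False_rect A (notF h) end)).
  rewrite big_ord0 mul1r; congr f; apply/matrixP => -[]//.
by move=> M; rewrite /= eq_sym; apply/esym/eqP/matrixP => -[].
Qed.

(** * Recursions for a determinant or the sum of an adjugate times a functional *)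

Section Functional.
Variables (eps : K) (phi : forall n, 'M[K]_n -> K).
Variables (Th : forall n, 'M[K]_n -> 'I_n -> 'I_n -> K).
Variables (al be : forall n, 'M[K]_n -> 'I_n -> K).
Hypothesis H : expands eps phi Th al be.
Variables c c' : K.

(* [Fseq] and [Xseq] are over [n] vertices.  In [Nseq], resp. [Mseq], the second,
   resp. first, factor has one more vertex than the other one; which vertex it is
   does not matter, by [N_anyE] and [M_anyE]. *)
Definition Fseq n := EE (fun M : 'M[K]_n => \det (M + c%:M) * \det (M + c'%:M)).
Definition Xseq n := EE (fun M : 'M[K]_n => \det (M + c%:M) * phi (M + c'%:M)).
Definition Nseq n := EE (fun M : 'M[K]_n.+1 =>
  \det (pminor ord0 M + c%:M) * phi (M + c'%:M)).
Definition Mseq n := EE (fun M : 'M[K]_n.+1 =>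
  \det (M + c%:M) * phi (pminor ord0 M + c'%:M)).
Definition Yseq n := EE (fun M : 'M[K]_n => ones_fun (M + c%:M) * phi (M + c'%:M)).

Lemma phi_ins n (i : 'I_n.+1) d r q (B : 'M[K]_n) :
  phi (ins i d r q B + c'%:M) =
  vertex_affine (eps * \det (B + c'%:M) + c' * phi (B + c'%:M)) (phi (B + c'%:M))
    (al (B + c'%:M)) (be (B + c'%:M)) (Th (B + c'%:M)) d r q.
Proof.
rewrite ins_addC (expands_ins H) /vertex_affine; congr (_ - _ - _ - _).
ring.
Qed.

(** The right-hand side is free of [i]; this is why the choice of the extra vertex is immaterial. *)
Lemma N_expand n (i : 'I_n.+1) :
  EE (fun M => \det (pminor i M + c%:M) * phi (M + c'%:M)) =
  eps * Fseq n + c' * Xseq n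
  - l11 * \sum_p EE (fun M : 'M[K]_n => \det (M + c%:M) * Th (M + c'%:M) p p).
Proof.
rewrite (EE_peel i) -EE_sum -!EE_Z -EE_D -mulN1r -EE_Z -EE_D.
apply: EE_ext => M.
transitivity (VE i (fun d r q => \det (M + c%:M) * vertex_affine
   (eps * \det (M + c'%:M) + c' * phi (M + c'%:M)) (phi (M + c'%:M))
    (al (M + c'%:M)) (be (M + c'%:M)) (Th (M + c'%:M)) d r q)).
  by apply: VE_ext => d r q; rewrite pminor_ins phi_ins.
rewrite VE_Z VE_affine// -mulr_sumr; ring.
Qed.

Lemma M_expand n (i : 'I_n.+1) :
  EE (fun M => \det (M + c%:M) * phi (pminor i M + c'%:M)) =
  c * Xseq n
  - l11 * \sum_p EE (fun M : 'M[K]_n => (\adj (M + c%:M)) p p * phi (M + c'%:M)).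
Proof.
rewrite (EE_peel i) -EE_sum -!EE_Z -mulN1r -EE_Z -EE_D.
apply: EE_ext => M.
transitivity (VE i (fun d r q => phi (M + c'%:M) * vertex_affine
   (c * \det (M + c%:M)) (\det (M + c%:M))
    (fun=> 0) (fun=> 0) (fun k l => (\adj (M + c%:M)) k l) d r q)).
  apply: VE_ext => d r q; rewrite pminor_ins ins_addC mulrC; congr (_ * _).
  rewrite -/(det_fun _) (expands_ins (det_expands K)) /vertex_affine.
  by congr (_ - _ - _ - _); rewrite /det_fun; ring.
rewrite VE_Z VE_affine// -mulr_suml; ring.
Qed.

Lemma N_anyE n (i : 'I_n.+1) :
  EE (fun M => \det (pminor i M + c%:M) * phi (M + c'%:M)) = Nseq n.
Proof. by rewrite /Nseq !N_expand. Qed.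

Lemma M_anyE n (i : 'I_n.+1) :
  EE (fun M => \det (M + c%:M) * phi (pminor i M + c'%:M)) = Mseq n.
Proof. by rewrite /Mseq !M_expand. Qed.

(** The diagonal coefficients of [phi] are its values on principal minors, which moves the extra
    vertex to the other factor; [M_rec] moves it back. At [n = 0] the factor [n%:R] cancels the
    meaningless predecessor. *)
Lemma N_rec n :
  Nseq n = eps * Fseq n + c' * Xseq n - l11 * (n%:R * Mseq n.-1).
Proof.
rewrite /Nseq N_expand; congr (_ - _ * _).
case: n => [|n]; first by rewrite big_ord0 mul0r.
rewrite natr_sum_ord; apply: eq_bigr => p _.
rewrite -(M_anyE p); apply: EE_ext => M.
by rewrite (expands_diag H) pminor_addC.
Qed.

Lemma M_rec n : Mseq n = c * Xseq n - l11 * (n%:R * Nseq n.-1).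
Proof.
rewrite /Mseq M_expand; congr (_ - _ * _).
case: n => [|n]; first by rewrite big_ord0 mul0r.
rewrite natr_sum_ord; apply: eq_bigr => p _.
rewrite -(N_anyE p); apply: EE_ext => M.
by rewrite mxE cofactor_diag pminor_addC.
Qed.

(** Adding the transposed sum makes every ordered pair contribute the same amount. The factor 2
    stays on the left because the field may have characteristic 2 here. *)
Lemma sum_pair_mom n p q :
  2 * \sum_(i < n.+1) \sum_(k < n) pair_mom i (lift i k) p q =
  n.+1%:R * n%:R * (mom p q + mom q p).
Proof.
have E (i : 'I_n.+1) : \sum_(k < n) pair_mom i (lift i k) p q =
    \sum_(j < n.+1 | j != i) pair_mom i j p q.
  by rewrite [RHS]big_mkcond [RHS](bigD1_ord i)//= eqxx add0r; apply: eq_bigr => k _;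
     rewrite eq_sym neq_lift.
under eq_bigr do rewrite E.
rewrite mulr_natl mulr2n.
have -> : \sum_(i < n.+1) \sum_(j < n.+1 | j != i) pair_mom i j p q =
          \sum_(i < n.+1) \sum_(j < n.+1 | j != i) pair_mom j i p q.
  rewrite [LHS](exchange_big_dep xpredT)//=; apply: eq_bigr => i _.
  by apply: eq_bigl => j; rewrite eq_sym.
rewrite {1}[X in X + _ = _](_ : _ = \sum_(i < n.+1) \sum_(j < n.+1 | j != i) pair_mom i j p q); last first.
  rewrite [RHS](exchange_big_dep xpredT)//=; apply: eq_bigr => i _.
  by apply: eq_bigl => j; rewrite eq_sym.
rewrite -big_split /=.
transitivity (\sum_(i < n.+1) n%:R * (mom p q + mom q p)); last first.
  by rewrite -natr_sum_ord mulrA.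
apply: eq_bigr => i _; rewrite -big_split /=.
transitivity (\sum_(j < n.+1 | j != i) (mom p q + mom q p)).
  apply: eq_bigr => j ji; rewrite /pair_mom.
  case: (ltngtP i j) => [||/val_inj ij]; rewrite ?addrA//; first by rewrite addrC.
  by rewrite ij eqxx in ji.
rewrite sumr_const mulr_natl; congr (_ *+ _).
have := cardC1 i; rewrite card_ord /= => ni.
by rewrite -[RHS]ni; apply: eq_card => j; rewrite !inE.
Qed.

(** In row [i] of the adjugate, the diagonal entry is a principal minor and gives [Nseq]. The others
    are linear in the row of vertex [i], so they meet only the terms kept by [VE_r_affine]; in the
    third-moment term, the off-diagonal part of the row sum averages to zero by [EE_adj_offdiag]. *)
Lemma Y_rec n :
  Yseq n.+1 = n.+1%:R * Nseq n
  + \sum_(i < n.+1) (\sum_k pair_mom i (lift i k) 2 0 *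
      EE (fun M : 'M[K]_n => adj_row_sum (M + c%:M) k * al (M + c'%:M) k)
    + l11 * \sum_k EE (fun M : 'M[K]_n =>
        adj_row_sum (M + c%:M) k * be (M + c'%:M) k))
  + (\sum_(i < n.+1) \sum_(k < n) pair_mom i (lift i k) 2 1) * Xseq n.-1.
Proof.
rewrite /Yseq.
transitivity (\sum_(i < n.+1) EE (fun M : 'M[K]_n.+1 =>
    (\adj (M + c%:M)) i i * phi (M + c'%:M) +
    (\sum_(j < n) (\adj (M + c%:M)) i (lift i j)) * phi (M + c'%:M))).
  rewrite -EE_sum; apply: EE_ext => M; rewrite /ones_fun /bform mulr_suml.
  apply: eq_bigr => i _; rewrite -mulrDl; congr (_ * _).
  rewrite (bigD1_ord i)//= mul1r mulr1; congr (_ + _).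
  by apply: eq_bigr => j _; rewrite mul1r mulr1.
have -> : n.+1%:R * Nseq n = \sum_(i < n.+1) EE (fun M : 'M[K]_n.+1 =>
    (\adj (M + c%:M)) i i * phi (M + c'%:M)).
  rewrite natr_sum_ord; apply: eq_bigr => i _.
  rewrite -(N_anyE i); apply: EE_ext => M.
  by rewrite mxE cofactor_diag pminor_addC.
rewrite [X in _ + X]mulr_suml -!big_split; apply: eq_bigr => i _ /=.
rewrite EE_D -addrA; congr (_ + _).
rewrite (EE_peel i).
transitivity (EE (fun M => \sum_k (
    pair_mom i (lift i k) 2 0 * (adj_row_sum (M + c%:M) k * al (M + c'%:M) k)
    + l11 * (adj_row_sum (M + c%:M) k * be (M + c'%:M) k)
    + pair_mom i (lift i k) 2 1 * (adj_row_sum (M + c%:M) k * Th (M + c'%:M) k k)))).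
  apply: EE_ext => M.
  transitivity (VE i (fun d r q => \sum_k (- adj_row_sum (M + c%:M) k) *
    (r k * vertex_affine
   (eps * \det (M + c'%:M) + c' * phi (M + c'%:M)) (phi (M + c'%:M))
    (al (M + c'%:M)) (be (M + c'%:M)) (Th (M + c'%:M)) d r q))).
    apply: VE_ext => d r q; rewrite phi_ins ins_addC.
    under eq_bigr do rewrite adj_ins_row.
    rewrite sumrN exchange_big /= -sumrN mulr_suml; apply: eq_bigr => k _.
    by rewrite -mulr_sumr /adj_row_sum; ring.
  rewrite VE_sum; apply: eq_bigr => k _; rewrite VE_Z VE_r_affine//; ring.
rewrite EE_sum mulr_sumr mulr_suml -!big_split; apply: eq_bigr => k _ /=.
rewrite !EE_D !EE_Z; congr (_ + _ * _).
case: n k i => [[]//|n] k i.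
transitivity (EE (fun M : 'M[K]_n.+1 => \det (pminor k M + c%:M) * phi (pminor k M + c'%:M)
   + \sum_(j < n) (\adj (M + c%:M)) k (lift k j) * phi (pminor k M + c'%:M))).
  apply: EE_ext => M; rewrite /adj_row_sum (bigD1_ord k)//= mulrDl.
  rewrite (expands_diag H) pminor_addC mulr_suml; congr (_ * _ + _).
  by rewrite mxE cofactor_diag pminor_addC.
rewrite EE_D EE_sum [X in _ + X]big1 ?addr0.
  exact: (EE_pminor k (fun M => \det (M + c%:M) * phi (M + c'%:M))).
by move=> j _; exact: (EE_adj_offdiag k j c (fun M => phi (M + c'%:M))).
Qed.

Lemma Y_0 : Yseq 0 = 0.
Proof. by rewrite /Yseq EE_0 /ones_fun /bform big_ord0 mul0r. Qed.

End Functional.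

(** * Products of two adjugates, and the recursion for two determinants *)

Section Quadratic.
Variables c c' : K.
Local Notation F := (Fseq c c').

Definition row_seq n (i : 'I_n) := EE (fun M : 'M[K]_n =>
  adj_row_sum (M + c%:M) i * adj_row_sum (M + c'%:M) i).
Definition col_seq n (i : 'I_n) := EE (fun M : 'M[K]_n =>
  adj_row_sum (M + c%:M) i * adj_col_sum (M + c'%:M) i).
(** The part of the double sum behind [row_seq] in which both column indices agree: [F_rec] produces
    this contraction, [Y_rec] the full sum. *)
Definition row_seq_diag n (i : 'I_n) := EE (fun M : 'M[K]_n =>
  \sum_j (\adj (M + c%:M)) i j * (\adj (M + c'%:M)) i j).
Definition col_seq_diag n (i : 'I_n) := EE (fun M : 'M[K]_n =>
  \sum_j (\adj (M + c%:M)) i j * (\adj (M + c'%:M)) j i).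

Lemma adj_row_sum_ins n (i : 'I_n.+1) d r q (B : 'M[K]_n) :
  adj_row_sum (ins i d r q B) i = \det B - \sum_k r k * adj_row_sum B k.
Proof.
rewrite /adj_row_sum (bigD1_ord i)//= adj_ins_diag; congr (_ + _).
under eq_bigr do rewrite adj_ins_row.
rewrite sumrN exchange_big; congr (- _).
by apply: eq_bigr => k _; rewrite mulr_sumr.
Qed.

Lemma adj_col_sum_ins n (i : 'I_n.+1) d r q (B : 'M[K]_n) :
  adj_col_sum (ins i d r q B) i = \det B - \sum_k adj_col_sum B k * q k.
Proof.
rewrite /adj_col_sum (bigD1_ord i)//= adj_ins_diag; congr (_ + _).
under eq_bigr do rewrite adj_ins_col.
rewrite sumrN exchange_big; congr (- _).
by apply: eq_bigr => k _; rewrite mulr_suml.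
Qed.

Lemma row_seq_rec n (i : 'I_n.+1) :
  row_seq i = F n + \sum_k pair_mom i (lift i k) 2 0 * row_seq k.
Proof.
rewrite /row_seq (EE_peel i).
under [X in _ = _ + X]eq_bigr do rewrite -EE_Z.
rewrite -EE_sum -EE_D; apply: EE_ext => M.
rewrite -(VE_rr_forms i); apply: VE_ext => d r q.
by rewrite !ins_addC !adj_row_sum_ins.
Qed.

Lemma col_seq_rec n (i : 'I_n.+1) : col_seq i = F n + l11 * \sum_(k < n) col_seq k.
Proof.
rewrite /col_seq (EE_peel i) -EE_sum -EE_Z -EE_D; apply: EE_ext => M.
rewrite -(VE_rq_forms i); apply: VE_ext => d r q.
by rewrite !ins_addC adj_row_sum_ins adj_col_sum_ins.
Qed.

Lemma row_seq_diag_rec n (i : 'I_n.+1) :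
  row_seq_diag i = F n + \sum_k pair_mom i (lift i k) 2 0 * row_seq_diag k.
Proof.
rewrite /row_seq_diag (EE_peel i).
under [X in _ = _ + X]eq_bigr do rewrite -EE_Z.
rewrite -EE_sum -EE_D; apply: EE_ext => M.
under [X in _ + X]eq_bigr do rewrite mulr_sumr.
rewrite exchange_big /=.
transitivity (VE i (fun d r q => \det (M + c%:M) * \det (M + c'%:M) + \sum_(j < n)
   (0 - \sum_k r k * (\adj (M + c%:M)) k j) * (0 - \sum_k r k * (\adj (M + c'%:M)) k j))).
  apply: VE_ext => d r q; rewrite (bigD1_ord i)//= !ins_addC !adj_ins_diag.
  congr (_ + _); apply: eq_bigr => j _; rewrite !adj_ins_row; ring.
rewrite VE_D VE_c VE_sum; congr (_ + _); apply: eq_bigr => j _.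
by rewrite VE_rr_forms mul0r add0r.
Qed.

Lemma col_seq_diag_rec n (i : 'I_n.+1) :
  col_seq_diag i = F n + l11 * \sum_(k < n) col_seq_diag k.
Proof.
rewrite /col_seq_diag (EE_peel i) -EE_sum -EE_Z -EE_D; apply: EE_ext => M.
rewrite exchange_big [X in _ + X]mulr_sumr /=.
transitivity (VE i (fun d r q => \det (M + c%:M) * \det (M + c'%:M) + \sum_(j < n)
   (0 - \sum_k r k * (\adj (M + c%:M)) k j) * (0 - \sum_k (\adj (M + c'%:M)) j k * q k))).
  apply: VE_ext => d r q; rewrite (bigD1_ord i)//= !ins_addC !adj_ins_diag.
  congr (_ + _); apply: eq_bigr => j _; rewrite adj_ins_row adj_ins_col; ring.
rewrite VE_D VE_c VE_sum; congr (_ + _); apply: eq_bigr => j _.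
by rewrite VE_rq_forms mul0r add0r.
Qed.

(** Both sides obey the same recursion, and there is no index to compare at [n = 0]. The cross terms
    thus average to zero. *)
Lemma row_seq_diagE n (i : 'I_n) : row_seq_diag i = row_seq i.
Proof.
elim: n i => [[]//|n IHn] i.
rewrite row_seq_diag_rec row_seq_rec; congr (_ + _).
by apply: eq_bigr => k _; rewrite IHn.
Qed.

Lemma col_seq_diagE n (i : 'I_n) : col_seq_diag i = col_seq i.
Proof.
elim: n i => [[]//|n IHn] i.
rewrite col_seq_diag_rec col_seq_rec; congr (_ + _ * _).
by apply: eq_bigr => k _; rewrite IHn.
Qed.

Lemma col_sum_rec n :
  \sum_(i < n) col_seq i = n%:R * (F n.-1 + l11 * \sum_(i < n.-1) col_seq i).
Proof.
case: n => [|n]; first by rewrite big_ord0 mul0r.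
by rewrite natr_sum_ord; apply: eq_bigr => i _; rewrite col_seq_rec.
Qed.

Lemma F_0 : F 0 = 1.
Proof. by rewrite /Fseq EE_0 !det_mx00 mul1r. Qed.

(** [VE_quad] at the first vertex. The product of traces gives [Nseq], the contractions of two
    adjugates give [col_seq_diag] and [row_seq_diag], and the products of equal diagonal entries
    give determinants on one vertex less. *)
Lemma F_rec n :
  F n.+1 = (kap 2 + c * c') * F n
  - l11 * (c * Xseq (@trace_fun K) c c' n + c' * Xseq (@trace_fun K) c' c n)
  + l11 ^+ 2 * (n%:R * Nseq (@trace_fun K) c c' n.-1 + \sum_(i < n) col_seq i)
  + l20 * l02 * (\sum_(i < n) row_seq i)
  + (l22 - 2 * l11 ^+ 2 - l20 * l02) * (n%:R * F n.-1).
Proof.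
transitivity (EE (fun M : 'M[K]_n =>
  (kap 2 + c * c') * (\det (M + c%:M) * \det (M + c'%:M))
  + (- l11) * (c * (\det (M + c%:M) * trace_fun (M + c'%:M)) +
              c' * (\det (M + c'%:M) * trace_fun (M + c%:M)))
  + l11 ^+ 2 * (\sum_i (\adj (M + c%:M)) i i * trace_fun (M + c'%:M)
     + \sum_i \sum_j (\adj (M + c%:M)) i j * (\adj (M + c'%:M)) j i)
  + l20 * l02 * (\sum_i \sum_j (\adj (M + c%:M)) i j * (\adj (M + c'%:M)) i j)
  + (l22 - 2 * l11 ^+ 2 - l20 * l02) *
     \sum_i (\adj (M + c%:M)) i i * (\adj (M + c'%:M)) i i)).
  rewrite /Fseq (EE_peel ord0); apply: EE_ext => M.
  transitivity (VE ord0 (fun d r q => ((d + c) * \det (M + c%:M) -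
    \sum_k \sum_l r k * (\adj (M + c%:M)) k l * q l) *
     ((d + c') * \det (M + c'%:M) -
    \sum_k \sum_l r k * (\adj (M + c'%:M)) k l * q l))).
    by apply: VE_ext => d r q; rewrite !ins_addC !det_ins.
  rewrite VE_quad -mulr_suml /trace_fun /mxtrace; ring.
rewrite !(EE_D, EE_Z, EE_sum).
congr (_ + _ + _ * (_ + _) + _ * _ + _ * _).
- by rewrite mulNr.
- case: n => [|n]; first by rewrite big_ord0 mul0r.
  rewrite natr_sum_ord; apply: eq_bigr => i _.
  rewrite -(N_anyE (trace_expands K) c c' i); apply: EE_ext => M.
  by rewrite mxE cofactor_diag pminor_addC.
- by apply: eq_bigr => i _; rewrite -col_seq_diagE.
- by apply: eq_bigr => i _; rewrite -row_seq_diagE.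
- case: n => [|n]; first by rewrite big_ord0 mul0r.
  rewrite natr_sum_ord; apply: eq_bigr => i _.
  rewrite /Fseq -(EE_pminor i); apply: EE_ext => M.
  by rewrite !mxE !cofactor_diag !pminor_addC.
Qed.

Lemma X_trace n :
  Xseq (@trace_fun K) c c' n = n%:R * Mseq (@det_fun K) c c' n.-1.
Proof.
rewrite /Xseq; case: n => [|n].
  by rewrite mul0r EE_0 /trace_fun /mxtrace big_ord0 mulr0.
rewrite natr_sum_ord.
transitivity (EE (fun M : 'M[K]_n.+1 => \sum_i (\det (M + c%:M) * \det (pminor i M + c'%:M)))).
  apply: EE_ext => M; rewrite -mulr_sumr; congr (_ * _); apply: eq_bigr => i _.
  by rewrite mxE cofactor_diag pminor_addC.
rewrite EE_sum; apply: eq_bigr => i _.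
exact: (M_anyE (@det_fun K) c c' i).
Qed.

End Quadratic.

Lemma Fseq_sym c c' n : Fseq c c' n = Fseq c' c n.
Proof. by apply: EE_ext => M; rewrite mulrC. Qed.

End FiniteModel.

(* [y_rec] entails y_(i+1) - y_i = (b - a) y_i on one vertex less, so [y] is a
   binomial transform of its values at the first vertex. *)
Section OrderedDescent.
Variables (K : comNzRingType) (a b : K) (F : nat -> K) (y : forall n, 'I_n -> K).
Hypothesis y_rec : forall n (i : 'I_n.+1),
  y i = F n + \sum_(k < n) (if (k < i)%N then b else a) * y k.

Let V n := \sum_(i < n) y i.
Let W n := F n.-1 + a * V n.-1.
Let g n i := \sum_(k < i.+1) 'C(i, k)%:R * (b - a) ^+ k * W (n - k).

(** Pascal's rule; the truncated subtractions agree even at [n = 0]. *)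
Let gS n i : g n i.+1 = g n i + (b - a) * g n.-1 i.
Proof.
rewrite /g big_ord_recl.
have -> : \sum_(k < i.+1) 'C(i, k)%:R * (b - a) ^+ k * W (n - k) =
    'C(i, 0)%:R * (b - a) ^+ 0 * W (n - 0) +
    \sum_(k < i.+1) 'C(i, k.+1)%:R * (b - a) ^+ k.+1 * W (n - k.+1).
  rewrite big_ord_recl; congr (_ + _).
  rewrite [RHS]big_ord_recr /= bin_small// !mul0r addr0.
  by apply: eq_bigr => k _.
rewrite !bin0 -addrA; congr (_ + _); rewrite mulr_sumr -big_split.
apply: eq_bigr => k _ /=; rewrite /bump /= !add1n binS natrD.
have -> : (n.-1 - k = n - k.+1)%N by rewrite -subn1 -subnDA add1n.
by rewrite exprS; ring.
Qed.

Let y_closed n (i : 'I_n) : y i = g n i.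
Proof.
elim: n i => [[]//|n IHn] [m mn].
elim: m mn => [|m IHm] mn.
  rewrite y_rec /g big_ord1 bin0 subn0 !mul1r /W /=; congr (_ + _).
  by rewrite mulr_sumr.
rewrite gS -(IHm (ltnW mn)) -(IHn (Ordinal (mn : m < n)%N)) !y_rec -addrA.
congr (_ + _); rewrite (bigD1 (Ordinal (mn : m < n)%N))//= ltnSn.
rewrite [in RHS](bigD1 (Ordinal (mn : m < n)%N))//= ltnn.
set S1 := \sum_(_ < _ | _) _; set S2 := \sum_(_ < _ | _) _.
have -> : S1 = S2; last by ring.
apply: eq_bigr => k; rewrite -val_eqE /= => km.
by rewrite ltnS leq_eqVlt (negbTE km).
Qed.

(** The hockey-stick identity. Its shift of the lower index is what turns e^(ct) into (e^(ct) - 1)/c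
    in the generating function. *)
Let sum_bin n k : (\sum_(i < n) 'C(i, k) = 'C(n, k.+1))%N.
Proof.
elim: n => [|n IHn]; first by rewrite big_ord0.
by rewrite big_ord_recr /= IHn binS addnC.
Qed.

Lemma ordered_descent n :
  \sum_(i < n) y i = \sum_(k < n) 'C(n, k.+1)%:R * (b - a) ^+ k *
    (F (n - k.+1)%N + a * \sum_(i < n - k.+1) y i).
Proof.
transitivity (\sum_(i < n) \sum_(k < n) 'C(i, k)%:R * (b - a) ^+ k * W (n - k)).
  apply: eq_bigr => i _; rewrite y_closed /g.
  rewrite (big_ord_widen n (fun k => 'C(i, k)%:R * (b - a) ^+ k * W (n - k)))//.
  rewrite big_mkcond; apply: eq_bigr => k _; case: ifP => // /negbT.
  by rewrite -leqNgt => ik; rewrite bin_small// !mul0r.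
rewrite exchange_big; apply: eq_bigr => k _ /=.
by rewrite -!mulr_suml -natr_sum sum_bin /W subnS.
Qed.

End OrderedDescent.

(** * Formal power series *)

Section PowerSeries.
Variable K : numFieldType.
Implicit Types (F G : fps K) (c d : K).

Lemma fcoefD F G n : fcoef (F + G) n = fcoef F n + fcoef G n.
Proof. by []. Qed.

Lemma fcoefN F n : fcoef (- F) n = - fcoef F n.
Proof. by []. Qed.

Lemma fcoefM F G n :
  fcoef (F * G) n = \sum_(i < n.+1) fcoef F i * fcoef G (n - i).
Proof. by []. Qed.

Lemma fcoefM0 F G : fcoef (F * G) 0 = fcoef F 0 * fcoef G 0.
Proof. by rewrite fcoefM big_ord1 subn0. Qed.

Lemma fcoef1 n : fcoef (1 : fps K) n = (n == 0%N)%:R.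
Proof. by case: n. Qed.

Lemma fps_const0 : 0%:S = 0 :> fps K.
Proof. by apply: fpsP => -[]. Qed.

Lemma fps_constD c d : (c + d)%:S = c%:S + d%:S.
Proof. by apply: fpsP => -[|n] //=; rewrite addr0. Qed.

Lemma fps_constN c : (- c)%:S = - c%:S.
Proof. by apply: fpsP => -[|n] //=; rewrite oppr0. Qed.

Lemma fps_constB c d : (c - d)%:S = c%:S - d%:S.
Proof. by rewrite fps_constD fps_constN. Qed.

Lemma fcoefCM c F n : fcoef (c%:S * F) n = c * fcoef F n.
Proof.
rewrite fcoefM big_ord_recl subn0 big1 ?addr0// => i _.
by rewrite /= mul0r.
Qed.

Lemma fps_constM c d : (c * d)%:S = c%:S * d%:S.
Proof. by apply: fpsP => -[|n]; rewrite fcoefCM //= mulr0. Qed.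

Lemma fps_constX c k : (c ^+ k)%:S = c%:S ^+ k.
Proof. by elim: k => // k IHk; rewrite !exprS fps_constM IHk. Qed.

Lemma fps_const_nat k : (k%:R)%:S = k%:R :> fps K.
Proof.
elim: k => [|k IHk]; first by apply: fpsP => -[].
by rewrite !mulrS -IHk fps_constD.
Qed.

Lemma fcoefXM0 F : fcoef (fps_var * F) 0 = 0.
Proof. by rewrite fcoefM0 /= mul0r. Qed.

Lemma fcoefXMS F n : fcoef (fps_var * F) n.+1 = fcoef F n.
Proof.
rewrite fcoefM big_ord_recl /= mul0r add0r big_ord_recl /= mul1r subSS subn0.
by rewrite big1 ?addr0// => i _; rewrite mul0r.
Qed.

Lemma fps_unitE F : (F \is a GRing.unit) = (fcoef F 0 != 0).
Proof. by []. Qed.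

Definition fps_deriv F : fps K := Fps (fun n => n.+1%:R * fcoef F n.+1).

Lemma fps_derivD F G : fps_deriv (F + G) = fps_deriv F + fps_deriv G.
Proof. by apply: fpsP => n; rewrite /= mulrDr. Qed.

Lemma fps_derivN F : fps_deriv (- F) = - fps_deriv F.
Proof. by apply: fpsP => n; rewrite /= mulrN. Qed.

Lemma fps_derivC c : fps_deriv c%:S = 0.
Proof. by apply: fpsP => n; rewrite /= mulr0. Qed.

Lemma fps_derivX : fps_deriv fps_var = 1.
Proof. by apply: fpsP => -[|n] /=; rewrite ?mulr1// mulr0. Qed.

Lemma fps_derivM F G : fps_deriv (F * G) = fps_deriv F * G + F * fps_deriv G.
Proof.
apply: fpsP => n; rewrite fcoefD [LHS]/= mulr_sumr.
transitivity (\sum_(i < n.+2) (i%:R * fcoef F i) * fcoef G (n.+1 - i) +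
   \sum_(i < n.+2) fcoef F i * ((n.+1 - i)%:R * fcoef G (n.+1 - i))).
  rewrite -big_split; apply: eq_bigr => i _ /=.
  by rewrite -{1}(subnKC (leq_ord i)) natrD; ring.
congr (_ + _).
  rewrite big_ord_recl mul0r mul0r add0r; apply: eq_bigr => i _ /=.
  by rewrite subSS.
rewrite big_ord_recr /= subnn mul0r mulr0 addr0; apply: eq_bigr => i _ /=.
by rewrite subSn// leq_ord.
Qed.

Lemma fps_derivCM c F : fps_deriv (c%:S * F) = c%:S * fps_deriv F.
Proof. by rewrite fps_derivM fps_derivC mul0r add0r. Qed.

Lemma fps_deriv_exprS F k :
  fps_deriv (F ^+ k.+1) = k.+1%:R * (F ^+ k * fps_deriv F).
Proof.
elim: k => [|k IHk]; first by rewrite expr0 expr1 !mul1r.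
by rewrite exprS fps_derivM IHk [in RHS]mulrS exprS; ring.
Qed.

Lemma fps_derivV F : F \is a GRing.unit ->
  fps_deriv F^-1 = - fps_deriv F * F^-1 ^+ 2.
Proof.
move=> uF; apply: (mulrI uF).
have := congr1 fps_deriv (divrr uF); rewrite fps_derivM.
have -> : fps_deriv 1 = 0 by exact: (fps_derivC 1).
move=> /eqP; rewrite addrC addr_eq0 => /eqP ->.
have := divrr uF; move: F^-1 => iF FiF.
transitivity (- fps_deriv F * iF * (F * iF)); last by ring.
by rewrite FiF mulr1 mulNr.
Qed.

Lemma fcoef_expr_lt F k n : fcoef F 0 = 0 -> (n < k)%N -> fcoef (F ^+ k) n = 0.
Proof.
move=> F0; elim: k n => // k IHk n nk; rewrite exprS fcoefM big1// => i _.
case: (eqVneq (i : nat) 0%N) => [->|i0]; first by rewrite F0 mul0r.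
rewrite IHk ?mulr0//; rewrite ltnS in nk.
by apply: leq_trans nk; rewrite ltn_subrL lt0n i0 /= (leq_trans _ (leq_ord i))// lt0n.
Qed.

(** A common truncation for all coefficients up to [m], needed to exchange the two sums in
    [fps_deriv_exp]. *)
Lemma fps_exp_coefW F n m : fcoef F 0 = 0 -> (n <= m)%N ->
  fcoef (fps_exp F) n = \sum_(k < m.+1) k`!%:R^-1 * fcoef (F ^+ k) n.
Proof.
move=> F0 nm; rewrite /=.
rewrite (big_ord_widen m.+1 (fun k => k`!%:R^-1 * fcoef (F ^+ k) n))//.
rewrite big_mkcond; apply: eq_bigr => k _; case: ifP => // /negbT.
by rewrite -leqNgt => nk; rewrite fcoef_expr_lt ?mulr0.
Qed.

Lemma fps_deriv_exp F : fcoef F 0 = 0 ->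
  fps_deriv (fps_exp F) = fps_deriv F * fps_exp F.
Proof.
move=> F0; apply: fpsP => n; rewrite fcoefM.
transitivity (\sum_(k < n.+1) k`!%:R^-1 * fcoef (fps_deriv F * F ^+ k) n).
  rewrite [LHS]/= mulr_sumr big_ord_recl expr0 fcoef1 /= !mulr0 add0r.
  apply: eq_bigr => k _.
  have Hd : n.+1%:R * fcoef (F ^+ k.+1) n.+1 =
      fcoef (k.+1%:R * (F ^+ k * fps_deriv F)) n by rewrite -fps_deriv_exprS.
  rewrite /bump add1n mulrCA Hd.
  rewrite -fps_const_nat fcoefCM factS natrM invfM mulrA; congr (_ * _).
    by rewrite mulrC mulrA divff ?mul1r// pnatr_eq0.
  by rewrite mulrC.
under eq_bigr => k _ do rewrite fcoefM mulr_sumr.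
rewrite exchange_big; apply: eq_bigr => i _.
rewrite (fps_exp_coefW F0 (leq_subr i n)) mulr_sumr.
by apply: eq_bigr => k _; rewrite mulrCA.
Qed.

(** The equation determines [n.+1] times each coefficient from the earlier ones, and [n.+1] is
    invertible in characteristic 0. *)
Lemma fps_ode_uniq F1 F2 G : fcoef F1 0 = fcoef F2 0 ->
  fps_deriv F1 = F1 * G -> fps_deriv F2 = F2 * G -> F1 = F2.
Proof.
move=> F0 F1G F2G; apply: fpsP => n; elim/ltn_ind: n => -[//|n] IHn.
have := congr1 (fun H => fcoef H n) F1G; have := congr1 (fun H => fcoef H n) F2G.
rewrite /= => H2 H1; have n0 : n.+1%:R != 0 :> K by rewrite pnatr_eq0.
apply: (mulfI n0); rewrite H1 H2; apply: eq_bigr => i _.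
by rewrite IHn.
Qed.

Definition egf (u : nat -> K) : fps K := Fps (fun n => u n / n`!%:R).

Lemma eq_egf u v : u =1 v -> egf u = egf v.
Proof. by move=> uv; apply: fpsP => n; rewrite /= uv. Qed.

Lemma egfD u v : egf (fun n => u n + v n) = egf u + egf v.
Proof. by apply: fpsP => n; rewrite /= mulrDl. Qed.

Lemma egfN u : egf (fun n => - u n) = - egf u.
Proof. by apply: fpsP => n; rewrite /= mulNr. Qed.

Lemma egfZ c u : egf (fun n => c * u n) = c%:S * egf u.
Proof. by apply: fpsP => n; rewrite fcoefCM /= mulrA. Qed.

Lemma egf_shift u : egf (fun n => n%:R * u n.-1) = fps_var * egf u.
Proof.
apply: fpsP => -[|n]; first by rewrite fcoefXM0 /= !mul0r.
by rewrite fcoefXMS /= factS natrM invfM mulrACA divff ?mul1r// pnatr_eq0.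
Qed.

Lemma fps_deriv_egf u : fps_deriv (egf u) = egf (fun n => u n.+1).
Proof.
apply: fpsP => n /=; rewrite factS natrM invfM mulrA mulrACA.
by rewrite divff ?mul1r// pnatr_eq0.
Qed.

(** The series (e^(ct) - 1)/c, given by coefficients so that it makes sense for [c = 0], where it is
    [t]. *)
Definition expm1_quotient c : fps K :=
  Fps (fun n => if n is k.+1 then c ^+ k / n`!%:R else 0).

Lemma egf_binomial c u :
  egf (fun n => \sum_(k < n) 'C(n, k.+1)%:R * c ^+ k * u (n - k.+1)%N) =
  expm1_quotient c * egf u.
Proof.
apply: fpsP => n; rewrite fcoefM big_ord_recl mul0r add0r /= mulr_suml.
apply: eq_bigr => k _ /=; rewrite ?add1n.
have E : (n`!%:R = 'C(n, k.+1)%:R * k.+1`!%:R * (n - k.+1)`!%:R :> K).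
  by rewrite -!natrM -mulnA bin_fact.
have B : 'C(n, k.+1)%:R != 0 :> K by rewrite pnatr_eq0 -lt0n bin_gt0.
rewrite E !invfM.
have -> : 'C(n, k.+1)%:R * c ^+ k * u (n - k.+1)%N *
    ('C(n, k.+1)%:R^-1 / k.+1`!%:R / (n - k.+1)`!%:R) =
  ('C(n, k.+1)%:R / 'C(n, k.+1)%:R) * (c ^+ k / k.+1`!%:R * (u (n - k.+1)%N / (n - k.+1)`!%:R)).
  by move: (_^-1) (_^-1) (_^-1) => i1 i2 i3; ring.
by rewrite divff// mul1r.
Qed.

Lemma expm1_quotient0 : expm1_quotient 0 = fps_var.
Proof.
apply: fpsP => -[|[|n]] //=; first by rewrite expr0 divff// oner_eq0.
by rewrite expr0n mul0r.
Qed.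

Lemma fps_deriv_expm1_quotient c :
  fps_deriv (expm1_quotient c) = 1 + c%:S * expm1_quotient c.
Proof.
apply: fpsP => n; rewrite fcoefD fcoefCM fcoef1 /=.
rewrite factS natrM invfM mulrA mulrACA divff ?pnatr_eq0// mul1r.
case: n => [|n]; first by rewrite expr0 fact0 divff ?oner_eq0// mulr0 addr0.
by rewrite add0r exprS mulrA.
Qed.

Lemma fps_exp_linear c : fps_exp (c%:S * fps_var) = 1 + c%:S * expm1_quotient c.
Proof.
apply: (@fps_ode_uniq _ _ c%:S).
- rewrite fcoefD fcoefCM fcoef1 /= big_ord1 expr0 fcoef1 fact0.
  by rewrite mulr0 addr0 mulr1 invr1.
- by rewrite fps_deriv_exp ?fcoefCM ?mulr0// fps_derivCM fps_derivX mulr1 mulrC.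
rewrite fps_derivD fps_derivCM fps_deriv_expm1_quotient.
have -> : fps_deriv 1 = 0 by exact: (fps_derivC 1).
by rewrite add0r mulrC.
Qed.

End PowerSeries.

(** * The differential equation of [Q_series] *)

Section ClosedForm.
Variables (K : numFieldType) (l : nat -> nat -> K) (k2 c1 c2 : K).
Local Notation t := (fps_var : fps K).
Local Notation l11 := (l 1 1)%:S.
Local Notation l20 := (l 2 0)%:S.
Local Notation l02 := (l 0 2)%:S.
Local Notation D := (1 - ((l 1 1) ^+ 2)%:S * t ^+ 2).
Local Notation Psi := (expm1_quotient (l 0 2 - l 2 0)).

Lemma unit_1B (F : fps K) : fcoef F 0 = 0 -> 1 - F \is a GRing.unit.
Proof. by move=> F0; rewrite fps_unitE fcoefD fcoefN F0 subr0 oner_neq0. Qed.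

Lemma unit_D : D \is a GRing.unit.
Proof. by apply: unit_1B; rewrite fcoefCM fcoefM0 mul0r mulr0. Qed.

Lemma unit_lin (c : K) : 1 - c%:S * t \is a GRing.unit.
Proof. by apply: unit_1B; rewrite fcoefCM mulr0. Qed.

Lemma unit_Psi (c d : K) : 1 - c%:S * expm1_quotient d \is a GRing.unit.
Proof. by apply: unit_1B; rewrite fcoefCM mulr0. Qed.

(** With e^(ct) = 1 + c Psi, the denominator [l02 - l20 e^(ct)] is c (1 - l20 Psi). Cancelling c
    gives a form that is also right in the limit case. *)
Lemma ratio_constE : ratio_const l = (1 - l20 * Psi)^-1.
Proof.
rewrite /ratio_const; case: eqP => [E|/eqP E].
  by rewrite E subrr expm1_quotient0.
have dn : (l 0 2 - l 2 0)%:S \is a GRing.unit.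
  by rewrite fps_unitE /= subr_eq0.
rewrite fps_exp_linear.
have -> : l02 - l20 * (1 + (l 0 2 - l 2 0)%:S * Psi) =
  (l 0 2 - l 2 0)%:S * (1 - l20 * Psi) by rewrite fps_constB; ring.
by rewrite invrM ?unit_Psi// mulrCA divrr// mulr1.
Qed.

Lemma ratio_expm1E : ratio_expm1 l = Psi / (1 - l20 * Psi).
Proof.
rewrite /ratio_expm1; case: eqP => [E|/eqP E].
  by rewrite E subrr expm1_quotient0.
have dn : (l 0 2 - l 2 0)%:S \is a GRing.unit.
  by rewrite fps_unitE /= subr_eq0.
rewrite fps_exp_linear.
have -> : l02 - l20 * (1 + (l 0 2 - l 2 0)%:S * Psi) =
  (l 0 2 - l 2 0)%:S * (1 - l20 * Psi) by rewrite fps_constB; ring.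
rewrite invrM ?unit_Psi// [1 + _]addrC addrK.
by rewrite [X in X * _]mulrC mulrACA divrr// mulr1.
Qed.

(** The constant [l20] is split off because the [- l20] in the exponent of [Q_series] cancels it. *)
Lemma ratio_const_deriv :
  fps_deriv (ratio_const l) = ratio_const l * (l20 + l20 * l02 * ratio_expm1 l).
Proof.
rewrite ratio_constE ratio_expm1E fps_derivV ?unit_Psi//.
rewrite fps_derivD fps_derivN fps_derivCM fps_deriv_expm1_quotient.
rewrite (fps_derivC 1).
have := divrr (unit_Psi (l 2 0) (l 0 2 - l 2 0)).
rewrite !fps_constB; move: Psi => P; move: ((1 - l20 * P)^-1) => r rP.
have -> : - (0 - l20 * (1 + (l02 - l20) * P)) * r ^+ 2 =
  r * (l20 * ((1 - l20 * P) * r) + l20 * l02 * (P * r)) by ring.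
by rewrite rP mulr1.
Qed.

Local Notation j := (D^-1).

Lemma D_inv : (l 1 1 ^+ 2)%:S * t ^+ 2 * j = j - 1.
Proof.
have := divrr unit_D; move: j => i E.
by transitivity (i - D * i); [ring | rewrite E].
Qed.

Lemma D_inv_deriv : fps_deriv j = 2 * (l 1 1 ^+ 2)%:S * t * j ^+ 2.
Proof.
rewrite fps_derivV ?unit_D// fps_derivD fps_derivN fps_derivCM (fps_derivC 1).
rewrite expr2 fps_derivM fps_derivX; ring.
Qed.

Lemma lin_inv_deriv (c : K) :
  fps_deriv (1 - c%:S * t)^-1 = (1 - c%:S * t)^-1 * (c%:S * (1 - c%:S * t)^-1).
Proof.
rewrite fps_derivV ?unit_lin// fps_derivD fps_derivN fps_derivCM (fps_derivC 1).
rewrite fps_derivX; ring.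
Qed.

Lemma fps_two_unit : (2 : fps K) \is a GRing.unit.
Proof.
by rewrite -(fps_const_nat K 2) fps_unitE /= pnatr_eq0.
Qed.

Lemma half_sqr_deriv : fps_deriv (t ^+ 2 / 2) = t.
Proof.
rewrite -(fps_const_nat K 2).
have -> : (2%:R : K)%:S^-1 = (2%:R^-1)%:S.
  have u2 : (2%:R : K)%:S \is a GRing.unit by rewrite fps_const_nat fps_two_unit.
  apply: (mulrI u2); rewrite divrr// -fps_constM divff ?pnatr_eq0//.
rewrite mulrC fps_derivCM expr2 fps_derivM fps_derivX mul1r mulr1.
rewrite -mulr2n -[t *+ 2]mulr_natl mulrA -(fps_const_nat K 2) -fps_constM mulVf ?pnatr_eq0//.
by rewrite mul1r.
Qed.

Lemma sqrt_D_deriv : fps_deriv (fps_sqrt D)^-1 =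
  (fps_sqrt D)^-1 * ((l 1 1 ^+ 2)%:S * t * j).
Proof.
have n2 : 2 != 0 :> K by rewrite pnatr_eq0.
have D0 : fcoef D 0 = 1.
  by rewrite fcoefD fcoefN fcoefCM fcoefM0 mul0r mulr0 subr0 fcoef1.
have SD := fps_sqrtK n2 D0.
have uS : fps_sqrt D \is a GRing.unit by rewrite fps_unitE fps_sqrt0 oner_neq0.
have := congr1 (@fps_deriv K) SD.
rewrite expr2 fps_derivM fps_derivD fps_derivN fps_derivCM (fps_derivC 1).
rewrite expr2 fps_derivM fps_derivX => S'.
rewrite fps_derivV//.
have -> : j = (fps_sqrt D)^-1 ^+ 2 by rewrite -{1}SD exprVn.
apply: (mulrI fps_two_unit).
move: S' (divrr uS); move: (fps_deriv (fps_sqrt D)) => S'.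
move: ((fps_sqrt D)^-1) => iS; move: (fps_sqrt D) => S E1 E2.
(* The last term vanishes since [S * iS = 1], and [E1] evaluates the first. *)
transitivity (- (S' * S + S * S') * iS ^+ 3 + 2 * S' * iS ^+ 2 * (S * iS - 1)); first by ring.
rewrite E1 E2; ring.
Qed.

Local Notation exponent :=
  ((c1 * c2 + k2 - l 1 1 - l 2 0)%:S * t
   + t ^+ 2 / 2 * (l 2 2 - 2 * l 1 1 ^+ 2 - l 0 2 * l 2 0)%:S
   + (c1 * c2 * l 1 1 ^+ 2)%:S * t ^+ 3 / D
   - t ^+ 2 / 2 * (((c1 ^+ 2 + c2 ^+ 2) * l 1 1)%:S / D)).

(** By [D_inv] the cubic term equals c1 c2 t (j - 1), whose derivative is j - 1 + 2 j (j - 1) times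
    c1 c2. In the last term, j + j (j - 1) collapses to j^2. *)
Lemma exponent_deriv : fps_deriv exponent =
  (c1 * c2 + k2 - l 1 1 - l 2 0)%:S
  + t * (l 2 2 - 2 * l 1 1 ^+ 2 - l 0 2 * l 2 0)%:S
  + c1%:S * c2%:S * (2 * j ^+ 2 - j - 1)
  - (c1%:S ^+ 2 + c2%:S ^+ 2) * l11 * t * j ^+ 2.
Proof.
rewrite !fps_derivD fps_derivN fps_derivCM fps_derivX mulr1.
rewrite [fps_deriv (_ * (((c1 ^+ 2 + c2 ^+ 2) * l 1 1)%:S * j))]fps_derivM.
rewrite [fps_deriv (_ * (_ - _)%:S)]fps_derivM.
rewrite half_sqr_deriv (fps_derivC (_ - _)) fps_derivCM.
rewrite [fps_deriv (_ * j)]fps_derivM D_inv_deriv fps_derivCM fps_deriv_exprS.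
rewrite fps_derivX.
have := D_inv; have := divrr fps_two_unit.
move: j (2^-1) => i h.
rewrite !(fps_constM, fps_constX, fps_constD c1 c2) (fps_constD (c1 ^+ 2)) !fps_constX.
move: ((_ - _ - _)%:S) ((_ - _ - _)%:S) => m0 m1 /eqP; rewrite -subr_eq0 => /eqP h2 /eqP.
rewrite -subr_eq0 => /eqP ir.
set a := l11 ^+ 2 * t ^+ 2 * i in ir.
(* The sides agree modulo [D_inv], that is [r = 0], and [hh = 0], which says that [h] is one
   half. *)
pose r := a - (i - 1); pose hh := 2 * h - 1.
transitivity (m1 + t * m0 + c1%:S * c2%:S * (2 * i ^+ 2 - i - 1)
  - (c1%:S ^+ 2 + c2%:S ^+ 2) * l11 * t * i ^+ 2
  + (c1%:S * c2%:S * (3 * r + 2 * r * (a + i - 1))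
     - (c1%:S ^+ 2 + c2%:S ^+ 2) * l11 * t * i * (r + hh * a))).
  rewrite /r /hh /a. ring.
rewrite (_ : r = 0)// (_ : hh = 0)//; ring.
Qed.

(** The right-hand side of [F_rec] as a generating function divided by that of [Fseq]: the summands
    come, in order, from the determinants, the traces, [Nseq] with [col_seq], [row_seq], and the
    correction for four equal indices. *)
Definition log_deriv_Q : fps K :=
  (k2 + c1 * c2)%:S
  - l11 * (c1%:S * t * (c1%:S - l11 * t * c2%:S) * j
           + c2%:S * t * (c2%:S - l11 * t * c1%:S) * j)
  + l11 ^+ 2 * (t * j * (1 + (c2%:S - l11 * t * c1%:S) * t
                          * (c1%:S - l11 * t * c2%:S) * j)
                + t * (1 - l11 * t)^-1)
  + l20 * l02 * ratio_expm1 l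
  + (l 2 2 - 2 * l 1 1 ^+ 2 - l 2 0 * l 0 2)%:S * t.

(** Logarithmic derivatives of the factors add up. The [- l11] of the exponent is absorbed by that
    of [(1 - l11 * t)^-1], which is [l11 + l11^2 t / (1 - l11 t)]. *)
Lemma Q_series_deriv :
  fps_deriv (Q_series l k2 c1 c2) = Q_series l k2 c1 c2 * log_deriv_Q.
Proof.
rewrite /Q_series.
have uS : fps_sqrt D \is a GRing.unit by rewrite fps_unitE fps_sqrt0 oner_neq0.
rewrite invrM ?unit_lin// !fps_derivM ratio_const_deriv lin_inv_deriv sqrt_D_deriv.
rewrite fps_deriv_exp; last first.
  rewrite !fcoefD !fcoefN fcoefCM mulr0 !fcoefM0 /=; ring.
rewrite exponent_deriv /log_deriv_Q.
have := D_inv; have := divrr (unit_lin (l 1 1)).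
rewrite [l 0 2 * l 2 0]mulrC.
move: (fps_exp _) (ratio_const l) (ratio_expm1 l) ((fps_sqrt _)^-1) => e rho R S.
move: j ((1 - l11 * t)^-1) => i i1.
rewrite !(fps_constD, fps_constN, fps_constM, fps_constX, fps_const_nat).
move=> /eqP; rewrite -subr_eq0 => /eqP hi1 /eqP; rewrite -subr_eq0 => /eqP hi.
(* The two sides agree modulo the relations [r = 0] and [r1 = 0]. *)
pose r := l11 ^+ 2 * t ^+ 2 * i - (i - 1); pose r1 := (1 - l11 * t) * i1 - 1.
pose C := c1%:S * c2%:S; pose s := c1%:S ^+ 2 + c2%:S ^+ 2.
rewrite -![1%:S]/(1 : fps K) -[RHS]subr0.
transitivity (rho * e * (S * i1) * (k2%:S + C
  - l11 * (c1%:S * t * (c1%:S - l11 * t * c2%:S) * i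
           + c2%:S * t * (c2%:S - l11 * t * c1%:S) * i)
  + l11 ^+ 2 * (t * i * (1 + (c2%:S - l11 * t * c1%:S) * t
                          * (c1%:S - l11 * t * c2%:S) * i)
                + t * i1)
  + l20 * l02 * R
  + ((l 2 2)%:S - 2 * l11 ^+ 2 - l20 * l02) * t)
  - rho * e * (S * i1) * (r * (C * (l11 ^+ 2 * t ^+ 2 * i + 2 * i + 1)
                               - s * l11 * t * i) - l11 * r1)).
  by rewrite /r /r1 /C /s; ring.
rewrite (_ : r = 0)// (_ : r1 = 0)// /C; ring.
Qed.

Lemma Q_series0 : fcoef (Q_series l k2 c1 c2) 0 = 1.
Proof.
have V0 (F : fps K) : fcoef F 0 = 1 -> fcoef F^-1 0 = 1.
  move=> F0; have uF : F \is a GRing.unit by rewrite fps_unitE F0 oner_neq0.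
  by have /(congr1 (fun G => fcoef G 0)) := divrr uF; rewrite fcoefM0 F0 mul1r.
rewrite /Q_series !fcoefM0 ratio_constE !V0 ?mulr1 ?mul1r.
- by rewrite /= big_ord1 expr0 fcoef1 fact0 mulr1 invr1.
- rewrite fcoefM0 fps_sqrt0 mulr1 fcoefD fcoefN fcoefCM mulr0 subr0 fcoef1 //.
- by rewrite fcoefD fcoefN fcoefCM mulr0 subr0 fcoef1.
Qed.

End ClosedForm.

(** * The generating function of the model *)

Section ModelSeries.
Variables (K : numFieldType) (A : finType) (wo wd x y z : A -> K).
Local Notation mom := (mom wo x y).
Local Notation kap := (kap wd z).
Local Notation EE := (EE wo wd x y z).
Hypotheses (mom00 : mom 0 0 = 1) (kap0 : kap 0 = 1).
Hypotheses (mom10 : mom 1 0 = 0) (mom01 : mom 0 1 = 0) (kap1 : kap 1 = 0).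
Local Notation t := (fps_var : fps K).
Local Notation l11 := (mom 1 1)%:S.
Local Notation l20 := (mom 2 0)%:S.
Local Notation l02 := (mom 0 2)%:S.
Local Notation D := (1 - ((mom 1 1) ^+ 2)%:S * t ^+ 2).
Local Notation j := (D^-1).
Local Notation Fseq := (Fseq wo wd x y z).
Local Notation Xseq := (Xseq wo wd x y z).
Local Notation Nseq := (Nseq wo wd x y z).
Local Notation Mseq := (Mseq wo wd x y z).
Local Notation Yseq := (Yseq wo wd x y z).
Local Notation detf := (@det_fun K).
Local Notation tracef := (@trace_fun K).
Local Notation onesf := (@ones_fun K).

(** Substituting the second equation into the first leaves [N] multiplied by [D]. *)
Lemma NM_solve (N M X B : fps K) (c c' : K) :
  N = B + c'%:S * X - l11 * (t * M) -> M = c%:S * X - l11 * (t * N) ->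
  N = (B + (c'%:S - l11 * t * c%:S) * X) * j.
Proof.
move=> E1 E2; apply: (mulIr (unit_D mom)); rewrite mulrVK ?unit_D//.
rewrite fps_constX.
transitivity (N - l11 * t * (l11 * (t * N))); first by ring.
rewrite {1}E1 E2; ring.
Qed.

Lemma egf_N eps phi Th al be c c' : expands eps phi Th al be ->
  egf (Nseq phi c c') = (eps%:S * egf (Fseq c c')
    + (c'%:S - l11 * t * c%:S) * egf (Xseq phi c c')) * j.
Proof.
move=> H; apply: (@NM_solve _ (egf (Mseq phi c c'))).
  rewrite -egf_shift -!egfZ -egfN -!egfD; apply: eq_egf => n.
  exact: (N_rec mom00 kap0 mom10 mom01 kap1 H).
rewrite -egf_shift -!egfZ -egfN -!egfD; apply: eq_egf => n.
exact: (M_rec mom00 kap0 mom10 mom01 kap1 H).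
Qed.

(** When [phi] is the determinant the two factors are alike, so [Mseq] is [Nseq] with the shifts
    exchanged. *)
Lemma egf_M_det c c' :
  egf (Mseq detf c c') = egf (Fseq c c') * (c%:S - l11 * t * c'%:S) * j.
Proof.
have -> : egf (Mseq detf c c') = egf (Nseq detf c' c).
  by apply: eq_egf => n; apply: EE_ext => M; rewrite mulrC.
rewrite (egf_N _ _ (det_expands K)).
have -> : egf (Xseq detf c' c) = egf (Fseq c c').
  by apply: eq_egf => n; apply: EE_ext => M; rewrite mulrC.
by rewrite fps_const0 mul0r add0r [_ * egf _]mulrC.
Qed.

Lemma egf_X_trace c c' : egf (Xseq tracef c c') =
  t * (egf (Fseq c c') * (c%:S - l11 * t * c'%:S) * j).
Proof.
rewrite -egf_M_det -egf_shift; apply: eq_egf => n.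
exact: X_trace.
Qed.

Section Fixed.
Variables c c' : K.
Local Notation F := (egf (Fseq c c')).
Local Notation U := (egf (fun n => \sum_(i < n) col_seq wo wd x y z c c' i)).
Local Notation V := (egf (fun n => \sum_(i < n) row_seq wo wd x y z c c' i)).

Lemma egf_col : U = F * (t * (1 - l11 * t)^-1).
Proof.
have E : U = t * (F + l11 * U).
  rewrite -egfZ -egfD -egf_shift; apply: eq_egf => n.
  exact: col_sum_rec.
apply: (mulIr (unit_lin (mom 1 1))); rewrite mulrA mulrVK ?unit_lin//.
by rewrite mulrBr mulr1 {1}E; ring.
Qed.

Lemma egf_row : V = F * ratio_expm1 mom.
Proof.
have E : V = expm1_quotient (mom 0 2 - mom 2 0) * (F + l20 * V).
  rewrite -egfZ -egfD -egf_binomial; apply: eq_egf => n.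
  apply: (@ordered_descent _ _ _ (Fseq c c') (fun n => @row_seq K A wo wd x y z c c' n)).
  move=> m i; rewrite row_seq_rec//; congr (_ + _); apply: eq_bigr => k _.
  (* [lift i k] lies after [i] exactly when [k] is at least [i]; this selects [l20], and [l02]
     otherwise. *)
  congr (_ * _); rewrite /pair_mom /= /bump.
  case: (ltnP k i) => ki; first by rewrite add0n ltnNge (ltnW ki).
  by rewrite add1n ltnS ki.
rewrite ratio_expm1E mulrA.
apply: (mulIr (unit_Psi (mom 2 0) (mom 0 2 - mom 2 0))).
by rewrite mulrVK ?unit_Psi// mulrBr mulr1 {1}E; ring.
Qed.

Lemma egf_F : F = Q_series mom (kap 2) c c'.
Proof.
apply: (@fps_ode_uniq _ _ _ (log_deriv_Q mom (kap 2) c c')).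
- by rewrite Q_series0 /= F_0// divr1.
- rewrite fps_deriv_egf.
  transitivity ((kap 2 + c * c')%:S * F
   - l11 * (c%:S * egf (Xseq tracef c c') + c'%:S * egf (Xseq tracef c' c))
   + (mom 1 1 ^+ 2)%:S * (t * egf (Nseq tracef c c') + U)
   + (mom 2 0 * mom 0 2)%:S * V
   + (mom 2 2 - 2 * mom 1 1 ^+ 2 - mom 2 0 * mom 0 2)%:S * (t * F)).
    rewrite -!egf_shift -!egfZ -!egfD -!egfZ -!egfN -!egfD; apply: eq_egf => n.
    exact: F_rec.
  rewrite (egf_N _ _ (trace_expands K)) !egf_X_trace egf_col egf_row.
  have -> : egf (Fseq c' c) = F by apply: eq_egf => n; exact: Fseq_sym.
  rewrite /log_deriv_Q fps_constX fps_constM -[1%:S]/(1 : fps K).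
  ring.
exact: Q_series_deriv.
Qed.

Local Notation L := ((mom 2 1 + mom 1 2)%:S * (t ^+ 2 / 2)).

Lemma sum_pair_momE (n : nat) (u : nat -> K) :
  (\sum_(i < n.+1) \sum_(k < n) pair_mom wo x y i (lift i k) 2 1) * u n.-1 =
  2^-1 * (mom 2 1 + mom 1 2) * (n.+1%:R * (n%:R * u n.-1)).
Proof.
have n2 : 2 != 0 :> K by rewrite pnatr_eq0.
apply: (mulfI n2); rewrite [LHS]mulrA (sum_pair_mom wo x y n 2 1) !mulrA divff// mul1r; ring.
Qed.

Lemma egf_L (u : nat -> K) :
  egf (fun n => 2^-1 * (mom 2 1 + mom 1 2) * (n%:R * (n.-1%:R * u n.-2))) =
  L * egf u.
Proof.
rewrite egfZ (egf_shift (fun n => n%:R * u n.-1)) egf_shift fps_constM.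
have -> : (2^-1 : K)%:S = 2^-1.
  apply: (mulrI (fps_two_unit K)); rewrite divrr ?fps_two_unit//.
  by rewrite -{1}(fps_const_nat K 2) -fps_constM divff// pnatr_eq0.
ring.
Qed.

Lemma egf_Y_det : egf (Yseq detf c c') =
  F * (L + c'%:S * t / D - (c * mom 1 1)%:S * t ^+ 2 / D).
Proof.
transitivity (t * egf (Nseq detf c c') + L * F).
  rewrite -egf_L -egf_shift -egfD; apply: eq_egf => -[|n].
    by rewrite Y_0// !mul0r mulr0 addr0.
  rewrite (Y_rec mom00 kap0 mom10 mom01 kap1 (det_expands K)) -addrA.
  (* The determinant has no linear terms in an inserted row or column, so the sums with [al] and
     [be] vanish. *)
  rewrite [X in _ + (X + _)]big1 ?add0r; last first.
    move=> i _; rewrite !big1 ?mulr0 ?addr0// => k _; rewrite EE_mulr0 ?mulr0//.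
  by rewrite sum_pair_momE.
rewrite (egf_N _ _ (det_expands K)) fps_constM.
have -> : egf (Xseq detf c c') = F by [].
by rewrite fps_const0 mul0r add0r; ring.
Qed.

End Fixed.

Lemma egf_X_ones c c' : egf (Xseq onesf c c') = egf (Yseq detf c' c).
Proof. by apply: eq_egf => n; apply: EE_ext => M; rewrite mulrC. Qed.

(** The second-moment sums of [Y_rec] are those in the recursions of [row_seq] and [col_seq], which
    also contain [Fseq]; subtracting it for each vertex gives the two terms in [t]. *)
Lemma egf_Y_ones c c' : egf (Yseq onesf c c') =
  t * egf (Nseq onesf c c')
  + (egf (fun n => \sum_(i < n) row_seq wo wd x y z c c' i) - t * egf (Fseq c c'))
  + (egf (fun n => \sum_(i < n) col_seq wo wd x y z c c' i) - t * egf (Fseq c c'))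
  + (mom 2 1 + mom 1 2)%:S * (t ^+ 2 / 2) * egf (Xseq onesf c c').
Proof.
rewrite -egf_L -!egf_shift -!egfN -!egfD; apply: eq_egf => -[|n].
  by rewrite Y_0// !big_ord0 !mul0r mulr0 subrr !addr0.
rewrite (Y_rec mom00 kap0 mom10 mom01 kap1 (ones_expands K)) sum_pair_momE.
congr (_ + _); rewrite -addrA; congr (_ + _).
rewrite big_split /= !natr_sum_ord -!sumrB; congr (_ + _); apply: eq_bigr => i _.
  by rewrite row_seq_rec// [X in X - _]addrC addrK.
by rewrite col_seq_rec// [X in X - _]addrC addrK.
Qed.

Theorem model_series a1 a2 c1 c2 :
  egf (fun n => EE (fun M : 'M[K]_n =>
    \det (M + a1 *: const_mx 1 + c1%:M) * \det (M + a2 *: const_mx 1 + c2%:M))) =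
  P_series mom a1 a2 c1 c2 * Q_series mom (kap 2) c1 c2.
Proof.
transitivity (egf (Fseq c1 c2) + a1%:S * egf (Yseq detf c1 c2)
  + a2%:S * egf (Xseq onesf c1 c2) + (a1 * a2)%:S * egf (Yseq onesf c1 c2)).
  rewrite -!egfZ -!egfD; apply: eq_egf => n.
  rewrite -!EE_Z -!EE_D; apply: EE_ext => M.
  rewrite (addrAC M (a1 *: _)) (addrAC M (a2 *: _)) !det_add_ones /det_fun /ones_fun; ring.
rewrite egf_Y_ones (egf_N _ _ (ones_expands K)) egf_col egf_row egf_X_ones.
rewrite !egf_Y_det.
have -> : egf (Fseq c2 c1) = egf (Fseq c1 c2) by apply: eq_egf => n; exact: Fseq_sym.
rewrite egf_F mulrC; move: (Q_series _ _ _ _) => Q.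
rewrite /P_series.
have := divrr (unit_lin (mom 1 1)).
move: j ((1 - l11 * t)^-1) (ratio_expm1 mom) (t ^+ 2 / 2) => i i1 R h.
rewrite !(fps_constM, fps_constD) -![1%:S]/(1 : fps K) => /eqP.
rewrite -subr_eq0 => /eqP; set r := _ - 1 => r0.
(* The column sum contributes [t * i1 - t], written [l11 * t ^+ 2 * i1] in [P_series]; the two
   differ by [t * r]. *)
rewrite -[LHS]addr0; have -> : 0 = - (Q * a1%:S * a2%:S * t * r).
  by rewrite r0 mulr0 oppr0.
by rewrite /r; ring.
Qed.

End ModelSeries.

(** * Matching moments *)

Section Interpolation.
Variable K : numFieldType.

(* Coefficients of the Lagrange basis of the nodes -1, 0, 1. *)
Definition lagrange (a : 'I_3) (p : nat) : K :=
  nth 0 (nth [::] [:: [:: 0; - 2^-1; 2^-1]; [:: 1; 0; -1]; [:: 0; 2^-1; 2^-1]] a) p.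

Definition node (a : 'I_3) : K := a%:R - 1.

(** The functional X^p Y^q -> m p q evaluated at the Lagrange polynomial of a pair of nodes. Three
    nodes per variable reproduce all degrees up to 2. *)
Definition interp (m : nat -> nat -> K) (a : 'I_3 * 'I_3) : K :=
  \sum_(p < 3) \sum_(q < 3) lagrange a.1 p * lagrange a.2 q * m p q.

Lemma lagrangeP (p k : nat) : (p < 3)%N -> (k < 3)%N ->
  \sum_(a < 3) lagrange a p * node a ^+ k = (p == k)%:R.
Proof.
have n2 : 2 != 0 :> K by rewrite pnatr_eq0.
rewrite !big_ord_recr big_ord0 /lagrange /node /=.
by case: p => [|[|[|//]]] _; case: k => [|[|[|//]]] _ /=; field.
Qed.

Lemma interp_mom m k l : (k < 3)%N -> (l < 3)%N ->
  \sum_a interp m a * (node a.1 ^+ k * node a.2 ^+ l) = m k l.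
Proof.
move=> k3 l3.
transitivity (\sum_(p < 3) \sum_(q < 3) m p q *
   ((\sum_(a < 3) lagrange a p * node a ^+ k) *
    (\sum_(b < 3) lagrange b q * node b ^+ l))).
  rewrite -(pair_bigA _ (fun a b => interp m (a, b) * (node a ^+ k * node b ^+ l))) /=.
  transitivity (\sum_(a < 3) \sum_(b < 3) \sum_(p < 3) \sum_(q < 3)
     m p q * ((lagrange a p * node a ^+ k) * (lagrange b q * node b ^+ l))).
    apply: eq_bigr => a _; apply: eq_bigr => b _; rewrite mulr_suml.
    apply: eq_bigr => p _; rewrite mulr_suml; apply: eq_bigr => q _ /=; ring.
  under [LHS]eq_bigr => a _ do rewrite exchange_big /=.
  rewrite exchange_big; apply: eq_bigr => p _ /=.
  under [LHS]eq_bigr => a _ do rewrite exchange_big /=.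
  rewrite exchange_big; apply: eq_bigr => q _ /=.
  under eq_bigr => a _ do rewrite -mulr_sumr -mulr_sumr.
  by rewrite -mulr_sumr -mulr_suml.
rewrite (bigD1 (Ordinal k3))//= [X in _ + X]big1 ?addr0 => [|p pk]; last first.
  rewrite big1// => q _; rewrite lagrangeP// -(inj_eq val_inj) /= in pk *.
  by rewrite (negbTE pk) mul0r mulr0.
rewrite (bigD1 (Ordinal l3))//= [X in _ + X]big1 ?addr0 => [|q ql]; last first.
  rewrite !lagrangeP// -(inj_eq val_inj) /= in ql *.
  by rewrite (negbTE ql) !mulr0.
by rewrite !lagrangeP// !eqxx !mulr1.
Qed.

End Interpolation.

(** * Expectation of a product of independent variables *)

Section IndependentProducts.
Context d (T : measurableType d) (R : realType) (P : probability T R).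
Local Open Scope ereal_scope.
Import HBNNSimple.

Lemma integral_mul_simple (G Y : T -> R) (f : {nnsfun (measurableTypeR R) >-> R}) :
  measurable_fun setT G -> measurable_fun setT Y -> (forall w, (0 <= G w)%R) ->
  \int[P]_w (G w * f (Y w))%:E =
  \sum_(k \in range f) k%:E *
     \int[P]_w (G w * \1_(Y @^-1` (f @^-1` [set k])) w)%:E.
Proof.
move=> mG mY G0.
have mI k : measurable (Y @^-1` (f @^-1` [set k])).
  rewrite -(setTI (_ @^-1` _)); apply: mY => //.
  by rewrite -(setTI (_ @^-1` _)); apply: (measurable_funP f) => //; exact: measurable_set1.
transitivity (\int[P]_w \sum_(k \in range f)
    (k * (G w * \1_(Y @^-1` (f @^-1` [set k])) w))%:E).
  apply: eq_integral => w _; rewrite (fimfunE f (Y w)). rewrite mulrC fsumEFin//.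
  congr (_%:E); rewrite !fsbig_finite// mulr_suml; apply: eq_bigr => k _.
  by rewrite mulrAC -mulrA.
rewrite ge0_integral_fsum//.
- apply: eq_fsbigr => k; rewrite inE => -[y _ <-].
  under eq_integral do rewrite EFinM.
  rewrite ge0_integralZl_EFin//.
  + by move=> w _; rewrite lee_fin mulr_ge0.
  + by apply/measurable_EFinP/measurable_funM => //; exact: measurable_indic.
- move=> k; apply/measurable_EFinP/measurable_funM => //.
  by apply: measurable_funM => //; exact: measurable_indic.
(* Here [k] is any real: it may be negative, but then the indicator vanishes. *)
- move=> k w _; rewrite lee_fin mulrCA mulr_ge0//.
  rewrite indicE; have [wk|_] := boolP (w \in Y @^-1` (f @^-1` [set k])).
    by rewrite mulr1; move: wk; rewrite inE /= => <-.
  by rewrite mulr0.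
Qed.

(* Passes from indicators to nonnegative functions of [Y], hence trades one event
   for one factor in the product rule. *)
Lemma integral_mul_step (G Y : T -> R) (c : R) :
  measurable_fun setT G -> measurable_fun setT Y ->
  (forall w, (0 <= G w)%R) -> (forall w, (0 <= Y w)%R) -> (0 <= c)%R ->
  (forall B : set (measurableTypeR R), measurable B ->
    \int[P]_w (G w * \1_(Y @^-1` B) w)%:E = c%:E * P (Y @^-1` B)) ->
  \int[P]_w (G w * Y w)%:E = c%:E * \int[P]_w (Y w)%:E.
Proof.
move=> mG mY G0 Y0 c0 H.
(* The absolute value is nonnegative on the whole line and agrees with the identity on the values of
   [Y]. *)
have mN : measurable_fun [set: measurableTypeR R] (fun y : measurableTypeR R => `|y|%:E).
  by apply/measurable_EFinP; exact: normr_measurable.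
pose f_ := nnsfun_approx measurableT mN.
(* Monotone convergence, used with [F = G] on one side and with the constant [c] on the other. *)
have fY (F : T -> R) : measurable_fun setT F -> (forall w, (0 <= F w)%R) ->
    \int[P]_w (F w * Y w)%:E = limn (fun n => \int[P]_w (F w * f_ n (Y w))%:E).
  move=> mF F0; rewrite -monotone_convergence//.
  - apply: eq_integral => w _; apply/esym/cvg_lim => //.
    have cv : EFin \o f_^~ (Y w) @ \oo --> (`|Y w|%:E : \bar R).
      exact: cvg_nnsfun_approx.
    rewrite ger0_norm// in cv.
    have -> : (fun n => (F w * f_ n (Y w))%:E) = (fun n => (F w)%:E * (EFin \o f_^~ (Y w)) n).
      by apply/funext => n; rewrite EFinM.
    by rewrite EFinM; apply: cvgeZl.
  - move=> n; apply/measurable_EFinP/measurable_funM => //.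
    exact: (measurableT_comp (measurable_funP (f_ n)) mY).
  - by move=> n w _; rewrite lee_fin mulr_ge0.
  - move=> w _ m n mn; rewrite lee_fin ler_wpM2l//.
    by have /lefP/(_ (Y w)) := nd_nnsfun_approx measurableT mN mn.
rewrite fY// -ge0_integralZl_EFin//; last first.
- exact/measurable_EFinP.
- by move=> w _; rewrite lee_fin.
under [RHS]eq_integral do rewrite -EFinM.
rewrite (fY (cst c))//; congr (limn _); apply/funext => n.
rewrite !integral_mul_simple//; apply: eq_fsbigr => k _; congr (_ * _).
rewrite H//.
have mI : measurable (Y @^-1` (f_ n @^-1` [set k])).
  rewrite -(setTI (_ @^-1` _)); apply: mY => //.
  by rewrite -(setTI (_ @^-1` _)); apply: (measurable_funP (f_ n)) => //; exact: measurable_set1.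
under [RHS]eq_integral do rewrite EFinM.
rewrite ge0_integralZl_EFin// ?integral_indic// ?setIT//.
by apply/measurable_EFinP; exact: measurable_indic.
Qed.

Lemma expectation_prod_ge0 (S : finType) (Y : S -> T -> R) :
  (forall s, measurable_fun setT (Y s)) -> (forall s w, (0 <= Y s w)%R) ->
  (forall s, \int[P]_w (Y s w)%:E < +oo) ->
  (forall B : S -> set (measurableTypeR R), (forall s, measurable (B s)) ->
    P (\bigcap_(s in [set: S]) Y s @^-1` B s) = (\prod_s P (Y s @^-1` B s))%E) ->
  \int[P]_w (\prod_s Y s w)%:E = (\prod_s fine (\int[P]_w (Y s w)%:E))%:E.
Proof.
move=> mY Y0 Yoo indep.
have mI s (B : set (measurableTypeR R)) : measurable B -> measurable (Y s @^-1` B).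
  by move=> mB; rewrite -[X in measurable X]setTI; exact: mY.
(* Interpolates between indicators, for which the claim is the hypothesis, and the variables
   themselves: those listed in [l] have already replaced their events. *)
pose h (l : seq S) (B : S -> set (measurableTypeR R)) s w : R :=
  if s \in l then Y s w else \1_(Y s @^-1` B s) w.
pose v (l : seq S) (B : S -> set (measurableTypeR R)) s : R :=
  if s \in l then fine (\int[P]_w (Y s w)%:E) else fine (P (Y s @^-1` B s)).
have h0 l B s w : (0 <= h l B s w)%R.
  by rewrite /h; case: ifP.
have v0 l B s : (0 <= v l B s)%R.
  rewrite /v; case: ifP => _; apply: fine_ge0 => //.
  by apply: integral_ge0 => w _; rewrite lee_fin.
have mh l B s : (forall s, measurable (B s)) -> measurable_fun setT (h l B s).
  move=> mB; have -> : h l B s = if s \in l then Y s else \1_(Y s @^-1` B s).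
    by apply/funext => w; rewrite /h; case: ifP.
  case: ifP => _; first exact: mY.
  by apply: measurable_indic; exact: mI.
suff main l : uniq l -> forall B, (forall s, measurable (B s)) ->
    \int[P]_w (\prod_s h l B s w)%:E = (\prod_s v l B s)%:E.
  have := main (enum S) (enum_uniq S) (fun=> setT) (fun=> measurableT).
  have -> : (\prod_s v (enum S) (fun=> setT) s)%R =
      (\prod_s fine (\int[P]_w (Y s w)%:E))%R.
    by apply: eq_bigr => s _; rewrite /v mem_enum.
  move=> <-; apply: eq_integral => w _; congr (_%:E).
  by apply: eq_bigr => s _; rewrite /h mem_enum.
elim: l => [_|a l IHl] /=.
  move=> B mB.
  transitivity (\int[P]_w (\1_(\bigcap_(s in [set: S]) Y s @^-1` B s) w)%:E).
    apply: eq_integral => w _; congr (_%:E); rewrite indicE.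
    have [wB|wB] := boolP (w \in \bigcap_(s in [set: S]) Y s @^-1` B s).
      rewrite big1// => s _; rewrite /h in_nil indicE mem_set//.
      by move: wB; rewrite inE => /(_ s Logic.I).
    apply/eqP/prodf_eq0.
    have /existsNP[s /not_implyP[_ ws]] : ~ (\bigcap_(s in [set: S]) Y s @^-1` B s) w.
      by move=> H; move: wB; rewrite mem_set.
    by exists s => //; rewrite /h in_nil indicE memNset.
  have mcap : measurable (\bigcap_(s in [set: S]) Y s @^-1` B s).
    by apply: fin_bigcap_measurable => // s _; exact: mI.
  rewrite integral_indic// setIT; apply: etrans; first exact: (indep B mB).
  rewrite -prodEFin; apply: eq_bigr => s _.
  by rewrite /v in_nil fineK// fin_num_measure//; exact: mI.
move=> /andP[al ul] B mB.
pose G w := (\prod_(s | s != a) h l B s w)%R.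
pose c := (\prod_(s | s != a) v l B s)%R.
transitivity (\int[P]_w (G w * Y a w)%:E).
  apply: eq_integral => w _; congr (_%:E); rewrite (bigD1 a)//= mulrC.
  rewrite {2}/h mem_head; congr (_ * _)%R; apply: eq_bigr => s sa.
  by rewrite /h in_cons (negbTE sa).
rewrite (integral_mul_step (c := c))//.
- rewrite (bigD1 a)//= {1}/v mem_head mulrC EFinM fineK; last first.
    rewrite ge0_fin_numE//; apply: integral_ge0 => w _; by rewrite lee_fin.
  congr ((_)%:E * _); apply: eq_bigr => s sa.
  by rewrite /v in_cons (negbTE sa).
- have -> : G = (fun w => \prod_(s <- [seq s <- index_enum S | s != a]) h l B s w)%R.
    by apply/funext => w; rewrite /G -big_filter.
  by apply: measurable_prod => s _; exact: mh.
- by move=> w; apply: prodr_ge0.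
- by apply: prodr_ge0.
(* The event of [a] is still free, so the induction hypothesis with [B0] there is the premise of
   [integral_mul_step]. *)
move=> B0 mB0; pose B' s := if s == a then B0 else B s.
have mB' s : measurable (B' s) by rewrite /B'; case: ifP.
transitivity (\int[P]_w (\prod_s h l B' s w)%:E).
  apply: eq_integral => w _; congr (_%:E); rewrite (bigD1 a)//= mulrC.
  rewrite {1}/h (negbTE al) /B' eqxx; congr (_ * _)%R; apply: eq_bigr => s sa.
  by rewrite /h (negbTE sa).
rewrite IHl// (bigD1 a)//= {1}/v (negbTE al) /B' eqxx mulrC EFinM fineK; last first.
  by rewrite fin_num_measure//; exact: mI.
congr (_%:E * _); apply: eq_bigr => s sa.
by rewrite /v (negbTE sa).
Qed.

End IndependentProducts.

(** * Integration of complex random variables *)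

Section ComplexExpectation.
Context d (T : measurableType d) (R : realType) (P : probability T R).
Local Notation C := R[i].
Local Notation Re := complex.Re.
Local Notation Im := complex.Im.
Local Notation CE := (complex_expectation P).
Implicit Types (X Y : T -> C) (c : C) (f g : T -> R).

Definition rexp f : R := fine (\int[P]_w (f w)%:E)%E.

Definition rint f : Prop := P.-integrable setT (EFin \o f).

Definition cint X : Prop :=
  rint (fun w => Re (X w)) /\ rint (fun w => Im (X w)).

Lemma rintD f g : rint f -> rint g -> rint (fun w => f w + g w).
Proof.
move=> Hf Hg; rewrite /rint.
by rewrite (_ : _ \o _ = (EFin \o f) \+ (EFin \o g))%E; [exact: integrableD | apply/funext].
Qed.

Lemma rintZ (k : R) f : rint f -> rint (fun w => k * f w).
Proof.
move=> Hf; rewrite /rint.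
by rewrite (_ : _ \o _ = (fun w => k%:E * (EFin \o f) w)%E); [exact: integrableZl | apply/funext].
Qed.

Lemma rexpD f g : rint f -> rint g ->
  rexp (fun w => f w + g w) = rexp f + rexp g.
Proof. by move=> Hf Hg; exact: RintegralD. Qed.

Lemma rexpZ (k : R) f : rint f -> rexp (fun w => k * f w) = k * rexp f.
Proof. by move=> Hf; exact: RintegralZl. Qed.

Lemma eq_rint f g : f =1 g -> rint f -> rint g.
Proof. by move=> /funext ->. Qed.

Lemma eq_cint X Y : X =1 Y -> cint X -> cint Y.
Proof. by move=> /funext ->. Qed.

Lemma CE_E X : CE X = rexp (fun w => Re (X w)) +i* rexp (fun w => Im (X w)).
Proof. by rewrite /complex_expectation unlock. Qed.

Lemma ReD (u v : C) : Re (u + v) = Re u + Re v.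
Proof. by case: u v => [a b] [c e]. Qed.
Lemma ImD (u v : C) : Im (u + v) = Im u + Im v.
Proof. by case: u v => [a b] [c e]. Qed.
Lemma ReM (u v : C) : Re (u * v) = Re u * Re v + - Im u * Im v.
Proof. by case: u v => [a b] [c e] /=; rewrite mulNr. Qed.
Lemma ImM (u v : C) : Im (u * v) = Re u * Im v + Im u * Re v.
Proof. by case: u v => [a b] [c e]. Qed.

Lemma cintD X Y : cint X -> cint Y -> cint (fun w => X w + Y w).
Proof.
move=> [Xr Xi] [Yr Yi]; split.
  by apply: eq_rint (rintD Xr Yr) => w; rewrite ReD.
by apply: eq_rint (rintD Xi Yi) => w; rewrite ImD.
Qed.

Lemma CE_D X Y : cint X -> cint Y -> CE (fun w => X w + Y w) = CE X + CE Y.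
Proof.
move=> [Xr Xi] [Yr Yi]; rewrite !CE_E.
have -> : (fun w => Re (X w + Y w)) = (fun w => Re (X w) + Re (Y w)).
  by apply/funext => w; rewrite ReD.
have -> : (fun w => Im (X w + Y w)) = (fun w => Im (X w) + Im (Y w)).
  by apply/funext => w; rewrite ImD.
by rewrite !rexpD.
Qed.

Lemma cintZ c X : cint X -> cint (fun w => c * X w).
Proof.
move=> [Xr Xi]; split.
  by apply: eq_rint (rintD (rintZ (Re c) Xr) (rintZ (- Im c) Xi)) => w; rewrite ReM.
by apply: eq_rint (rintD (rintZ (Re c) Xi) (rintZ (Im c) Xr)) => w; rewrite ImM.
Qed.

Lemma CE_Z c X : cint X -> CE (fun w => c * X w) = c * CE X.
Proof.
move=> [Xr Xi]; rewrite !CE_E.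
have -> : (fun w => Re (c * X w)) = (fun w => Re c * Re (X w) + - Im c * Im (X w)).
  by apply/funext => w; rewrite ReM.
have -> : (fun w => Im (c * X w)) = (fun w => Re c * Im (X w) + Im c * Re (X w)).
  by apply/funext => w; rewrite ImM.
rewrite !rexpD ?rexpZ//; try exact: rintZ.
by case: c => a b /=; rewrite mulNr.
Qed.

Lemma rint0 : rint (fun=> 0).
Proof. exact: integrable0. Qed.

Lemma cint0 : cint (fun=> 0).
Proof. by split; exact: rint0. Qed.

Lemma CE_0 : CE (fun=> 0) = 0.
Proof.
rewrite CE_E /rexp /=.
by under eq_integral do []; rewrite integral0.
Qed.

Lemma cint_sum (I : Type) (s : seq I) (X : I -> T -> C) :
  (forall k, cint (X k)) -> cint (fun w => \sum_(k <- s) X k w).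
Proof.
move=> HX; elim: s => [|k s IHs].
  by apply: eq_cint cint0 => w; rewrite big_nil.
by apply: eq_cint (cintD (HX k) IHs) => w; rewrite big_cons.
Qed.

Lemma CE_sum (I : Type) (s : seq I) (X : I -> T -> C) :
  (forall k, cint (X k)) ->
  CE (fun w => \sum_(k <- s) X k w) = \sum_(k <- s) CE (X k).
Proof.
move=> HX; elim: s => [|k s IHs].
  by rewrite big_nil -[RHS]CE_0; congr CE; apply/funext => w; rewrite big_nil.
rewrite big_cons -IHs -CE_D//; last exact: cint_sum.
by congr CE; apply/funext => w; rewrite big_cons.
Qed.

Lemma cint_real f : rint f -> cint (fun w => (f w)%:C).
Proof. by split => //; exact: rint0. Qed.

Lemma CE_real f : rint f -> CE (fun w => (f w)%:C) = (rexp f)%:C.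
Proof.
by move=> Hf; rewrite CE_E; congr (_ +i* _); rewrite /rexp integral0.
Qed.

(* The four nonnegative parts of a complex number, see [partE]; they reduce the
   product rule to nonnegative variables. *)
Definition part (e : 'I_4) (u : C) : R :=
  Num.max (nth 0 [:: Re u; Im u; - Re u; - Im u] e) 0.

Lemma part_ge0 e u : 0 <= part e u.
Proof. by rewrite /part le_max lexx orbT. Qed.

Lemma partE u : u = \sum_(e < 4) (0 +i* 1) ^+ e * (part e u)%:C.
Proof.
rewrite !big_ord_recl big_ord0 /part /= /bump /= !add1n !expr0 !exprS !expr0.
have E (x : R) : Num.max x 0 - Num.max (- x) 0 = x.
  rewrite /Num.max; case: (ltrgtP x 0) => [x0|x0|->].
  - by rewrite oppr_lt0 ltNge (ltW x0) /= sub0r opprK.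
  - by rewrite oppr_lt0 x0 subr0.
  - by rewrite oppr0 ltxx subr0.
case: u => a b /=; rewrite -{1}(E a) -{1}(E b).
by apply/eqP; rewrite eq_complex !(ReD, ImD, ReM, ImM) /=; apply/andP; split; apply/eqP; ring.
Qed.

Lemma rint_part X e : cint X -> rint (fun w => part e (X w)).
Proof.
move=> [Xr Xi].
have H f : rint f -> rint (fun w => Num.max (f w) 0).
  move=> Hf; apply: le_integrable (Hf) => //.
    apply/measurable_EFinP/measurable_maxr => //.
    by have /integrableP[/measurable_EFinP] := Hf.
  move=> w _ /=; rewrite lee_fin ger0_norm ?le_max ?lexx ?orbT// ge_max normr_ge0 andbT.
  exact: ler_norm.
have N f : rint f -> rint (fun w => - f w).
  by move=> Hf; apply: eq_rint (rintZ (-1) Hf) => w; rewrite mulN1r.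
case: e => -[|[|[|[|//]]]] /= i; apply: H => //; exact: N.
Qed.

Lemma CE_part X : cint X ->
  CE X = \sum_(e < 4) (0 +i* 1) ^+ e * (rexp (fun w => part e (X w)))%:C.
Proof.
move=> HX; transitivity (CE (fun w => \sum_(e < 4) (0 +i* 1) ^+ e * (part e (X w))%:C)).
  by congr CE; apply/funext => w; exact: partE.
have Hp e := cint_real (rint_part e HX).
rewrite CE_sum; last by move=> e; exact: cintZ.
by apply: eq_bigr => e _; rewrite CE_Z// CE_real//; exact: rint_part.
Qed.

(** Distributing the product over the four parts of each factor leaves products of nonnegative
    variables, one part per index; independence is therefore asked only for such choices. *)
Lemma CE_prod (S : finType) (X : S -> T -> C) :
  (forall s, cint (X s)) ->
  (forall (e : S -> 'I_4) (B : S -> set (measurableTypeR R)),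
    (forall s, measurable (B s)) ->
    P (\bigcap_(s in [set: S]) (fun w => part (e s) (X s w)) @^-1` B s) =
    (\prod_s P ((fun w => part (e s) (X s w)) @^-1` B s))%E) ->
  cint (fun w => \prod_s X s w) /\
  CE (fun w => \prod_s X s w) = \prod_s CE (X s).
Proof.
move=> HX indep.
pose W (e : {ffun S -> 'I_4}) w := \prod_s part (e s) (X s w).
have mpart s e : measurable_fun setT (fun w => part e (X s w)).
  by have /integrableP[/measurable_EFinP] := rint_part e (HX s).
have mpartE s e : measurable_fun setT (fun w => (part e (X s w))%:E).
  by have /integrableP[] := rint_part e (HX s).
have WE e : (\int[P]_w (W e w)%:E = (\prod_s rexp (fun w => part (e s) (X s w)))%:E)%E.
  apply: (@expectation_prod_ge0 _ _ _ P S (fun s w => part (e s) (X s w))) => //.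
  - by move=> s w; exact: part_ge0.
  - move=> s; have /integrableP[_] := rint_part (e s) (HX s).
    apply: le_lt_trans; apply: ge0_le_integral => //.
    + by move=> w _; rewrite lee_fin part_ge0.
    + by apply: measurableT_comp => //; exact: mpartE.
    + by move=> w _; rewrite lee_fin ler_norm.
  - by move=> B mB; exact: (indep (fun s => e s)).
have Wint e : rint (W e).
  apply/integrableP; split.
    by apply/measurable_EFinP; apply: measurable_prod.
  rewrite (eq_integral (fun w => (W e w)%:E)); first by rewrite WE ltry.
  by move=> w _; rewrite /= ger0_norm// prodr_ge0// => s _; exact: part_ge0.
have XE : (fun w => \prod_s X s w) = (fun w => \sum_(e : {ffun S -> 'I_4})
    (\prod_s (0 +i* 1) ^+ (e s)) * (W e w)%:C).
  apply/funext => w; under eq_bigr do rewrite [X _ _]partE.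
  rewrite bigA_distr_bigA; apply: eq_bigr => e _.
  by rewrite big_split /= /W rmorph_prod.
rewrite XE; split.
  by apply: cint_sum => e; apply: cintZ; exact: cint_real.
rewrite CE_sum => [|e]; last by apply: cintZ; exact: cint_real.
under [RHS]eq_bigr do rewrite CE_part//.
rewrite bigA_distr_bigA; apply: eq_bigr => e _.
rewrite CE_Z; last exact: cint_real.
by rewrite CE_real// /rexp WE /= big_split /= rmorph_prod.
Qed.

End ComplexExpectation.

Section ChangeOfVariables.
Context d (T : measurableType d) (R : realType) (P : probability T R).
Context d' (E : measurableType d') (law : probability E R) (Z : T -> E).
Hypothesis mZ : measurable_fun setT Z.
Hypothesis Zlaw : forall A, measurable A -> P (Z @^-1` A) = law A.

Let Zm : {mfun T >-> E} := HB.pack Z (isMeasurableFun.Build _ _ _ _ Z mZ).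

Lemma rint_law (g : E -> R) : rint law g ->
  rint P (fun w => g (Z w)) /\ rexp P (fun w => g (Z w)) = rexp law g.
Proof.
move=> /integrableP[mg goo].
have pushE (h : E -> \bar R) : (\int[law]_x h x = \int[pushforward P Zm]_x h x)%E.
  by apply: eq_measure_integral => A mA _; rewrite /= -Zlaw.
have ig : P.-integrable setT ((EFin \o g) \o Z).
  apply/integrableP; split; first exact: measurableT_comp.
  move: goo; rewrite pushE ge0_integral_pushforward//.
  exact: measurableT_comp.
split; first exact: ig.
by rewrite /rexp pushE (@integral_pushforward _ _ _ _ _ Zm)// preimage_setT.
Qed.

Lemma CE_law (f : E -> R[i]) : cint law f ->
  cint P (fun w => f (Z w)) /\
  complex_expectation P (fun w => f (Z w)) = complex_expectation law f.
Proof.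
move=> [/rint_law[fr frE] /rint_law[fi fiE]]; split; first by split.
by rewrite !CE_E frE fiE.
Qed.

End ChangeOfVariables.

Lemma prod_pairs (K : comNzRingType) n (G : 'I_n -> 'I_n -> K) :
  \prod_i \prod_j G i j =
  (\prod_(p : upper_index n) (G (val p).1 (val p).2 * G (val p).2 (val p).1)) *
  \prod_j G j j.
Proof.
rewrite big_split /=.
have sub (F : 'I_n -> 'I_n -> K) :
    \prod_(p : upper_index n) F (val p).1 (val p).2 =
    \prod_(i < n) \prod_(j < n) (if (i < j)%N then F i j else 1).
  rewrite (pair_bigA _ (fun i j : 'I_n => if (i < j)%N then F i j else 1)) /=.
  rewrite -big_mkcond (reindex_omap (val : upper_index n -> _) insub) /=.
    by apply: eq_bigl => -[p pp] /=; rewrite insubT pp /= eqxx.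
  by move=> p pp; rewrite insubT.
rewrite (sub G) (sub (fun i j => G j i)).
have diag : \prod_j G j j = \prod_i \prod_(j < n) (if i == j then G i j else 1).
  apply: eq_bigr => i _; rewrite (bigD1 i)//= eqxx big1 ?mulr1// => j /negbTE ji.
  by rewrite eq_sym ji.
rewrite diag [X in _ * X * _]exchange_big -!big_split; apply: eq_bigr => i _ /=.
rewrite -!big_split; apply: eq_bigr => j _ /=.
case: (ltngtP i j) => [ij|ij|/val_inj ->]; rewrite ?eqxx ?mul1r ?mulr1//.
  by case: eqP => [E|]; rewrite ?mulr1//; rewrite E ltnn in ij.
by case: eqP => [E|]; rewrite ?mulr1//; rewrite E ltnn in ij.
Qed.

(** * Measurability and integrability of low powers *)

Section ComplexMeasurability.
Variable R : realType.
Local Notation C := R[i].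
Local Notation Re := complex.Re.
Local Notation Im := complex.Im.

Lemma measurable_Re : measurable_fun [set: C] (fun z : C => Re z : measurableTypeR R).
Proof.
move=> _ B mB; rewrite setTI; exists (B `*` setT).
  exact: measurableX.
rewrite setTI; apply/seteqP; split => [z [] //|z zB]; by split.
Qed.

Lemma measurable_Im : measurable_fun [set: C] (fun z : C => Im z : measurableTypeR R).
Proof.
move=> _ B mB; rewrite setTI; exists (setT `*` B).
  exact: measurableX.
rewrite setTI; apply/seteqP; split => [z [] //|z zB]; by split.
Qed.

Definition cmeas (f : C -> C) : Prop :=
  measurable_fun [set: C] (fun z => Re (f z) : measurableTypeR R) /\
  measurable_fun [set: C] (fun z => Im (f z) : measurableTypeR R).

Lemma cmeas_id : cmeas id.
Proof. by split; [exact: measurable_Re | exact: measurable_Im]. Qed.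

Lemma cmeas_cst c : cmeas (fun=> c).
Proof. by split; exact: measurable_cst. Qed.

Lemma cmeas_conj f : cmeas f -> cmeas (fun z => (f z)^*).
Proof.
move=> [mr mi]; split.
  by rewrite (_ : (fun z => _) = fun z => Re (f z))//; apply/funext => z; case: (f z).
rewrite (_ : (fun z => _) = fun z => - Im (f z)); first exact: measurableT_comp.
by apply/funext => z; case: (f z).
Qed.

Lemma cmeasM f g : cmeas f -> cmeas g -> cmeas (fun z => f z * g z).
Proof.
move=> [fr fi] [gr gi]; split.
  rewrite (_ : (fun z => _) = fun z => Re (f z) * Re (g z) + - Im (f z) * Im (g z)).
    apply: measurable_funD; first exact: measurable_funM.
    by apply: measurable_funM => //; exact: measurableT_comp.
  by apply/funext => z; rewrite ReM.
rewrite (_ : (fun z => _) = fun z => Re (f z) * Im (g z) + Im (f z) * Re (g z)).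
  by apply: measurable_funD; exact: measurable_funM.
by apply/funext => z; rewrite ImM.
Qed.

Lemma cmeasX f k : cmeas f -> cmeas (fun z => f z ^+ k).
Proof.
move=> mf; elim: k => [|k IHk]; first exact: cmeas_cst.
rewrite (_ : (fun z => _) = fun z => f z * f z ^+ k); first exact: cmeasM.
by apply/funext => z; rewrite exprS.
Qed.

Local Notation normc := ComplexField.Normc.normc.

Lemma normcX (u : C) k : normc (u ^+ k) = normc u ^+ k.
Proof.
elim: k => [|k IHk]; first by rewrite !expr0 ComplexField.Normc.normc1.
by rewrite !exprS ComplexField.Normc.normcM IHk.
Qed.

Lemma normc_conj (u : C) : normc u^* = normc u.
Proof. by case: u => a b /=; rewrite sqrrN. Qed.

Lemma normc_pos (u : C) : 0 <= normc u.
Proof. by case: u => a b /=; exact: sqrtr_ge0. Qed.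

Lemma ler_Re_normc (u : C) : `|Re u| <= normc u.
Proof.
case: u => a b /=; rewrite -sqrtr_sqr; apply: ler_wsqrtr.
by rewrite lerDl sqr_ge0.
Qed.

Lemma ler_Im_normc (u : C) : `|Im u| <= normc u.
Proof.
case: u => a b /=; rewrite -sqrtr_sqr; apply: ler_wsqrtr.
by rewrite lerDr sqr_ge0.
Qed.

Lemma expr_le_1D4 (x : R) k : 0 <= x -> (k <= 4)%N -> x ^+ k <= 1 + x ^+ 4.
Proof.
move=> x0 k4; have [x1|x1] := leP x 1.
  by rewrite (le_trans (exprn_ile1 _ x0 x1))// lerDl exprn_ge0.
by rewrite (le_trans (ler_weXn2l (ltW x1) k4))// lerDr.
Qed.

Lemma measurable_normc4 : measurable_fun [set: C] (fun z => normc z ^+ 4 : measurableTypeR R).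
Proof.
rewrite (_ : (fun z => _) = fun z => (Re z ^+ 2 + Im z ^+ 2) ^+ 2).
  apply: measurable_funX; apply: measurable_funD.
    by apply: measurable_funX; exact: measurable_Re.
  by apply: measurable_funX; exact: measurable_Im.
apply/funext => -[a b] /=.
by rewrite -[4%N]/(2 * 2)%N exprM sqr_sqrtr// addr_ge0// sqr_ge0.
Qed.

Variable mu : probability C R.
Hypothesis mu4 : (\int[mu]_z (normc z ^+ 4)%:E < +oo)%E.

(** Dominated by [1 + normc z ^+ 4], since the total degree is at most 4. *)
Lemma cint_monomial k l : (k <= 2)%N -> (l <= 2)%N ->
  cint mu (fun z => z ^+ k * (z^*) ^+ l).
Proof.
move=> k2 l2.
have dom : rint mu (fun z => 1 + normc z ^+ 4).
  apply: rintD.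
    by apply: finite_measure_integrable_cst.
  apply/integrableP; split; first by apply/measurable_EFinP; exact: measurable_normc4.
  rewrite (eq_integral (fun z => (normc z ^+ 4)%:E))// => z _ /=.
  by rewrite ger0_norm// exprn_ge0// normc_pos.
have bd (z : C) : normc (z ^+ k * (z^*) ^+ l) <= 1 + normc z ^+ 4.
  rewrite ComplexField.Normc.normcM !normcX normc_conj -exprD.
  by rewrite expr_le_1D4 ?normc_pos//; exact: (leq_add k2 l2).
have [mr mi] : cmeas (fun z => z ^+ k * (z^*) ^+ l).
  by apply: cmeasM; apply: cmeasX; [exact: cmeas_id | apply: cmeas_conj; exact: cmeas_id].
split.
- apply: le_integrable dom => //; first exact/measurable_EFinP.
  move=> z _ /=; rewrite lee_fin (le_trans (ler_Re_normc _))// (le_trans (bd z))//.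
  exact: ler_norm.
- apply: le_integrable dom => //; first exact/measurable_EFinP.
  move=> z _ /=; rewrite lee_fin (le_trans (ler_Im_normc _))// (le_trans (bd z))//.
  exact: ler_norm.
Qed.

Variable nu : probability (measurableTypeR R) R.
Hypothesis nu2 : (\int[nu]_x (x ^+ 2)%:E < +oo)%E.

Lemma rint_power k : (k <= 2)%N -> rint nu (fun x : measurableTypeR R => (x : R) ^+ k).
Proof.
move=> k2.
have dom : rint nu (fun x : measurableTypeR R => 1 + (x : R) ^+ 2).
  apply: rintD.
    by apply: finite_measure_integrable_cst.
  apply/integrableP; split; first by apply/measurable_EFinP; exact: measurable_funX.
  rewrite (eq_integral (fun x : measurableTypeR R => ((x : R) ^+ 2)%:E))// => x _ /=.
  by rewrite ger0_norm// sqr_ge0.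
apply: le_integrable dom => //.
  by apply/measurable_EFinP; exact: measurable_funX.
move=> x _ /=; rewrite lee_fin; apply: le_trans (ler_norm _).
rewrite normrX; have [x1|x1] := leP `|x| 1.
  by rewrite (le_trans (exprn_ile1 _ _ x1))// lerDl sqr_ge0.
by rewrite (le_trans (ler_weXn2l (ltW x1) k2))// real_normK ?num_real// lerDr.
Qed.

(** The general polynomial of degree at most 2: the way a single entry occurs in one term of the
    product of two determinants. *)
Definition quad (al : nat -> C) (u : C) : C := \sum_(k < 3) al k * u ^+ k.

Lemma quad_pair al be (u v : C) : quad al u * quad be v =
  \sum_(k < 3) \sum_(l < 3) (al k * be l) * (u ^+ k * v ^+ l).
Proof.
rewrite mulr_suml; apply: eq_bigr => k _; rewrite mulr_sumr.
by apply: eq_bigr => l _; rewrite mulrACA.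
Qed.

Lemma cint_quad_pair al be : cint mu (fun z => quad al z * quad be z^*) /\
  complex_expectation mu (fun z => quad al z * quad be z^*) =
  \sum_(k < 3) \sum_(l < 3) (al k * be l) * lambda_moment mu k l.
Proof.
have E : (fun z => quad al z * quad be z^*) = (fun z =>
    \sum_(k < 3) \sum_(l < 3) (al k * be l) * (z ^+ k * (z^*) ^+ l)).
  by apply/funext => z; exact: quad_pair.
have H (k l : 'I_3) : cint mu (fun z => z ^+ k * (z^*) ^+ l).
  by apply: cint_monomial; rewrite -ltnS ltn_ord.
rewrite E; split.
  by apply: cint_sum => k; apply: cint_sum => l; exact: cintZ.
rewrite CE_sum; last by move=> k; apply: cint_sum => l; exact: cintZ.
apply: eq_bigr => k _; rewrite CE_sum; last by move=> l; exact: cintZ.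
by apply: eq_bigr => l _; rewrite CE_Z.
Qed.

Lemma cint_quad_diag al : cint nu (fun x : measurableTypeR R => quad al (x : R)%:C) /\
  complex_expectation nu (fun x : measurableTypeR R => quad al (x : R)%:C) =
  \sum_(k < 3) al k * (kappa_moment nu k)%:C.
Proof.
have E : (fun x : measurableTypeR R => quad al (x : R)%:C) =
    (fun x => \sum_(k < 3) al k * ((x : R) ^+ k)%:C).
  apply/funext => x; apply: eq_bigr => k _; by rewrite rmorphXn.
have H (k : 'I_3) : rint nu (fun x : measurableTypeR R => (x : R) ^+ k).
  by apply: rint_power; rewrite -ltnS ltn_ord.
rewrite E; split.
  by apply: cint_sum => k; apply: cintZ; exact: cint_real.
rewrite CE_sum; last by move=> k; apply: cintZ; exact: cint_real.
apply: eq_bigr => k _; rewrite CE_Z; last exact: cint_real.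
by rewrite CE_real// /kappa_moment unlock.
Qed.

End ComplexMeasurability.

(** * From the random matrix to the model *)

Section HermitianEntries.
Context d (T : measurableType d) (R : realType) (P : probability T R).
Local Notation C := R[i].
Variables (mu : probability C R) (nu : probability (measurableTypeR R) R).
Hypothesis mu4 : (\int[mu]_z (ComplexField.Normc.normc z ^+ 4)%:E < +oo)%E.
Hypothesis nu2 : (\int[nu]_x (x ^+ 2)%:E < +oo)%E.

(** Independence of the two families is stated for generated sigma-algebras; this brings joint
    events of finitely many entries within its reach. *)
Lemma sigma_family_bigcap d' (E : measurableType d') (I : finType)
    (X : I -> T -> E) (A : I -> set E) : (forall i, measurable (A i)) ->
  sigma_family X (\bigcap_(i in [set: I]) X i @^-1` A i).
Proof.
move=> mA; rewrite /sigma_family; set G := (X in <<s X >>).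
apply: (@fin_bigcap_measurable _ (g_sigma_algebraType G) _ setT
  (fun i => X i @^-1` A i)) => // i _.
by apply: sub_sigma_algebra; exists i; exists (A i).
Qed.

Lemma mutually_independentT d' (E : measurableType d') (I : finType)
    (X : I -> T -> E) (A : I -> set E) : mutually_independent P X ->
  (forall i, measurable (A i)) ->
  P (\bigcap_(i in [set: I]) X i @^-1` A i) = (\prod_i P (X i @^-1` A i))%E.
Proof.
move=> indep mA; have := indep [set: I]%SET A mA.
rewrite (_ : [set` [set: I]%SET] = [set: I]); last first.
  by apply/seteqP; split => i //= _; rewrite finset.in_setT.
by move=> ->; apply: eq_bigl => i; rewrite finset.in_setT.
Qed.

Variables (n : nat) (Z : T -> 'M[C]_n).
Hypothesis HZ : random_hermitian P mu nu Z.

Lemma hermitian_prod_expectation (al : 'I_n -> 'I_n -> nat -> C) :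
  cint P (fun w => \prod_i \prod_j quad (al i j) (Z w i j)) /\
  complex_expectation P (fun w => \prod_i \prod_j quad (al i j) (Z w i j)) =
  (\prod_(p : upper_index n) complex_expectation mu (fun z =>
     quad (al (val p).1 (val p).2) z * quad (al (val p).2 (val p).1) z^*)) *
  \prod_j complex_expectation nu (fun x : measurableTypeR R =>
     quad (al j j) (x : R)%:C).
Proof.
have [Zconj Zdiag [mU lawU indU] [mD lawD indD] indDU] := HZ.
pose f (p : upper_index n) (z : C) :=
  quad (al (val p).1 (val p).2) z * quad (al (val p).2 (val p).1) z^*.
pose g (j : 'I_n) (x : measurableTypeR R) := quad (al j j) (x : R)%:C.
have cf p : cint mu (f p) by have [] := cint_quad_pair mu4 (al (val p).1 (val p).2)
   (al (val p).2 (val p).1).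
have cg j : cint nu (g j) by have [] := cint_quad_diag nu2 (al j j).
(* One index for each independent source: an entry above the diagonal, grouped with its conjugate,
   or a diagonal entry. *)
pose X (s : upper_index n + 'I_n) w := match s with
  | inl p => f p (upper_entries Z p w) | inr j => g j (diagonal_entries Z j w) end.
have ZX : (fun w => \prod_i \prod_j quad (al i j) (Z w i j)) = (fun w => \prod_s X s w).
  apply/funext => w; rewrite prod_pairs big_sumType /=; congr (_ * _).
    by apply: eq_bigr => p _; rewrite /f /upper_entries (Zconj w _ _ (valP p)).
  apply: eq_bigr => j _; rewrite /g /diagonal_entries.
  congr (quad _ _); move: (Zdiag w j); by case: (Z w j j) => a b /= ->.
have lawUp p := CE_law (mU p) (lawU p) (cf p).
have lawDj j := CE_law (mD j) (lawD j) (cg j).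
have cX s : cint P (X s).
  by case: s => [p|j]; [have [] := lawUp p | have [] := lawDj j].
rewrite ZX; have [|cP ->] := CE_prod cX.
  move=> e B mB.
  pose AU p := (fun z => part (e (inl p)) (f p z)) @^-1` B (inl p).
  pose AD j := (fun x => part (e (inr j)) (g j x)) @^-1` B (inr j).
  have mAU p : measurable (AU p).
    have /integrableP[/measurable_EFinP mf _] := rint_part (e (inl p)) (cf p).
    by rewrite -[X in measurable X]setTI; exact: (mf measurableT _ (mB (inl p))).
  have mAD j : measurable (AD j).
    have /integrableP[/measurable_EFinP mf _] := rint_part (e (inr j)) (cg j).
    by rewrite -[X in measurable X]setTI; exact: (mf measurableT _ (mB (inr j))).
  rewrite [RHS]big_sumType /= muleC.
  transitivity (P ((\bigcap_(j in [set: 'I_n]) diagonal_entries Z j @^-1` AD j) `&`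
     (\bigcap_(p in [set: upper_index n]) upper_entries Z p @^-1` AU p))).
    congr (P _); apply/seteqP; split => w /=.
      by move=> H; split => [j _|p _]; [exact: (H (inr j)) | exact: (H (inl p))].
    by move=> [HD HU] [p|j] _; [exact: (HU p) | exact: (HD j)].
  rewrite indDU; [|exact: sigma_family_bigcap..].
  by rewrite (mutually_independentT indD mAD) (mutually_independentT indU mAU).
split=> //; rewrite big_sumType /=; congr (_ * _).
  by apply: eq_bigr => p _; have [_ ->] := lawUp p.
by apply: eq_bigr => j _; have [_ ->] := lawDj j.
Qed.

End HermitianEntries.

(** * The product of two determinants as a polynomial in the entries *)

Section DeterminantExpansion.
Variables (R : realType) (n : nat) (a1 a2 c1 c2 : R[i]).
Local Notation C := R[i].

Definition shift_entry (a c : C) (i j : 'I_n) : C := a + c *+ (i == j).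

(** Coefficients by increasing degree; the default 0 of [nth] pads the shorter lists. *)
Definition pair_coef (u : 'S_n * 'S_n) (i j : 'I_n) : nat -> C :=
  let b1 := shift_entry a1 c1 i j in let b2 := shift_entry a2 c2 i j in
  nth 0 (if u.1 i == j then if u.2 i == j then [:: b1 * b2; b1 + b2; 1]
                            else [:: b1; 1]
         else if u.2 i == j then [:: b2; 1] else [:: 1]).

Lemma quad_pair_coef u i j (v : C) : quad (pair_coef u i j) v =
  (if u.1 i == j then v + shift_entry a1 c1 i j else 1) *
  (if u.2 i == j then v + shift_entry a2 c2 i j else 1).
Proof.
rewrite /quad /pair_coef !big_ord_recr big_ord0 /=.
by case: eqP => _; case: eqP => _ /=; ring.
Qed.

(** Padding by ones to a product over all positions lets the terms of two permutations be multiplied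
    entry by entry. *)
Lemma prod_perm_entries (s : 'S_n) (a c : C) (M : 'M[C]_n) :
  \prod_i (M + a *: const_mx 1 + c%:M) i (s i) =
  \prod_i \prod_j (if s i == j then M i j + shift_entry a c i j else 1).
Proof.
apply: eq_bigr => i _; rewrite (bigD1 (s i))//= eqxx big1 ?mulr1.
  by rewrite !mxE mulr1 addrA.
by move=> j /negbTE sj; rewrite eq_sym sj.
Qed.

Lemma det_mul_det (M : 'M[C]_n) :
  \det (M + a1 *: const_mx 1 + c1%:M) * \det (M + a2 *: const_mx 1 + c2%:M) =
  \sum_(u : 'S_n * 'S_n) ((-1) ^+ u.1 * (-1) ^+ u.2) *
    \prod_i \prod_j quad (pair_coef u i j) (M i j).
Proof.
rewrite -(pair_bigA _ (fun s1 s2 : 'S_n => ((-1) ^+ s1 * (-1) ^+ s2) *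
    \prod_i \prod_j quad (pair_coef (s1, s2) i j) (M i j))) /=.
rewrite mulr_suml; apply: eq_bigr => s1 _; rewrite mulr_sumr.
apply: eq_bigr => s2 _; rewrite !prod_perm_entries mulrACA; congr (_ * _).
rewrite -big_split; apply: eq_bigr => i _ /=; rewrite -big_split.
by apply: eq_bigr => j _; rewrite quad_pair_coef.
Qed.

End DeterminantExpansion.

Section MatchedModel.
Variables (R : realType) (mu : probability R[i] R).
Variable nu : probability (measurableTypeR R) R.
Local Notation C := R[i].
Hypothesis mu4 : (\int[mu]_z (ComplexField.Normc.normc z ^+ 4)%:E < +oo)%E.
Hypothesis nu2 : (\int[nu]_x (x ^+ 2)%:E < +oo)%E.

Definition off_weight : 'I_3 * 'I_3 -> C := interp (lambda_moment mu).
(** The model has a single type of atoms, so the diagonal law is extended to pairs with the moments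
    of a second coordinate equal to 0. *)
Definition diag_weight : 'I_3 * 'I_3 -> C :=
  interp (fun p q => if q == 0%N then (kappa_moment nu p)%:C else 0).
Definition node1 (a : 'I_3 * 'I_3) : C := node C a.1.
Definition node2 (a : 'I_3 * 'I_3) : C := node C a.2.

Local Notation mom := (mom off_weight node1 node2).
Local Notation kap := (kap diag_weight node1).
Local Notation EE := (EE off_weight diag_weight node1 node2 node1).

Lemma mom_match k l : (k < 3)%N -> (l < 3)%N -> mom k l = lambda_moment mu k l.
Proof. by move=> k3 l3; exact: interp_mom. Qed.

Lemma kap_match k : (k < 3)%N -> kap k = (kappa_moment nu k)%:C.
Proof.
move=> k3.
transitivity (\sum_a diag_weight a * (node C a.1 ^+ k * node C a.2 ^+ 0)).
  by apply: eq_bigr => a _; rewrite expr0 mulr1.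
exact: (interp_mom (fun p q => if q == 0%N then (kappa_moment nu p)%:C else 0)).
Qed.

Lemma lambda00 : lambda_moment mu 0 0 = 1.
Proof.
rewrite /lambda_moment (_ : (fun z => _) = fun=> (1 : R)%:C); last first.
  by apply/funext => z; rewrite !expr0 mulr1.
rewrite CE_real; last exact: finite_measure_integrable_cst.
by have := @expectation_cst _ _ _ mu 1; rewrite unlock /rexp /= => ->.
Qed.

Lemma kappa0 : kappa_moment nu 0 = 1.
Proof.
rewrite /kappa_moment (_ : (fun x => _) = cst 1); last by apply/funext.
by rewrite expectation_cst.
Qed.

Lemma lambda01 : lambda_moment mu 1 0 = 0 -> lambda_moment mu 0 1 = 0.
Proof.
have [Hr Hi] := @cint_monomial _ mu mu4 1 0 isT isT.
rewrite /lambda_moment !CE_E => /eqP; rewrite eq_complex /= => /andP[/eqP r0 /eqP i0].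
have -> : (fun z : C => complex.Re (z ^+ 0 * z^* ^+ 1)) =
    (fun z => complex.Re (z ^+ 1 * z^* ^+ 0)).
  by apply/funext => z; rewrite expr0 mul1r mulr1 !expr1; case: z.
have -> : (fun z : C => complex.Im (z ^+ 0 * z^* ^+ 1)) =
    (fun z => -1 * complex.Im (z ^+ 1 * z^* ^+ 0)).
  by apply/funext => z; rewrite expr0 mul1r mulr1 !expr1 mulN1r; case: z.
by rewrite rexpZ// r0 i0 mulr0.
Qed.

Context d (T : measurableType d) (P : probability T R) (n : nat) (Z : T -> 'M[C]_n).
Hypothesis HZ : random_hermitian P mu nu Z.

(** Both sides factor over conjugate pairs and diagonal entries, and each factor involves only
    matched moments. *)
Lemma EE_match (al : 'I_n -> 'I_n -> nat -> C) :
  complex_expectation P (fun w => \prod_i \prod_j quad (al i j) (Z w i j)) =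
  EE (fun M => \prod_i \prod_j quad (al i j) (M i j)).
Proof.
have [_ ->] := hermitian_prod_expectation mu4 nu2 HZ al.
have m00 : mom 0 0 = 1 by rewrite mom_match// lambda00.
rewrite (EE_prod _ _ m00 (fun i j => quad (al i j))) prod_pairs.
congr (_ * _).
  apply: eq_bigr => -[[i j] /= ij] _; rewrite ij ltnNge (ltnW ij) /=.
  have -> : (j == i) = false by apply/eqP => E; rewrite E ltnn in ij.
  rewrite mulr1; have [_ ->] := cint_quad_pair mu4 (al i j) (al j i).
  under [RHS]eq_bigr => a _ do rewrite quad_pair mulr_sumr.
  rewrite [RHS]exchange_big; apply: eq_bigr => k _ /=.
  under [RHS]eq_bigr => a _ do rewrite mulr_sumr.
  rewrite [RHS]exchange_big; apply: eq_bigr => l _ /=.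
  rewrite -mom_match// mulr_sumr; apply: eq_bigr => a _; ring.
apply: eq_bigr => j _; rewrite ltnn eqxx.
have [_ ->] := cint_quad_diag nu2 (al j j).
under [RHS]eq_bigr => a _ do rewrite mulr_sumr.
rewrite [RHS]exchange_big; apply: eq_bigr => k _ /=.
rewrite -kap_match// mulr_sumr; apply: eq_bigr => a _; ring.
Qed.

Lemma expectation_det_match (a1 a2 c1 c2 : C) :
  complex_expectation P (fun w =>
    \det (Z w + a1 *: const_mx 1 + c1%:M) * \det (Z w + a2 *: const_mx 1 + c2%:M)) =
  EE (fun M : 'M[C]_n => \det (M + a1 *: const_mx 1 + c1%:M) *
               \det (M + a2 *: const_mx 1 + c2%:M)).
Proof.
have -> : (fun w => \det (Z w + a1 *: const_mx 1 + c1%:M) *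
      \det (Z w + a2 *: const_mx 1 + c2%:M)) =
    (fun w => \sum_(u : 'S_n * 'S_n) ((-1) ^+ u.1 * (-1) ^+ u.2) *
      \prod_i \prod_j quad (pair_coef a1 a2 c1 c2 u i j) (Z w i j)).
  by apply/funext => w; exact: det_mul_det.
have H u : cint P (fun w => \prod_i \prod_j quad (pair_coef a1 a2 c1 c2 u i j) (Z w i j)).
  by have [] := hermitian_prod_expectation mu4 nu2 HZ (pair_coef a1 a2 c1 c2 u).
rewrite CE_sum => [|u]; last exact: cintZ.
rewrite (EE_ext _ _ _ _ _ (@det_mul_det R n a1 a2 c1 c2)) EE_sum.
by apply: eq_bigr => u _; rewrite CE_Z// EE_Z EE_match.
Qed.

End MatchedModel.

Theorem theorem12 (R : realType)
    (mu : probability R[i] R) (nu : probability (measurableTypeR R) R)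
    (d : nat -> measure_display) (T : forall n : nat, measurableType (d n))
    (P : forall n : nat, probability (T n) R)
    (Z : forall n : nat, T n -> 'M[R[i]]_n)
    (Z_hermitian : forall n : nat, random_hermitian (P n) mu nu (Z n))
    (mu_moment4 : (\int[mu]_z (ComplexField.Normc.normc z ^+ 4)%:E < +oo)%E)
    (nu_moment2 : (\int[nu]_x (x ^+ 2)%:E < +oo)%E)
    (mu_centered : lambda_moment mu 1 0 = 0)
    (nu_centered : kappa_moment nu 1 = 0)
    (a1 a2 c1 c2 : R) :
  H2_series P Z a1 a2 c1 c2 =
  P_series (lambda_moment mu) a1%:C a2%:C c1%:C c2%:C *
  Q_series (lambda_moment mu) (kappa_moment nu 2)%:C c1%:C c2%:C.
Proof.
have m k l := @mom_match R mu k l.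
have mom00 : mom (off_weight mu) (@node1 R) (@node2 R) 0 0 = 1.
  by rewrite m// lambda00.
have mom10 : mom (off_weight mu) (@node1 R) (@node2 R) 1 0 = 0 by rewrite m.
have mom01 : mom (off_weight mu) (@node1 R) (@node2 R) 0 1 = 0.
  by rewrite m// lambda01.
have kap0 : kap (diag_weight nu) (@node1 R) 0 = 1 by rewrite kap_match// kappa0.
have kap1 : kap (diag_weight nu) (@node1 R) 1 = 0.
  by rewrite kap_match// nu_centered.
transitivity (egf (fun n => EE (off_weight mu) (diag_weight nu) (@node1 R)
    (@node2 R) (@node1 R) (fun M : 'M[R[i]]_n =>
    \det (M + a1%:C *: const_mx 1 + c1%:C%:M) *
    \det (M + a2%:C *: const_mx 1 + c2%:C%:M)))).
  apply: fpsP => n; rewrite /= mulrC; congr (_ * _).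
  exact: (expectation_det_match mu_moment4 nu_moment2 (Z_hermitian n)).
apply: etrans.
  exact: (model_series mom00 kap0 mom10 mom01 kap1 a1%:C a2%:C c1%:C c2%:C).
(* The moment functions agree only for indices below 3, so the moments occurring in the series are
   replaced one by one. *)
rewrite (kap_match nu (k := 2) isT) /P_series /Q_series /ratio_expm1 /ratio_const.
rewrite (m 1%N 1%N isT isT) (m 2%N 0%N isT isT) (m 0%N 2%N isT isT).
by rewrite (m 2%N 1%N isT isT) (m 1%N 2%N isT isT) (m 2%N 2%N isT isT).
Qed.
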